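(* Suppose that $d=\varepsilon q^{l/2}$ and $a=\varepsilon q^{\alpha+l/2}$, where $\varepsilon=\pm1$ and $\alpha,l\in\mathbb{N}$, let $\max(|b|,|c|)<1$, and let $k\in\mathbb{N}$, $k\le\alpha$. (I) For each $j=1,2,\dots,k$ pick $\delta_j=a$ and $$\phi^{(j)}(\lambda_\gamma)\in\mathrm{span}\{u^{1,m_j}(\lambda_\gamma),u^{2,m_j}(\lambda_\gamma)\}\qquad(\ast)$$ with $m_j\in\{0,1,\dots,\alpha-1\}$ and $m_j\ne m_i$ for $j\ne i$. Then for generic $\{\phi^{(j)}(\lambda_\gamma)\}$ as in $(\ast)$, the polynomials $\hat p_n(x)=\chi_n\mathrm{Wr}_n(\psi^{(1)}_n,\dots,\psi^{(k)}_n,p_n(x))$, with $\psi^{(j)}_n=\phi^{(j)}(\lambda_n)/\xi^a_n$, are orthogonal with respect to a complex measure of the form $$d\hat\mu=\frac{d\mu_{\varepsilon q^{\alpha+l/2},b,c,\varepsilon q^{l/2}}}{\prod_{j=1}^k(x-x_{m_j})}+\sum_{j=1}^k\nu_j\,\delta(x-x_{m_j}),\qquad x_{m_j}=\frac{\varepsilon}{2}\left(q^{m_j+l/2}+q^{-m_j-l/2}\right),\qquad(\ast\ast)$$ for some $\nu_1,\dots,\nu_k\in\mathbb{C}$. (II) Conversely, if $m_1,\dots,m_k\in\{0,1,\dots,\alpha-1\}$ are distinct numbers, then for generic complex numbers $\nu_1,\dots,\nu_k$ one can pick, with $\delta_j=a$ for every $j$, an appropriate $\phi^{(j)}(\lambda_\gamma)$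 as in $(\ast)$ for every $j=1,\dots,k$ so that the polynomials $\{\hat p_n(x)\}_{n=0}^\infty$ given by the formula in (I) are orthogonal with respect to the complex measure $d\hat\mu$ in $(\ast\ast)$.
   Context: $q\in(0,1)$; $(u;q)_n=\prod_{l=0}^{n-1}(1-uq^l)$, $(u;q)_\infty=\prod_{l\ge0}(1-uq^l)$, $(u_1,\dots,u_j;q)_n=\prod_i(u_i;q)_n$ (similarly for $n=\infty$); ${}_4\phi_3\left[{a_1,a_2,a_3,a_4\atop b_1,b_2,b_3};q,q\right]=\sum_{l\ge0}\frac{(a_1,a_2,a_3,a_4;q)_l}{(b_1,b_2,b_3,q;q)_l}q^l$. The parameters are nonzero, satisfy $\max(|a|,|b|,|c|,|d|)<1$, and are such that the expressions below are well defined. Askey-Wilson polynomials: $p_n(x)=p_n(x;a,b,c,d)=\frac{(ab,ac,ad;q)_n}{a^n}\,{}_4\phi_3\left[{q^{-n},\,abcdq^{n-1},\,az,\,az^{-1}\atop ab,\,ac,\,ad};q,q\right]$, $x=\frac12(z+\frac1z)$. The Askey-Wilson measure $\mu_{a,b,c,d}$ on $[-1,1]$ is $d\mu_{a,b,c,d}=\frac{w(x;a,b,c,d)}{2\pi\sqrt{1-x^2}}dx$, $w(x;a,b,c,d)=\frac{(z^2,z^{-2};q)_\infty}{(az,a/z,bz,b/z,cz,c/z,dz,d/z;q)_\infty}$. $\delta(x-x_0)$ denotes the unit point mass at $x_0$. $\lambda_\gamma=(q^{-\gamma}-1)(1-abcdq^{\gamma-1})$. For $m=0,1,\dots,\alpha-1$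 let $$u^{1,m}(\lambda_\gamma)={}_4\phi_3\left[{q^{m-\alpha+1},\ q^{-m+\alpha+1}/a^2,\ q^{\gamma+1},\ 1/(abcdq^{\gamma-2})\atop q^2/(ab),\ q^2/(ac),\ q^2/(ad)};q,q\right],$$ $$u^{2,m}(\lambda_\gamma)=\frac{(bcq^\gamma,q^{\gamma+1};q)_{\alpha+l-1}}{(q^\gamma)^{\alpha+l-1}}\,{}_4\phi_3\left[{q^{-\gamma},\ abcdq^{\gamma-1},\ q^{m+l},\ q^{-m}\atop ad,\ bd,\ cd};q,q\right];$$ these are polynomials in $\lambda_\gamma$. $\xi^a_n=\frac{q^n(abcd/q;q)_n}{a^n(bc,bd,cd,q;q)_n}$ (extended meromorphically in $n$; it vanishes at negative integers $n$). $\mathrm{Wr}_n(h^{(1)}_n,\dots,h^{(m)}_n)=\det(h^{(i)}_{n-j+1})_{1\le i,j\le m}$. Since all $\delta_j=a$, the normalizing factor is $\chi_n=\prod_{j=1}^{k+1}\xi^a_{n-j+1}$, so that $\hat p_n(x)=\mathrm{Wr}_n(\phi^{(1)}(\lambda_n),\dots,\phi^{(k)}(\lambda_n),\xi^a_np_n(x))$, where $\xi^a_mp_m(x):=0$ for $m<0$. Put $\tau_n=\mathrm{Wr}_n(\phi^{(1)}(\lambda_n),\dots,\phi^{(k)}(\lambda_n))$. ''Generic $\phi^{(j)}$'' means generic so that the standing conditions $\tau_n\ne0$ for $n=-1,0,1,\dots$ and $\chi_n\xi^a_{n-k-1}/\chi_{n-1}=\xi^a_n\neq0$ for $n=0,1,\dots$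 hold. ''Generic $(\nu_1,\dots,\nu_k)$'' is understood as outside a countable union of proper algebraic subsets of $\mathbb{C}^k$. Orthogonal with respect to a complex measure is meant in the bilinear sense: $\int\hat p_n\hat p_m\,d\hat\mu=0$ for $n\ne m$ and $\ne0$ for $n=m$, with $\deg \hat p_n=n$.
   Formalization: In (II) it is additionally assumed that λ_{-1},…,λ_{-k} are pairwise distinct; if two of them coincide then τ_{-1}=0 for every choice of φ^{(j)}, so p̂_0=0 and (II) fails (e.g. l=1, α=k=2, bc=q). *)

(* Defs.v *)
From HB Require Import structures.
From mathcomp Require Import all_boot all_order all_algebra.
From mathcomp Require Import all_classical all_reals all_analysis.
From mathcomp Require Import complex ring.
From mathcomp Require mpoly.

Set Implicit Arguments.
Unset Strict Implicit.
Unset Printing Implicit Defensive.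

Import Order.TTheory GRing.Theory Num.Theory.
Import numFieldNormedType.Exports.

Local Open Scope classical_set_scope.
Local Open Scope ring_scope.
Local Open Scope complex_scope.

Section ComplexAnalysis.
Context {R : realType}.

(* R[i] carries no canonical topology: limits and integrals of complex-valued
   functions are taken componentwise. *)
Definition climn (u : nat -> R[i]) : R[i] :=
  limn (fun n => complex.Re (u n)) +i* limn (fun n => complex.Im (u n)).

Definition cintegral (f : R -> R[i]) : R[i] :=
  (\int[lebesgue_measure]_(x in `[-1, 1]) complex.Re (f x))
  +i* (\int[lebesgue_measure]_(x in `[-1, 1]) complex.Im (f x)).

End ComplexAnalysis.

Section QSeries.
Context {R : realType}.
Implicit Types (q : R) (u : R[i]) (us : seq R[i]).

Definition qpoch q u (n : nat) : R[i] := \prod_(j < n) (1 - u * q%:C ^+ j).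

Definition qpoch_inf q u : R[i] := climn (qpoch q u).

Definition qpochs q us (n : nat) : R[i] := \prod_(u <- us) qpoch q u n.

Definition qpochs_inf q us : R[i] := \prod_(u <- us) qpoch_inf q u.

(* The series (r+1)phi(r) [top; bot; q, q]. If some entry of top is q^(-N), the
   terms of index > N have a zero numerator, so they vanish even if their
   denominator does (x / 0 = 0): a terminating series is the sum of its first
   N + 1 terms, as usual. *)
Definition qhyp q (top bot : seq R[i]) : R[i] :=
  climn (fun N => \sum_(s < N)
    qpochs q top s / qpochs q (rcons bot q%:C) s * q%:C ^+ s).

Lemma qhyp_perm q top top' bot : perm_eq top top' ->
  qhyp q top bot = qhyp q top' bot.
Proof.
move=> tt; rewrite /qhyp; congr climn; apply/funext => N.
by apply: eq_bigr => s _; rewrite /qpochs (perm_big _ tt).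
Qed.

End QSeries.

Section AskeyWilson.
Context {R : realType}.
Variables (q : R) (a b c d : R[i]).

(* A solution z of x = (z + 1/z) / 2; the other one is 1/z. *)
Definition joukowski_inv (x : R[i]) : R[i] := x + sqrtC (x ^+ 2 - 1).

Definition askey_wilson_z (n : nat) (z : R[i]) : R[i] :=
  qpochs q [:: a * b; a * c; a * d] n / a ^+ n *
  qhyp q [:: q%:C ^- n; a * b * c * d * q%:C ^ (n%:Z - 1); a * z; a * z^-1]
         [:: a * b; a * c; a * d].

Definition askey_wilson (n : nat) (x : R[i]) : R[i] :=
  askey_wilson_z n (joukowski_inv x).

Definition aw_weight (x : R) : R[i] :=
  let z := joukowski_inv x%:C in
  qpochs_inf q [:: z ^+ 2; z ^- 2] /
  qpochs_inf q [:: a * z; a / z; b * z; b / z; c * z; c / z; d * z; d / z].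

Definition aw_integral (f : R -> R[i]) : R[i] :=
  cintegral (fun x =>
    f x * (aw_weight x / (2 * pi * Num.sqrt (1 - x ^+ 2))%:C)).

Definition aw_eigenvalue (gamma : int) : R[i] :=
  (q%:C ^ (- gamma) - 1) * (1 - a * b * c * d * q%:C ^ (gamma - 1)).

Definition u1 (alpha m : nat) (gamma : int) : R[i] :=
  qhyp q
    [:: q%:C ^ (m%:Z - alpha%:Z + 1);
        q%:C ^ (- m%:Z + alpha%:Z + 1) / a ^+ 2;
        q%:C ^ (gamma + 1);
        (a * b * c * d * q%:C ^ (gamma - 2))^-1]
    [:: q%:C ^+ 2 / (a * b); q%:C ^+ 2 / (a * c); q%:C ^+ 2 / (a * d)].

Definition u2 (alpha l m : nat) (gamma : int) : R[i] :=
  qpochs q [:: b * c * q%:C ^ gamma; q%:C ^ (gamma + 1)] (alpha + l - 1)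
  / (q%:C ^ gamma) ^+ (alpha + l - 1) *
  qhyp q
    [:: q%:C ^ (- gamma); a * b * c * d * q%:C ^ (gamma - 1);
        q%:C ^+ (m + l); q%:C ^- m]
    [:: a * d; b * d; c * d].

Definition in_span_u (alpha l m : nat) (phi : {poly R[i]}) : Prop :=
  exists A B : R[i], forall gamma : int,
    phi.[aw_eigenvalue gamma] = A * u1 alpha m gamma + B * u2 alpha l m gamma.

(* The factor 1/(q;q)_n makes xi vanish at negative integers. *)
Definition xi (n : int) : R[i] :=
  match n with
  | Posz n => q%:C ^+ n * qpoch q (a * b * c * d / q%:C) n
              / (a ^+ n * qpochs q [:: b * c; b * d; c * d; q%:C] n)
  | Negz _ => 0
  end.

Definition xi_askey_wilson (x : R[i]) (n : int) : R[i] :=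
  match n with
  | Posz n => xi n * askey_wilson n x
  | Negz _ => 0
  end.

Definition wronskian (m : nat) (h : m.-tuple (int -> R[i])) (n : int) : R[i] :=
  \det (\matrix_(i < m, j < m) tnth h i (n - j%:Z)).

Definition phi_lambda (k : nat) (phi : 'I_k -> {poly R[i]}) :
    k.-tuple (int -> R[i]) :=
  [tuple (fun n => (phi j).[aw_eigenvalue n]) | j < k].

Definition tau (k : nat) (phi : 'I_k -> {poly R[i]}) (n : int) : R[i] :=
  wronskian (phi_lambda phi) n.

(* chi_n Wr_n(psi^(1), ..., psi^(k), p_n) with the factors xi cleared column by
   column, which makes sense for all n >= 0; see phatE for n >= k. *)
Definition phat (k : nat) (phi : 'I_k -> {poly R[i]}) (n : int) (x : R[i]) :
    R[i] :=
  wronskian [tuple of rcons (phi_lambda phi) (xi_askey_wilson x)] n.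

(* The columns of tau phi (-1) are the values at aw_eigenvalue (-1), ...,
   aw_eigenvalue (-k): it vanishes for every phi if two of these coincide. *)
Definition standing_conditions (k : nat) (phi : 'I_k -> {poly R[i]}) : Prop :=
  (forall n : int, -1 <= n -> tau phi n != 0) /\
  (forall n : int, 0 <= n -> xi n != 0).

Lemma joukowski_invK (x : R[i]) :
  (joukowski_inv x + (joukowski_inv x)^-1) / 2 = x.
Proof.
have E : joukowski_inv x * (x - sqrtC (x ^+ 2 - 1)) = 1.
  by rewrite mulrC -subr_sqr sqrtCK opprB addrC subrK.
have w0 : joukowski_inv x != 0.
  by apply/eqP => w0; move/eqP: E; rewrite w0 mul0r eq_sym oner_eq0.
have -> : (joukowski_inv x)^-1 = x - sqrtC (x ^+ 2 - 1).
  by apply: (mulfI w0); rewrite mulfV// E.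
by rewrite /joukowski_inv addrACA subrr addr0 -mulr2n -(mulr_natr x 2) mulfK// pnatr_eq0.
Qed.

Lemma askey_wilsonE (n : nat) (z : R[i]) : z != 0 ->
  askey_wilson n ((z + z^-1) / 2) = askey_wilson_z n z.
Proof.
move=> z0; rewrite /askey_wilson; set x := _ / 2; set w := joukowski_inv x.
have Ew : (w - x) ^+ 2 = x ^+ 2 - 1 by rewrite /w /joukowski_inv addrC addKr sqrtCK.
have xE : x *+ 2 = z + z^-1.
  by rewrite -(mulr_natr x 2) divfK// pnatr_eq0.
have : (w - z) * (w - z^-1) == 0.
  have -> : (w - z) * (w - z^-1) =
      (w - x) ^+ 2 - x ^+ 2 + w * (x *+ 2 - (z + z^-1)) + z * z^-1.
    by move: (z^-1) => z'; ring.
  by rewrite Ew xE mulfV// subrr mulr0 addr0 addrAC subrK subrr.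
rewrite mulf_eq0 !subr_eq0 => /orP[] /eqP -> //.
rewrite /askey_wilson_z invrK; congr (_ * _); apply: qhyp_perm.
by rewrite -[X in perm_eq X _]/([:: _; _] ++ [:: _; _]) -[X in perm_eq _ X]/([:: _; _] ++ [:: _; _])
  perm_cat2l (perm_catC [:: _] [:: _]).
Qed.

Lemma phatE (k : nat) (phi : 'I_k -> {poly R[i]}) (n : nat) (x : R[i]) :
  (forall m : int, 0 <= m -> xi m != 0) -> (k <= n)%N ->
  phat phi n x =
  (\prod_(j < k.+1) xi (n%:Z - j%:Z)) *
  wronskian [tuple of rcons
      [tuple (fun m => (phi j).[aw_eigenvalue m] / xi m) | j < k]
      (fun m => askey_wilson `|m|%N x)] n.
Proof.
move=> xi0 kn; rewrite /phat /wronskian.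
set M := (X in \det X = _); set N := (X in _ = _ * \det X).
have -> : M = N *m diag_mx (\row_j xi (n%:Z - j%:Z)).
  apply/matrixP => i j; rewrite mul_mx_diag !mxE.
  have [r rE] : exists r : nat, n%:Z - j%:Z = r%:Z.
    by exists (n - j)%N; rewrite subzn// (leq_trans _ kn)// -ltnS.
  rewrite rE !(tnth_nth (fun=> 0)) !nth_rcons !size_tuple.
  case: ifP => [ik|_]; last by case: ifP => _; rewrite ?mul0r//= mulrC.
  rewrite -!(tnth_nth _ _ (Ordinal ik)) !tnth_mktuple.
  by rewrite divfK// xi0.
by rewrite det_mulmx det_diag mulrC; congr (_ * _); apply: eq_bigr => j _; rewrite mxE.
Qed.

End AskeyWilson.

Section Orthogonality.
Context {R : realType}.

(* Integration against d mu / prod_j (x - x_j) + sum_j nu_j delta(x - x_j). *)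
Definition muhat_integral (q : R) (a b c d : R[i]) (k : nat)
    (x : 'I_k -> R) (nu : 'I_k -> R[i]) (f : R -> R[i]) : R[i] :=
  aw_integral q a b c d (fun t => f t / (\prod_(j < k) (t - x j))%:C)
  + \sum_(j < k) nu j * f (x j).

Definition mass_point (q eps : R) (l m : nat) : R :=
  eps / 2 * (q `^ (m%:R + l%:R / 2) + q `^ (- m%:R - l%:R / 2)).

Definition orthogonal_polynomials
    (I : (R -> R[i]) -> R[i]) (p : nat -> R[i] -> R[i]) : Prop :=
  [/\ forall n, exists P : {poly R[i]},
        size P = n.+1 /\ (forall x, p n x = P.[x]),
      forall n m, n <> m -> I (fun t => p n t%:C * p m t%:C) = 0
    & forall n, I (fun t => p n t%:C * p n t%:C) != 0].

End Orthogonality.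

Section Genericity.
Variables (K : comNzRingType) (k : nat).

Definition zero_locus (S : set (mpoly.mpoly k K)) : set ('I_k -> K) :=
  [set nu | forall p, S p -> mpoly.meval nu p = 0].

(* P holds outside a countable union of proper algebraic subsets of K^k. *)
Definition generically (P : ('I_k -> K) -> Prop) : Prop :=
  exists S : nat -> set (mpoly.mpoly k K),
    (forall i, zero_locus (S i) <> setT) /\
    forall nu, (forall i, ~ zero_locus (S i) nu) -> P nu.

End Genericity.

(* Main.v *)
Require Import Defs.
From HB Require Import structures.
From mathcomp Require Import all_boot all_order all_algebra.
From mathcomp Require Import all_classical all_reals all_analysis.
From mathcomp Require Import complex ring lra zify.
From mathcomp Require mpoly.

Set Implicit Arguments.
Unset Strict Implicit.
Unset Printing Implicit Defensive.

Import Order.TTheory GRing.Theory Num.Theory.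
Import numFieldNormedType.Exports.

Local Open Scope classical_set_scope.
Local Open Scope ring_scope.
Local Open Scope complex_scope.

(* The functions y_n = xi_n p_n satisfy x y_n = A_n y_(n+1) + B_n y_n + C_n y_(n-1), and
   at x = x_m the resonance a d = q^(alpha+l) makes both u^(1,m) and u^(2,m) solutions of
   it, with u^(1,m)(-1) = 1 and u^(2,m)(-j) = 0 for 1 <= j <= k. Let L be integration
   against the Askey-Wilson measure and J integration against the candidate measure, so
   that J (prod_j (x - x_j) p) = L p. The sequence n -> J (y_n prod_(i<>j) (x - x_i))
   satisfies the recurrence at x_j with a defect at n = 0 which prescribes its value at -1;
   so it is a multiple of phi^(j) exactly when their values at 0 and -1 are proportional,
   and that can be arranged by choosing either the masses nu or the combination phi^(j).
   By Lagrange interpolation J (y_(n-j) r) is then, for deg r < n, a combination of the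
   phi^(i)(n-j) with coefficients independent of j, so that after pairing with r the last
   row of the determinant defining phat_n becomes a combination of the other rows. The
   condition tau <> 0 follows from Hankel determinants of J being nonzero, which is a
   polynomial condition on nu.

   That L y_n = 0 for n > 0 comes from a functional equation for the total mass under
   a -> a q, and L 1 <> 0 from the density of polynomials: the weight is
   E(z) E(1/z) up to elementary factors, with E a uniform limit of polynomials on the
   unit disc. *)

(** * The Askey-Wilson recurrence *)

(** The delicate point lies below index 0, where the Wronskians also reach: there y_n = 0, while
    phi^(j)(n) need not vanish. The factor 1 - q X gives A_(-1) = 0, so the values at -1, ..., -k
    are cut off from the others, and phi^(j)(-1-n) is phi^(j)(-1) times the value at x_j of one
    polynomial of degree n, the same for all j. Interpolation at the k nodes turns the pairing of
    these values with r into a top coefficient, which is 0 when the degrees are small: to r, phi^(j)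
    looks like y_n = 0. This needs a recurrence without poles and with C_n nonzero down to n = 1 -
    k. The numerators are controlled by |a u| < q^alpha, |abcd| < q^(alpha+l) and k <= alpha. For
    the denominators, abcd must avoid the powers q^N with N <= 2 k; this is the content of the
    distinct eigenvalues at -1, ..., -k, without which tau_(-1) has two equal columns. The
    functional equation in a replaces a contour shift z -> q z: for a polynomial g, the constant
    term of g(qz) g(1/z) (qz - 1/z) vanishes by antisymmetry, and uniform approximation carries this
    over to g(z) = (1 - z^2) E(z). *)

Section QPochhammer.
Variables (F : fieldType) (q : F).

(** The q-Pochhammer symbol over any field, convertible to [qpoch] at [q%:C]: the recurrences become
    identities of rational functions, within reach of [field]. *)
Definition qfact (u : F) (n : nat) : F := \prod_(j < n) (1 - u * q ^+ j).

Lemma qfact0 u : qfact u 0 = 1. Proof. exact: big_ord0. Qed.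

Lemma qfactS u n : qfact u n.+1 = qfact u n * (1 - u * q ^+ n).
Proof. exact: big_ord_recr. Qed.

Lemma qfactSl u n : qfact u n.+1 = (1 - u) * qfact (u * q) n.
Proof.
rewrite /qfact big_ord_recl expr0 mulr1; congr (_ * _).
by apply: eq_bigr => j _; rewrite lift0 exprS mulrA.
Qed.

Lemma qfact_eq0 u n j : (j < n)%N -> u * q ^+ j = 1 -> qfact u n = 0.
Proof.
move=> jn uj; apply/eqP/prodf_eq0; exists (Ordinal jn) => //=.
by rewrite uj subrr.
Qed.

Lemma qfact_neq0 u n : (forall j, (j < n)%N -> u * q ^+ j != 1) -> qfact u n != 0.
Proof.
by move=> h; apply/prodf_neq0 => j _; rewrite subr_eq0 eq_sym h.
Qed.

Lemma qfact_neq0S u n : qfact u n.+1 != 0 -> qfact u n != 0.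
Proof. by rewrite qfactS mulf_eq0 negb_or => /andP[]. Qed.

End QPochhammer.

Section Recurrence.
Variables (F : fieldType) (q a b c d x2 : F).
Let e := a * b * c * d.

(* x2 stands for 2 x = z + 1/z, so that each factor below is
   (1 - a z q^j) (1 - a z^(-1) q^j). *)
Definition aw_base (s : nat) : F :=
  \prod_(j < s) (1 - a * q ^+ j * x2 + a ^+ 2 * q ^+ j ^+ 2).

Lemma aw_baseS s :
  aw_base s.+1 = aw_base s * (1 - a * q ^+ s * x2 + a ^+ 2 * q ^+ s ^+ 2).
Proof. exact: big_ord_recr. Qed.

Definition aw_coef (s : nat) : F :=
  aw_base s * q ^+ s /
  (qfact q (a * b) s * qfact q (a * c) s * qfact q (a * d) s * qfact q q s).

(** With a free X in place of q^n, negative n and the substitution of 1/(q X) for X are instances of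
    the same identities. *)
Definition aw_dual (s : nat) (X : F) : F := qfact q X^-1 s * qfact q (e * X / q) s.

(* The partial sums of the 4phi3 series with X = q^n. *)
Definition aw_sum (N : nat) (X : F) : F := \sum_(s < N.+1) aw_coef s * aw_dual s X.

(** [aw_A] and [aw_C] are the classical coefficients of the Askey-Wilson recurrence for the 4phi3
    itself, whose first term is 1. *)
Definition aw_A (X : F) : F :=
  (1 - a * b * X) * (1 - a * c * X) * (1 - a * d * X) * (1 - e * X / q) /
  (a * (1 - e * X ^+ 2 / q) * (1 - e * X ^+ 2)).

Definition aw_C (X : F) : F :=
  a * (1 - X) * (1 - b * c * X / q) * (1 - b * d * X / q) * (1 - c * d * X / q) /
  ((1 - e * X ^+ 2 / q ^+ 2) * (1 - e * X ^+ 2 / q)).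

Hypotheses (a0 : a != 0) (q0 : q != 0).

Definition aw_regular (X : F) : bool :=
  [&& X != 0, 1 - e * X ^+ 2 / q != 0, 1 - e * X ^+ 2 != 0
    & 1 - e * X ^+ 2 / q ^+ 2 != 0].

(** The difference operator in X is bidiagonal on the functions [aw_dual s]. Its diagonal entry is
    x2 - a - 1/a plus the next factor of [aw_base] divided by a q^(s+1), whence the telescoping in
    [aw_sum_rec]. *)
Lemma aw_dual_step s X : aw_regular X ->
  aw_A X * (aw_dual s.+1 (q * X) - aw_dual s.+1 X) +
  aw_C X * (aw_dual s.+1 (X / q) - aw_dual s.+1 X) =
  ((q ^+ s.+1)^-1 / a + a * q ^+ s.+1 - a - a^-1) * aw_dual s.+1 X -
  (q ^+ s)^-1 / a * (1 - a * b * q ^+ s) * (1 - a * c * q ^+ s) *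
    (1 - a * d * q ^+ s) * (1 - q ^+ s.+1) / q * aw_dual s X.
Proof.
case/and4P=> X0.
have -> : 1 - e * X ^+ 2 / q = (q - e * X ^+ 2) / q by field.
have -> : 1 - e * X ^+ 2 / q ^+ 2 = (q ^+ 2 - e * X ^+ 2) / q ^+ 2 by field.
rewrite !mulf_eq0 !invr_eq0 !expf_eq0 /= (negPf q0) !orbF => h1 h2 h3.
have E1 : aw_dual 0 X = 1 by rewrite /aw_dual !qfact0 mulr1.
rewrite /aw_A /aw_C; case: s => [|s].
  rewrite E1 /aw_dual !qfactS !qfact0 !expr0; rewrite /e in h1 h2 h3 *.
  by field; rewrite oner_eq0 a0 q0 X0 h1 h2 h3.
(* The three shifts share all but a few boundary factors; with those split off, the identity is
   rational in X and q^s. The case s = 0 has too few factors for this and was done apart. *)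
have -> : aw_dual s.+2 (q * X) = (1 - (q * X)^-1) * (1 - X^-1) *
    ((1 - e * X * q ^+ s) * (1 - e * X * q ^+ s.+1)) *
    (qfact q (q / X) s * qfact q (e * X) s).
  rewrite /aw_dual (qfactSl q (q * X)^-1) (qfactSl q ((q * X)^-1 * q)).
  have -> : (q * X)^-1 * q = X^-1 by field; rewrite ?q0 ?X0.
  have -> : X^-1 * q = q / X by rewrite mulrC.
  have -> : e * (q * X) / q = e * X by field.
  rewrite !qfactS; ring.
have -> : aw_dual s.+2 X = (1 - X^-1) * (1 - q ^+ s.+1 / X) *
    ((1 - e * X / q) * (1 - e * X * q ^+ s)) *
    (qfact q (q / X) s * qfact q (e * X) s).
  rewrite /aw_dual (qfactSl q X^-1) (qfactSl q (e * X / q)).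
  have -> : X^-1 * q = q / X by rewrite mulrC.
  have -> : e * X / q * q = e * X by field.
  rewrite !qfactS exprS; ring.
have -> : aw_dual s.+2 (X / q) = (1 - q ^+ s.+1 / X) * (1 - q ^+ s.+2 / X) *
    ((1 - e * X / q ^+ 2) * (1 - e * X / q)) *
    (qfact q (q / X) s * qfact q (e * X) s).
  rewrite /aw_dual (qfactSl q (e * (X / q) / q)) (qfactSl q (e * (X / q) / q * q)).
  have -> : e * (X / q) / q * q * q = e * X by field.
  have -> : e * (X / q) / q = e * X / q ^+ 2 by field.
  have -> : e * X / q ^+ 2 * q = e * X / q by field.
  have -> : (X / q)^-1 = q / X by field; rewrite ?q0 ?X0.
  rewrite !qfactS !exprS; ring.
have -> : aw_dual s.+1 X = (1 - X^-1) * (1 - e * X / q) *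
    (qfact q (q / X) s * qfact q (e * X) s).
  rewrite /aw_dual (qfactSl q X^-1) (qfactSl q (e * X / q)).
  have -> : X^-1 * q = q / X by rewrite mulrC.
  have -> : e * X / q * q = e * X by field.
  ring.
have Y0 : q ^+ s != 0 by rewrite expf_neq0.
rewrite !(exprS q s.+1) (exprS q s).
move: (q ^+ s) Y0 => Y Y0; move: (qfact _ _ _ * _) => G.
by rewrite /e in h1 h2 h3 *; field; rewrite ?a0 ?q0 ?X0 ?Y0 ?h1 ?h2 ?h3.
Qed.

(** The partial sums satisfy the recurrence up to one boundary term. It vanishes in two ways:
    through [aw_dual] when X = q^n with n < N, which gives p_n, or through [aw_base] when x is a
    node, which gives u1 and u2 for every X. *)
Lemma aw_sum_rec N X : aw_regular X ->
  qfact q (a * b) N != 0 -> qfact q (a * c) N != 0 -> qfact q (a * d) N != 0 ->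
  qfact q q N != 0 ->
  aw_A X * aw_sum N (q * X) + aw_C X * aw_sum N (X / q) =
  (x2 - (a + a^-1) + aw_A X + aw_C X) * aw_sum N X +
  aw_base N.+1 / a /
    (qfact q (a * b) N * qfact q (a * c) N * qfact q (a * d) N * qfact q q N) *
    aw_dual N X.
Proof.
move=> rX; elim: N => [|N IH].
  rewrite /aw_sum !big_ord1 /aw_coef /aw_dual /aw_base big_ord_recl !big_ord0 !qfact0.
  by move=> _ _ _ _; rewrite expr0; field; rewrite ?oner_eq0 ?a0.
move=> h1 h2 h3 h4.
have {}IH := IH (qfact_neq0S h1) (qfact_neq0S h2) (qfact_neq0S h3) (qfact_neq0S h4).
have S := aw_dual_step N rX.
have sumS Y : aw_sum N.+1 Y = aw_sum N Y + aw_coef N.+1 * aw_dual N.+1 Y.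
  by rewrite /aw_sum big_ord_recr.
rewrite !sumS !mulrDr addrACA IH.
set A := aw_A X in S *; set C := aw_C X in S *.
set D1 := aw_dual N.+1 X in S *; set Dp := aw_dual _ (q * X) in S *.
set Dm := aw_dual _ (X / q) in S *; set D0 := aw_dual N X in S *.
have -> : A * (aw_coef N.+1 * Dp) + C * (aw_coef N.+1 * Dm) =
  aw_coef N.+1 * (A * (Dp - D1) + C * (Dm - D1)) + aw_coef N.+1 * (A + C) * D1 by ring.
rewrite S /aw_coef.
rewrite (aw_baseS N.+1).
move: h1 h2 h3 h4; rewrite !qfactS (exprS q N) !mulf_eq0 !negb_or.
have Q0 : q ^+ N != 0 by rewrite expf_neq0.
move: (aw_base N.+1) (aw_sum N X) (q ^+ N) Q0 => B T Q Q0.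
move: (qfact _ _ _) (qfact _ _ _) (qfact _ _ _) (qfact _ _ _) => f1 f2 f3 f4.
case/andP=> f10 g1 /andP[f20 g2] /andP[f30 g3] /andP[f40 g4].
by field; rewrite ?a0 ?q0 ?Q0 ?f10 ?f20 ?f30 ?f40 ?g1 ?g2 ?g3 ?g4.
Qed.

End Recurrence.

(** * The recurrence of xi_n p_n and its other two solutions *)

Section ThreeTerm.
Variables (F : fieldType) (q a b c d : F).
Let e := a * b * c * d.

(* Coefficients of the recurrence satisfied by xi_n p_n, as functions of X = q^n. *)
Definition rec_up (X : F) : F :=
  a * (1 - b * c * X) * (1 - b * d * X) * (1 - c * d * X) * (1 - q * X) /
  (q * (1 - e * X ^+ 2 / q) * (1 - e * X ^+ 2)).

Definition rec_mid (X : F) : F :=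
  a + a^-1 - aw_A q a b c d X - aw_C q a b c d X.

Definition rec_down (X : F) : F :=
  q * (1 - e * X / q ^+ 2) * (1 - a * b * X / q) * (1 - a * c * X / q) *
    (1 - a * d * X / q) /
  (a * (1 - e * X ^+ 2 / q ^+ 2) * (1 - e * X ^+ 2 / q)).

Hypotheses (q0 : q != 0) (a0 : a != 0) (b0 : b != 0) (c0 : c != 0) (d0 : d != 0).

Lemma aw_regularE X : aw_regular q a b c d X =
  [&& X != 0, q - e * X ^+ 2 != 0, 1 - e * X ^+ 2 != 0 & q ^+ 2 - e * X ^+ 2 != 0].
Proof.
rewrite /aw_regular -/e.
have -> : 1 - e * X ^+ 2 / q = (q - e * X ^+ 2) / q by field.
have -> : 1 - e * X ^+ 2 / q ^+ 2 = (q ^+ 2 - e * X ^+ 2) / q ^+ 2 by field.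
by rewrite !mulf_eq0 !invr_eq0 !expf_eq0 /= (negPf q0) !orbF.
Qed.

Lemma aw_regular_dual X : aw_regular q a b c d X ->
  aw_regular q (q / a) (q / b) (q / c) (q / d) (q * X)^-1.
Proof.
rewrite aw_regularE /e => /and4P[X0 h1 h2 h3].
have XE : (q / a) * (q / b) * (q / c) * (q / d) * (q * X)^-1 ^+ 2 =
    q ^+ 2 / (a * b * c * d * X ^+ 2) by field; rewrite a0 b0 c0 d0 q0 X0.
have D0 : a * b * c * d * X ^+ 2 != 0 by rewrite !mulf_neq0 ?expf_neq0.
rewrite /aw_regular XE invr_eq0 mulf_neq0//=.
have -> : 1 - q ^+ 2 / (a * b * c * d * X ^+ 2) / q =
    (a * b * c * d * X ^+ 2 - q) / (a * b * c * d * X ^+ 2).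
  by field; rewrite a0 b0 c0 d0 q0 X0.
have -> : 1 - q ^+ 2 / (a * b * c * d * X ^+ 2) =
    (a * b * c * d * X ^+ 2 - q ^+ 2) / (a * b * c * d * X ^+ 2).
  by field; rewrite a0 b0 c0 d0 X0.
have -> : 1 - q ^+ 2 / (a * b * c * d * X ^+ 2) / q ^+ 2 =
    (a * b * c * d * X ^+ 2 - 1) / (a * b * c * d * X ^+ 2).
  by field; rewrite a0 b0 c0 d0 q0 X0.
rewrite !(mulf_eq0 _ (_^-1)) invr_eq0 !(negPf D0) !orbF.
by rewrite -!(opprB _ (_ * X ^+ 2)) !oppr_eq0 h1 h2 h3.
Qed.

Let regular_opp X :
  (q - e * X ^+ 2 != 0 -> e * X ^+ 2 - q != 0) *
  (1 - e * X ^+ 2 != 0 -> e * X ^+ 2 - 1 != 0) *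
  (q ^+ 2 - e * X ^+ 2 != 0 -> e * X ^+ 2 - q * q != 0).
Proof. by rewrite -!(opprB _ (_ * X ^+ 2)) !oppr_eq0. Qed.

(** Replacing n by -n-1 reverses the direction of the recurrence, so the raising coefficient for the
    parameters q/a, ..., q/d is the lowering one here, and conversely. *)
Lemma aw_A_dual X : aw_regular q a b c d X ->
  aw_A q (q / a) (q / b) (q / c) (q / d) (q * X)^-1 = rec_down X.
Proof.
rewrite aw_regularE /aw_A /rec_down => /and4P[X0 h1 h2 h3].
have g1 := (regular_opp X).1.1 h1; have g3 := (regular_opp X).2 h3.
rewrite /e in h1 h2 h3 g1 g3 *; field.
by rewrite ?q0 ?a0 ?b0 ?c0 ?d0 ?X0 ?h1 ?h2 ?h3 ?g1 ?g3.
Qed.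

Lemma aw_C_dual X : aw_regular q a b c d X ->
  aw_C q (q / a) (q / b) (q / c) (q / d) (q * X)^-1 = rec_up X.
Proof.
rewrite aw_regularE /aw_C /rec_up => /and4P[X0 h1 h2 h3].
have g1 := (regular_opp X).1.1 h1; have g2 := (regular_opp X).1.2 h2.
rewrite /e in h1 h2 h3 g1 g2 *; field.
by rewrite ?q0 ?a0 ?b0 ?c0 ?d0 ?X0 ?h1 ?h2 ?h3 ?g1 ?g2.
Qed.

Lemma rec_mid_dual X : aw_regular q a b c d X ->
  q / a + (q / a)^-1 - rec_down X - rec_up X = rec_mid X.
Proof.
rewrite aw_regularE /rec_mid /rec_up /rec_down /aw_A /aw_C => /and4P[X0 h1 h2 h3].
rewrite /e in h1 h2 h3 *; field.
by rewrite ?q0 ?a0 ?X0 ?h1 ?h2 ?h3.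
Qed.

(** The middle coefficient is symmetric in the parameters; this allows u2 to be built on d instead
    of a. *)
Lemma rec_mid_swap X : aw_regular q a b c d X ->
  d + d^-1 - aw_A q d a b c X - aw_C q d a b c X = rec_mid X.
Proof.
rewrite aw_regularE /rec_mid /rec_up /rec_down /aw_A /aw_C => /and4P[X0 h1 h2 h3].
have -> : d * a * b * c = a * b * c * d by ring.
rewrite /e in h1 h2 h3 *; field.
by rewrite ?q0 ?a0 ?d0 ?h1 ?h2 ?h3.
Qed.

(* The solution u1 is the same series with the parameters q/a, q/b, q/c, q/d and
   X' = 1/(q X), that is, n replaced by -n-1. *)
Lemma dual_sum_rec x2 N X : aw_regular q a b c d X ->
  let S Y := aw_sum q (q / a) (q / b) (q / c) (q / d) x2 N (q * Y)^-1 in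
  let D u := qfact q (q / a * (q / u)) N in
  aw_base q (q / a) x2 N.+1 = 0 -> D b != 0 -> D c != 0 -> D d != 0 ->
  qfact q q N != 0 ->
  x2 * S X = rec_up X * S (q * X) + rec_mid X * S X + rec_down X * S (X / q).
Proof.
move=> rX S D B0 Db Dc Dd Dq; have X0 : X != 0 by case/and4P: rX.
have a0' : q / a != 0 by rewrite mulf_neq0 ?invr_eq0.
have := aw_sum_rec x2 a0' q0 (aw_regular_dual rX) Db Dc Dd Dq.
rewrite B0 !mul0r addr0 (aw_A_dual rX) (aw_C_dual rX).
have -> : q * (q * X)^-1 = (q * (X / q))^-1 by field; rewrite q0 X0.
have -> : (q * X)^-1 / q = (q * (q * X))^-1 by field; rewrite q0 X0.
rewrite -!/(S _) => E.
rewrite addrAC [_ * S (q * X) + _]addrC E -(rec_mid_dual rX).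
ring.
Qed.

Lemma qfact_inv_eq0 n s : (n < s)%N -> qfact q (q ^- n) s = 0.
Proof.
by move=> ns; apply: (qfact_eq0 ns); rewrite mulVf// expf_neq0.
Qed.

Lemma aw_sum_trunc a' b' c' d' x2 n N : (n <= N)%N ->
  aw_sum q a' b' c' d' x2 N (q ^+ n) = aw_sum q a' b' c' d' x2 n (q ^+ n).
Proof.
move=> /subnKC <-; elim: (N - n)%N => [|m IH]; first by rewrite addn0.
rewrite addnS -IH /aw_sum big_ord_recr /= /aw_dual qfact_inv_eq0 ?ltnS ?leq_addr//.
by rewrite mul0r mulr0 addr0.
Qed.

(** This is xi_n (ab, ac, ad; q)_n / a^n, so that [aw_full (2 x) n] is xi_n p_n(x); see
    [xi_askey_wilsonE]. *)
Definition norm_factor (n : nat) : F :=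
  q ^+ n * qfact q (e / q) n *
    (qfact q (a * b) n * qfact q (a * c) n * qfact q (a * d) n) /
  (a ^+ n * a ^+ n *
    (qfact q (b * c) n * qfact q (b * d) n * qfact q (c * d) n * qfact q q n)).

Definition aw_full (x2 : F) (n : nat) : F :=
  norm_factor n * aw_sum q a b c d x2 n (q ^+ n).

Lemma aw_full_rec x2 n : aw_regular q a b c d (q ^+ n) ->
  (forall u s, u \in [:: a * b; a * c; a * d; b * c; b * d; c * d; q] ->
     qfact q u s != 0) ->
  x2 * aw_full x2 n = rec_up (q ^+ n) * aw_full x2 n.+1 +
    rec_mid (q ^+ n) * aw_full x2 n +
    rec_down (q ^+ n) * (if n is n'.+1 then aw_full x2 n' else 0).
Proof.
move=> rX h.
have gS k : norm_factor k.+1 = norm_factor k *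
    (q * (1 - e / q * q ^+ k) * (1 - a * b * q ^+ k) * (1 - a * c * q ^+ k) *
     (1 - a * d * q ^+ k) / (a ^+ 2 * (1 - b * c * q ^+ k) *
     (1 - b * d * q ^+ k) * (1 - c * d * q ^+ k) * (1 - q * q ^+ k))).
  rewrite /norm_factor !qfactS !exprS expr0.
  have : [/\ qfact q (b * c) k.+1 != 0, qfact q (b * d) k.+1 != 0,
    qfact q (c * d) k.+1 != 0 & qfact q q k.+1 != 0].
    by split; apply: h; rewrite !inE eqxx ?orbT.
  have Ak : a ^+ k != 0 by rewrite expf_neq0.
  rewrite !qfactS !mulf_eq0 !negb_or.
  case=> /andP[f1 g1] /andP[f2 g2] /andP[f3 g3] /andP[f4 g4].
  by field; rewrite ?a0 ?q0 ?Ak ?f1 ?f2 ?f3 ?f4 ?g1 ?g2 ?g3 ?g4.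
have dual0 : aw_dual q a b c d n.+1 (q ^+ n) = 0.
  by rewrite /aw_dual qfact_inv_eq0// mul0r.
(* The order n + 1 is a common truncation for the indices n - 1, n and n + 1, and it makes the
   boundary term vanish. *)
have := @aw_sum_rec F q a b c d x2 a0 q0 n.+1 _ rX.
have hn u s := h u s; rewrite dual0 mulr0 addr0.
rewrite !hn ?inE ?eqxx ?orbT//= => /(_ isT isT isT isT).
rewrite [aw_sum _ _ _ _ _ _ _ (q ^+ n)]aw_sum_trunc// -exprS => E.
rewrite {1 3}/aw_full mulrCA.
have -> : x2 * aw_sum q a b c d x2 n (q ^+ n) =
  aw_A q a b c d (q ^+ n) * aw_sum q a b c d x2 n.+1 (q ^+ n.+1) +
  aw_C q a b c d (q ^+ n) * aw_sum q a b c d x2 n.+1 (q ^+ n / q) +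
  rec_mid (q ^+ n) * aw_sum q a b c d x2 n (q ^+ n).
  by rewrite E /rec_mid; ring.
rewrite !mulrDr [LHS]addrAC; congr (_ + _ + _); last 1 first.
(* At n = 0 the coefficient [aw_C] vanishes because X = 1, in agreement with the convention y_(-1) =
   0. *)
- case: n rX dual0 E => [|n] rX _ _.
    by rewrite expr0 /aw_C subrr !(mulr0, mul0r).
  have -> : q ^+ n.+1 / q = q ^+ n by rewrite exprSr mulfK.
  rewrite aw_sum_trunc ?leqW// /aw_full gS.
  move: (norm_factor n) (aw_sum _ _ _ _ _ _ _ _) => G S; rewrite !mulrA; congr (_ * _).
  have : [/\ qfact q (b * c) n.+1 != 0, qfact q (b * d) n.+1 != 0,
    qfact q (c * d) n.+1 != 0 & qfact q q n.+1 != 0].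
    by split; apply: h; rewrite !inE eqxx ?orbT.
  rewrite !qfactS !mulf_eq0 !negb_or.
  case=> /andP[f1 g1] /andP[f2 g2] /andP[f3 g3] /andP[f4 g4].
  move: rX; rewrite aw_regularE exprS => /and4P[X0 h1 h2 h3].
  have {}h1 : 1 - e * (q * q ^+ n ^+ 2) != 0.
    by apply: contraNneq h1 => h1; apply/eqP; rewrite -[RHS](mulr0 q) -h1; ring.
  have {}h3 : 1 - e * q ^+ n ^+ 2 != 0.
    by apply: contraNneq h3 => h3; apply/eqP; rewrite -[RHS](mulr0 (q ^+ 2)) -h3; ring.
  rewrite /aw_C /rec_down /e in h1 h2 h3 g1 g2 g3 g4 *.
  field.
  by rewrite ?a0 ?q0 ?X0 ?h1 ?h2 ?h3 ?g1 ?g2 ?g3 ?g4.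
- rewrite /aw_full gS.
  move: (norm_factor n) (aw_sum _ _ _ _ _ _ _ _) => G S; rewrite !mulrA; congr (_ * _).
  have : [/\ qfact q (b * c) n.+1 != 0, qfact q (b * d) n.+1 != 0,
    qfact q (c * d) n.+1 != 0 & qfact q q n.+1 != 0].
    by split; apply: h; rewrite !inE eqxx ?orbT.
  rewrite !qfactS !mulf_eq0 !negb_or.
  case=> /andP[f1 g1] /andP[f2 g2] /andP[f3 g3] /andP[f4 g4].
  move: rX; rewrite aw_regularE => /and4P[X0 h1 h2 h3].
  rewrite /aw_A /rec_up /e in h1 h2 h3 g1 g2 g3 g4 *.
  field.
  by rewrite ?a0 ?q0 ?X0 ?h1 ?h2 ?h3 ?g1 ?g2 ?g3 ?g4.
- by rewrite mulrCA.
Qed.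

Section AltSolution.
Variable M : nat.
Hypothesis adE : a * d = q ^+ M.+1.

(* The prefactor of u2; it turns the recurrence of the series with a and d exchanged
   into the original one because a d is a power of q. *)
Definition alt_factor (X : F) : F :=
  qfact q (b * c * X) M * qfact q (q * X) M / X ^+ M.

Let eE : e = b * c * q ^+ M.+1. Proof. by rewrite -adE /e; ring. Qed.

Let qfact_shift u : (1 - u) * qfact q (q * u) M = qfact q u M * (1 - u * q ^+ M).
Proof. by rewrite [q * u]mulrC -qfactSl qfactS. Qed.

Lemma alt_factor_up X : aw_regular q a b c d X ->
  rec_up X * alt_factor (q * X) = aw_A q d a b c X * alt_factor X.
Proof.
rewrite aw_regularE /rec_up /aw_A /alt_factor => /and4P[X0 h1 h2 h3].
have e1 : (1 - b * c * X) * qfact q (b * c * (q * X)) M =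
    qfact q (b * c * X) M * (1 - e * X / q).
  have -> : b * c * (q * X) = q * (b * c * X) by ring.
  rewrite qfact_shift; congr (_ * (1 - _)).
  by rewrite eE exprS; field.
have e2 : (1 - q * X) * qfact q (q * (q * X)) M =
    qfact q (q * X) M * (1 - d * a * X).
  by rewrite qfact_shift [d * a]mulrC adE exprS; congr (_ * (1 - _)); ring.
rewrite exprMn -/e (_ : d * a * b * c = e); last by rewrite /e; ring.
(* The resonance is put in the form q^M = a d / q, so that [field] can compare the two sides. *)
have QE : q ^+ M = a * d / q by rewrite adE exprS mulrC mulKf.
have XM : X ^+ M != 0 by rewrite expf_neq0.
rewrite QE; set l := LHS.
have -> : l = a * (1 - b * d * X) * (1 - c * d * X) *
    (((1 - b * c * X) * qfact q (b * c * (q * X)) M) *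
     ((1 - q * X) * qfact q (q * (q * X)) M)) /
  (q * (1 - e * X ^+ 2 / q) * (1 - e * X ^+ 2)) / (a * d / q * X ^+ M).
  by rewrite /l; field; rewrite ?a0 ?d0 ?q0 ?XM ?h1 ?h2.
by rewrite e1 e2; field; rewrite ?a0 ?d0 ?q0 ?XM ?h1 ?h2.
Qed.

Lemma alt_factor_down X : aw_regular q a b c d X ->
  rec_down X * alt_factor (X / q) = aw_C q d a b c X * alt_factor X.
Proof.
rewrite aw_regularE /rec_down /aw_C /alt_factor => /and4P[X0 h1 h2 h3].
have e1 : (1 - b * c * X / q) * qfact q (b * c * X) M =
    qfact q (b * c * (X / q)) M * (1 - e * X / q ^+ 2).
  have -> : b * c * (X / q) = b * c * X / q by rewrite mulrA.
  have {2}-> : b * c * X = q * (b * c * X / q) by field.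
  rewrite qfact_shift; congr (_ * (1 - _)).
  by rewrite eE exprS; field.
have e2 : (1 - X) * qfact q (q * X) M = qfact q (q * (X / q)) M * (1 - a * d * X / q).
  have -> : q * (X / q) = X by field.
  by rewrite qfact_shift adE exprS; congr (_ * (1 - _)); field.
rewrite expr_div_n -/e (_ : d * a * b * c = e); last by rewrite /e; ring.
have QE : q ^+ M = a * d / q by rewrite adE exprS mulrC mulKf.
have XM : X ^+ M != 0 by rewrite expf_neq0.
rewrite QE; set r := RHS.
have -> : r = d * (1 - a * b * X / q) * (1 - a * c * X / q) *
    (((1 - b * c * X / q) * qfact q (b * c * X) M) *
     ((1 - X) * qfact q (q * X) M)) /
  ((1 - e * X ^+ 2 / q ^+ 2) * (1 - e * X ^+ 2 / q)) / X ^+ M.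
  by rewrite /r; field; rewrite ?a0 ?d0 ?q0 ?XM ?h1 ?h3.
by rewrite e1 e2; field; rewrite ?a0 ?d0 ?q0 ?XM ?h1 ?h3.
Qed.

Lemma alt_sum_rec x2 N X : aw_regular q a b c d X ->
  let S Y := alt_factor Y * aw_sum q d a b c x2 N Y in
  let D u := qfact q (d * u) N in
  aw_base q d x2 N.+1 = 0 -> D a != 0 -> D b != 0 -> D c != 0 ->
  qfact q q N != 0 ->
  x2 * S X = rec_up X * S (q * X) + rec_mid X * S X + rec_down X * S (X / q).
Proof.
move=> rX S D B0 Da Db Dc Dq.
have rX' : aw_regular q d a b c X.
  by rewrite /aw_regular (_ : d * a * b * c = a * b * c * d)//; ring.
have := aw_sum_rec x2 d0 q0 rX' Da Db Dc Dq.
rewrite B0 !mul0r addr0 /S (mulrA (rec_up X)) (mulrA (rec_down X)).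
rewrite alt_factor_up// alt_factor_down// -(rec_mid_swap rX).
move: (aw_A _ _ _ _ _ _) (aw_C _ _ _ _ _ _) => A C.
move: (alt_factor _) (aw_sum _ _ _ _ _ _ _ X) => f T E.
have -> : x2 * (f * T) = f * (x2 * T) by ring.
rewrite (_ : x2 * T = (x2 - (d + d^-1) + A + C) * T + (d + d^-1 - A - C) * T); last by ring.
by rewrite -E; ring.
Qed.

End AltSolution.

(* The partial sums of the q-Vandermonde series have a closed form, so the sum telescopes. *)
Lemma qvandermonde_partial u v N : (forall s, qfact q u s != 0) ->
  (forall s, qfact q q s != 0) -> v != 0 ->
  \sum_(s < N.+1) qfact q v s * qfact q (u / (q * v)) s * q ^+ s /
    (qfact q u s * qfact q q s) =
  qfact q (q * v) N * qfact q (u / v) N / (qfact q u N * qfact q q N).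
Proof.
move=> hu hq v0; elim: N => [|N IH].
  by rewrite big_ord1 !qfact0 expr0 !mulr1.
rewrite big_ord_recr /= IH (qfactSl _ v) (qfactSl _ (u / (q * v))).
have -> : v * q = q * v by rewrite mulrC.
have -> : u / (q * v) * q = u / v by field; rewrite q0 v0.
move: (hu N.+1) (hq N.+1); rewrite !qfactS exprS !mulf_eq0 !negb_or.
move=> /andP[f1 g1] /andP[f2 g2].
by field; rewrite ?q0 ?v0 ?f1 ?g1 ?f2 ?g2.
Qed.

End ThreeTerm.

(** * Darboux transforms of orthogonal polynomials *)

Section Polynomials.
Variable F : fieldType.
Implicit Types (p r : {poly F}) (n : nat).

Lemma size_sum_leq (I : finType) (f : I -> {poly F}) n :
  (forall i, (size (f i) <= n)%N) -> (size (\sum_i f i)%R <= n)%N.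
Proof.
by move=> h; rewrite (leq_trans (size_sum _ _ _))//; apply/bigmax_leqP.
Qed.

Section ThreeTermPolynomials.
Variables alpha beta gamma : nat -> F.

(** The pair carries the two latest polynomials, which makes the recursion of order two structural;
    it starts from y_0 = 1 and y_(-1) = 0. *)
Fixpoint ttp_pair n : {poly F} * {poly F} :=
  if n is n'.+1 then
    let: (p, r) := ttp_pair n' in
    ((alpha n')^-1 *: ('X * p - beta n' *: p - gamma n' *: r), p)
  else (1, 0).

Definition ttp n := (ttp_pair n).1.

Definition ttp_pred n := if n is n'.+1 then ttp n' else 0.

Lemma ttpS n :
  ttp n.+1 = (alpha n)^-1 *: ('X * ttp n - beta n *: ttp n - gamma n *: ttp_pred n).
Proof.
rewrite /ttp /ttp_pred /=; case: n => [|n] //=.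
by rewrite /ttp; case: (ttp_pair n).
Qed.

Lemma ttp_rec n : alpha n != 0 ->
  'X * ttp n = alpha n *: ttp n.+1 + beta n *: ttp n + gamma n *: ttp_pred n.
Proof.
by move=> an; rewrite ttpS scalerA divff// scale1r addrAC subrK subrK.
Qed.

Lemma size_ttp n : (forall i, (i < n)%N -> alpha i != 0) -> size (ttp n) = n.+1.
Proof.
elim/ltn_ind: n => -[|n] IH an; first by rewrite size_poly1.
have sn : size (ttp n) = n.+1 by apply: IH => // i /ltnW; exact: an.
rewrite ttpS size_scale ?invr_eq0 ?an// -addrA -opprD size_polyDl.
  by rewrite mulrC size_mulX ?sn// -size_poly_eq0 sn.
rewrite mulrC size_mulX ?sn -?size_poly_eq0 ?sn// size_polyN.
rewrite (leq_ltn_trans (size_polyD _ _))// gtn_max !ltnS.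
rewrite (leq_trans (size_scale_leq _ _)) ?sn//=.
rewrite (leq_trans (size_scale_leq _ _))//.
case: n IH an {sn} => [|n] IH an /=; first by rewrite size_poly0.
by rewrite IH// => i ni; apply: an; rewrite (leq_trans ni)// leqW.
Qed.

(** The range is finite because the downward recurrence from index -1 is only used, and only
    regular, for k - 1 steps. *)
Lemma ttp_unique (f : nat -> F) (x : F) N :
  (forall n, (n < N)%N -> alpha n != 0) ->
  (forall n, (n < N)%N ->
    x * f n = alpha n * f n.+1 + beta n * f n +
              gamma n * (if n is n'.+1 then f n' else 0)) ->
  forall n, (n <= N)%N -> f n = f 0%N * (ttp n).[x].
Proof.
move=> aN fN; elim/ltn_ind => -[|n] IH nN; first by rewrite hornerC mulr1.
apply: (mulfI (aN n nN)).
have -> : alpha n * (f 0%N * (ttp n.+1).[x]) = f 0%N * (alpha n * (ttp n.+1).[x]) by ring.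
have E := congr1 (horner^~ x) (ttp_rec (aN n nN)); rewrite !hornerE in E.
have {}E : alpha n * (ttp n.+1).[x] =
    x * (ttp n).[x] - beta n * (ttp n).[x] - gamma n * (ttp_pred n).[x].
  by rewrite E; ring.
rewrite E.
have -> : alpha n * f n.+1 =
    x * f n - beta n * f n - gamma n * (if n is n'.+1 then f n' else 0).
  by rewrite fN//; ring.
rewrite (IH n) ?(ltnW nN)//; case: n IH nN {E} => [|n] IH nN /=.
  by rewrite horner0; ring.
by rewrite (IH n) ?(leq_trans _ nN)//; last exact: leqW; ring.
Qed.

End ThreeTermPolynomials.

Lemma size_basis_eq0 (P : nat -> {poly F}) N (c : nat -> F) :
  (forall i, (i < N)%N -> size (P i) = i.+1) ->
  \sum_(i < N) c i *: P i = 0 -> forall i, (i < N)%N -> c i = 0.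
Proof.
elim: N => [//|N IH] sP; rewrite big_ord_recr /= => S0.
have cN : c N = 0.
  apply/eqP; apply: contraT => cN0.
  have : size (c N *: P N) = N.+1 by rewrite size_scale// sP.
  have -> : c N *: P N = - \sum_(i < N) c i *: P i.
    by apply/eqP; rewrite -addr_eq0 addrC S0.
  rewrite size_polyN => sN.
  have : (size (\sum_(i < N) c i *: P i)%R <= N)%N.
    apply: size_sum_leq => i; apply: leq_trans (size_scale_leq _ _) _.
    by rewrite sP// ltnS ltnW.
  by rewrite sN ltnn.
move: S0; rewrite cN scale0r addr0 => S0 i; rewrite ltnS leq_eqVlt => /orP[/eqP->//|].
by apply: IH => // j jN; apply: sP; rewrite (leq_trans jN).
Qed.

Section Lagrange.
Variables (k : nat) (x : 'I_k -> F).
Hypothesis xI : injective x.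

Definition nodal : {poly F} := \prod_(j < k) ('X - (x j)%:P).

Definition nodal_but (i : 'I_k) : {poly F} := \prod_(j < k | j != i) ('X - (x j)%:P).

Lemma nodalE i : nodal = ('X - (x i)%:P) * nodal_but i.
Proof. by rewrite /nodal (bigD1 i). Qed.

Lemma monic_nodal : nodal \is monic. Proof. exact: monic_prod_XsubC. Qed.

Lemma size_nodal : size nodal = k.+1.
Proof. by rewrite /nodal -big_enum size_prod_XsubC size_enum_ord. Qed.

Lemma monic_nodal_but i : nodal_but i \is monic.
Proof. by apply: monic_prod => j _; rewrite monicXsubC. Qed.

Lemma size_nodal_but i : size (nodal_but i) = k.
Proof.
have := size_nodal; rewrite (nodalE i) size_Mmonic ?monic_nodal_but ?polyXsubC_eq0//.
by rewrite size_XsubC => -[].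
Qed.

Lemma horner_nodal i : nodal.[x i] = 0.
Proof. by rewrite (nodalE i) hornerM hornerXsubC subrr mul0r. Qed.

Lemma horner_nodal_but i j : j != i -> (nodal_but i).[x j] = 0.
Proof.
by move=> ji; rewrite /nodal_but (bigD1 j)//= hornerM hornerXsubC subrr mul0r.
Qed.

Lemma nodal_but_neq0 i : (nodal_but i).[x i] != 0.
Proof.
rewrite /nodal_but horner_prod; apply/prodf_neq0 => j ji.
by rewrite hornerXsubC subr_eq0 inj_eq// eq_sym.
Qed.

Lemma small_poly_eq0 p : (size p <= k)%N -> (forall i, p.[x i] = 0) -> p = 0.
Proof.
move=> sp p0; apply/eqP; apply: contraT => pn0.
have := @max_poly_roots _ p [seq x i | i <- enum 'I_k] pn0.
rewrite size_map size_enum_ord map_inj_uniq ?enum_uniq// => h.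
suff /h : all (root p) [seq x i | i <- enum 'I_k] by move=> /(_ isT); rewrite ltnNge sp.
by apply/allP => _ /mapP[i _ ->]; apply/rootP.
Qed.

Definition lagrange_coef p i : F := p.[x i] / (nodal_but i).[x i].

Lemma lagrange p : (size p <= k)%N -> p = \sum_i lagrange_coef p i *: nodal_but i.
Proof.
move=> sp; apply/eqP; rewrite -subr_eq0; apply/eqP/small_poly_eq0.
  rewrite (leq_trans (size_polyD _ _))// geq_max sp size_polyN.
  apply: size_sum_leq => i.
  by rewrite (leq_trans (size_scale_leq _ _))// size_nodal_but.
move=> i; rewrite hornerD hornerN horner_sum (bigD1 i)//= big1 => [|j ji].
  by rewrite hornerZ divfK ?nodal_but_neq0// addr0 subrr.
by rewrite hornerZ horner_nodal_but 1?eq_sym// mulr0.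
Qed.

(** Comparison of the coefficients of X^(k-1), every [nodal_but] being monic of that degree. This
    evaluates the pairings at negative indices. *)
Lemma sum_lagrange_coef p : (size p <= k)%N -> \sum_i lagrange_coef p i = p`_k.-1.
Proof.
move=> sp; rewrite {2}(lagrange sp) coef_sum; apply: eq_bigr => i _.
rewrite coefZ; have /monicP := monic_nodal_but i.
by rewrite lead_coefE size_nodal_but => ->; rewrite mulr1.
Qed.

End Lagrange.
End Polynomials.

(** The degree counts behind [J_Y_dual], at nonnegative and at negative index. In the last column j
    = k one degree is lost, whence the implication. *)
Lemma size_quotient_bound s k n j : (j <= k)%N -> (s <= n.+1)%N ->
  (j == k) ==> (s <= n)%N -> (j <= n)%N -> (s - k <= n - j)%N.
Proof. by case: eqVneq => /= ? ? ? ? ?; lia. Qed.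

Lemma size_product_bound s k n j : (j <= k)%N -> (s <= n.+1)%N ->
  (j == k) ==> (s <= n)%N -> (n < j)%N -> ((s + (j - n.+1).+1).-1 <= k.-1)%N.
Proof. by case: eqVneq => /= ? ? ? ? ?; lia. Qed.

(** * Orthogonality of the Darboux transform for an abstract recurrence and abstract functionals *)

Section Darboux.
Variables (F : fieldType) (k : nat).
Variables (A B C : int -> F).

Let predz (n : nat) : n.+1%:Z - 1 = n.
Proof. by rewrite intS addrAC subrr add0r. Qed.

Definition Yz (n : int) : {poly F} :=
  if n is Posz n then ttp A B C n else 0.

Let Y (n : nat) : {poly F} := ttp A B C n.

Hypothesis A_neq0 : forall n : nat, A n != 0.
Hypothesis C_neq0 : forall n : int, 1 - k%:Z <= n -> C n != 0.
Hypothesis k_gt0 : (0 < k)%N.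
Hypothesis A_N1 : A (-1) = 0.

Lemma Y_rec (n : nat) : 'X * Y n = A n *: Y n.+1 + B n *: Y n + C n *: Yz (n%:Z - 1).
Proof. by rewrite /Y ttp_rec//; case: n => [|n]; rewrite ?predz. Qed.

Lemma size_Y n : size (Y n) = n.+1.
Proof. by apply: size_ttp => i _; exact: A_neq0. Qed.

Let C_nat (n : nat) : C n != 0.
Proof. by apply: C_neq0; rewrite lerBlDr lez_nat; case: k k_gt0 => // k' _; rewrite addnS. Qed.

Section Functional.
Variable L : {scalar {poly F}}.
Hypothesis L_Y : forall n, L (Y n.+1) = 0.
Hypothesis L_1 : L 1 != 0.

(** Each factor X is moved onto Y n by the recurrence. Only the lowering terms can reach Y 0, so X^n
    pairs with Y n to C_n ... C_1 L 1. *)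
Let L_Xn_Y j n : (j <= n)%N -> (L ('X^j * Y n) == 0) = (j != n).
Proof.
elim: j n => [|j IH] n jn.
  rewrite expr0 mul1r; case: n jn => [|n] _ /=; last by rewrite L_Y eqxx.
  by rewrite (negPf L_1).
rewrite exprSr -mulrA Y_rec !mulrDr !linearD -!scalerAr !linearZ /=.
have /eqP-> : L ('X^j * Y n.+1) == 0.
  by rewrite IH ?ltn_eqF// ltnW// ltnW.
have /eqP-> : L ('X^j * Y n) == 0 by rewrite IH ?ltn_eqF// ltnW.
case: n jn => [//|n] jn.
by rewrite !mulr0 !add0r eqSS predz /= mulf_eq0 (negPf (C_nat _)) IH.
Qed.

Lemma L_mulY (p : {poly F}) n : (size p <= n)%N -> L (p * Y n) = 0.
Proof.
move=> sp; rewrite -(coefK p) poly_def mulr_suml linear_sum big1// => i _.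
have ln : (i < n)%N by rewrite (leq_trans (ltn_ord i)).
rewrite -scalerAl linearZ /=; have /eqP-> : L ('X^i * Y n) == 0.
  by rewrite L_Xn_Y ?ltn_eqF// ltnW.
by rewrite mulr0.
Qed.

Lemma L_mulY_neq0 (p : {poly F}) n : size p = n.+1 -> L (p * Y n) != 0.
Proof.
move=> sp; rewrite -(coefK p) poly_def sp mulr_suml linear_sum big_ord_recr /=.
rewrite big1 => [|i _].
  rewrite add0r -scalerAl linearZ /= mulf_neq0//.
    by rewrite -[n]/(n.+1.-1) -sp -lead_coefE lead_coef_eq0 -size_poly_eq0 sp.
  by rewrite L_Xn_Y// eqxx.
rewrite -scalerAl linearZ /=; have /eqP-> : L ('X^i * Y n) == 0.
  by rewrite L_Xn_Y ?ltn_eqF// ltnW.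
by rewrite mulr0.
Qed.

Section Geronimus.
Variables (x : 'I_k -> F) (J : {scalar {poly F}}).
Hypothesis xI : injective x.
Hypothesis J_nodal : forall p, J (nodal x * p) = L p.

Variables (t : 'I_k -> F) (phi : 'I_k -> int -> F).
Hypothesis t_neq0 : forall i, t i != 0.
Hypothesis phi_rec : forall i (n : int), 1 - k%:Z <= n ->
  x i * phi i n = A n * phi i (n + 1) + B n * phi i n + C n * phi i (n - 1).
Hypothesis phi_0 : forall i, phi i 0 = t i * J (nodal_but x i).
Hypothesis phi_N1 : forall i, phi i (-1) = - (t i * L 1 / C 0).

Lemma phi_nat i (n : nat) : phi i n = t i * J (nodal_but x i * Y n).
Proof.
have kn (m : nat) : 1 - k%:Z <= m.
  by rewrite lerBlDr lez_nat; case: k k_gt0 => // k' _; rewrite addnS.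
(* The functional J turns the factor x - x_i into L of Y m, which is nonzero only for m = 0; the
   value -(L 1 / C 0) placed at index -1 compensates it. *)
have fr (m : nat) : x i * J (nodal_but x i * Y m) =
    A m * J (nodal_but x i * Y m.+1) + B m * J (nodal_but x i * Y m) +
    C m * (if m is m'.+1 then J (nodal_but x i * Y m') else - (L 1 / C 0)).
  have E : J (nodal x * Y m) = if m is 0 then L 1 else 0.
    by rewrite J_nodal; case: m => [//|m]; exact: L_Y.
  move: E; rewrite (nodalE x i) mulrAC mulrC mulrBl mul_polyC mulrBr.
  rewrite Y_rec !mulrDr -!scalerAr !(linearB, linearD) /= !linearZ /=.
  case: m => [|m]; last by rewrite predz => /eqP; rewrite subr_eq0 => /eqP <-.
  rewrite mulr0 linear0 mulr0 addr0 => /eqP; rewrite subr_eq => /eqP ->.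
  by rewrite mulrN mulrCA divff ?C_nat//; ring.
elim/ltn_ind: n => -[|n] IH; first by rewrite phi_0 mulr1.
apply: (mulfI (A_neq0 n)).
have -> : A n * (t i * J (nodal_but x i * Y n.+1)) =
    t i * (A n * J (nodal_but x i * Y n.+1)) by ring.
have -> : A n * J (nodal_but x i * Y n.+1) = x i * J (nodal_but x i * Y n) -
    B n * J (nodal_but x i * Y n) -
    C n * (if n is m'.+1 then J (nodal_but x i * Y m') else - (L 1 / C 0)).
  by rewrite fr; ring.
have -> : A n * phi i n.+1 = x i * phi i n - B n * phi i n - C n * phi i (n%:Z - 1).
  by rewrite phi_rec// (_ : n.+1%:Z = n%:Z + 1); [ring | lia].
rewrite IH//; case: n IH => [|n] IH.
  by rewrite sub0r phi_N1; ring.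
by rewrite predz IH ?leqnSn//; ring.
Qed.

(** The recurrence read downward from index -1, with A and C exchanged. Since A (-1) = 0, no value
    at index 0 enters. *)
Let rho (n : nat) : {poly F} :=
  ttp (fun j : nat => C (- 1 - j%:Z)) (fun j : nat => B (- 1 - j%:Z))
      (fun j : nat => A (- 1 - j%:Z)) n.

Lemma size_rho n : (n < k)%N -> size (rho n) = n.+1.
Proof.
move=> nk; apply: size_ttp => j jn; apply: C_neq0.
by move: (leq_ltn_trans jn nk); lia.
Qed.

Lemma phi_neg i (n : nat) : (n < k)%N ->
  phi i (- 1 - n%:Z) = - (t i * L 1 / C 0) * (rho n).[x i].
Proof.
move=> nk; rewrite -phi_N1.
have := @ttp_unique _ (fun j : nat => C (- 1 - j%:Z)) (fun j : nat => B (- 1 - j%:Z))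
  (fun j : nat => A (- 1 - j%:Z)) (fun j => phi i (- 1 - j%:Z)) (x i) k.-1.
rewrite /= subr0 -/(rho _) => -> //.
- by move=> j jk; apply: C_neq0; lia.
- move=> j jk; rewrite phi_rec; last by lia.
  have -> : - 1 - j%:Z - 1 = - 1 - j.+1%:Z by lia.
  case: j jk => [|j] jk; first by rewrite !subr0 A_N1 !mul0r; ring.
  have -> : - 1 - j.+1%:Z + 1 = - 1 - j%:Z by lia.
  ring.
- by lia.
Qed.

(* dual_form n r agrees with J (Yz n * r) for r of small degree, even at negative n,
   where Yz n = 0. Cofactors of the phi rows annihilate it, hence the orthogonality. *)
Definition dual_form (n : int) (r : {poly F}) : F :=
  \sum_i lagrange_coef x r i * (phi i n / t i).

Lemma size_divp_nodal (r : {poly F}) : size (r %/ nodal x)%R = (size r - k)%N.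
Proof. by rewrite size_divp ?monic_neq0 ?monic_nodal// size_nodal. Qed.

(** Division of r by the nodal polynomial: the remainder is interpolated at the nodes and yields
    values of phi, while the multiple of [nodal x] passes from J to L. *)
Lemma J_Y_nat (n : nat) (r : {poly F}) :
  J (Yz n * r) = dual_form n r + L (r %/ nodal x * Y n).
Proof.
rewrite {1}(divp_eq r (nodal x)) mulrDr linearD addrC; congr (_ + _); last first.
  by rewrite -J_nodal /Yz -/(Y n); congr (J _); ring.
have nd0 : nodal x != 0 by rewrite monic_neq0 ?monic_nodal.
have sr : (size (r %% nodal x)%R <= k)%N by rewrite -ltnS -(size_nodal x) ltn_modp.
rewrite {1}(lagrange xI sr) mulr_sumr linear_sum; apply: eq_bigr => i _.
rewrite -scalerAr linearZ /= phi_nat [t i * _]mulrC mulfK// [_ * nodal_but x i]mulrC.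
congr (_ * _); rewrite /lagrange_coef; congr (_ / _).
by rewrite [in RHS](divp_eq r (nodal x)) hornerD hornerM horner_nodal mulr0 add0r.
Qed.

Lemma dual_form_neg (n : nat) (r : {poly F}) : (n < k)%N -> (size (r * rho n)%R <= k)%N ->
  dual_form (- 1 - n%:Z) r = - (L 1 / C 0) * (r * rho n)`_k.-1.
Proof.
move=> nk sr; rewrite -(sum_lagrange_coef xI sr) mulr_sumr /dual_form.
apply: eq_bigr => i _; rewrite phi_neg// /lagrange_coef hornerM.
by field; rewrite ?t_neq0 ?nodal_but_neq0 ?C_nat.
Qed.

(** For j <= n the quotient of r by the nodal polynomial has degree below n - j and L kills it. For
    j > n the product of r and [rho] has degree below k - 1, so the dual form is 0, as is [Yz]. *)
Lemma J_Y_dual (n j : nat) (r : {poly F}) : (j <= k)%N ->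
  (size r <= n.+1)%N -> (j == k) ==> (size r <= n)%N ->
  J (Yz (n%:Z - j%:Z) * r) = dual_form (n%:Z - j%:Z) r.
Proof.
move=> jk sr jkr; case: (leqP j n) => jn.
  have -> : n%:Z - j%:Z = (n - j)%N by lia.
  rewrite J_Y_nat L_mulY ?addr0// size_divp_nodal.
  exact: size_quotient_bound.
have -> : n%:Z - j%:Z = - 1 - (j - n.+1)%N%:Z by lia.
have jnk : (j - n.+1 < k)%N by lia.
have srho := size_rho jnk.
have sM : (size (r * rho (j - n.+1))%R <= k.-1)%N.
  apply: leq_trans (size_polyMleq _ _) _; rewrite srho.
  exact: size_product_bound.
rewrite dual_form_neg// ?nth_default ?mulr0//; last by rewrite (leq_trans sM)// leq_pred.
have -> : - 1 - (j - n.+1)%N%:Z = Negz (j - n.+1) by rewrite NegzE; lia.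
by rewrite mul0r linear0.
Qed.

(** The counts of [J_Y_dual] are sharp: for j = k and deg r = n the difference is a nonzero
    L-pairing, or else a nonzero leading coefficient. *)
Lemma J_Y_dual_neq (n : nat) (r : {poly F}) : size r = n.+1 ->
  J (Yz (n%:Z - k%:Z) * r) != dual_form (n%:Z - k%:Z) r.
Proof.
move=> sr; case: (leqP k n) => jn.
  have -> : n%:Z - k%:Z = (n - k)%N by lia.
  rewrite J_Y_nat -subr_eq0 addrAC subrr add0r L_mulY_neq0// size_divp_nodal sr.
  by lia.
have -> : n%:Z - k%:Z = - 1 - (k - n.+1)%N%:Z by lia.
have jnk : (k - n.+1 < k)%N by lia.
have srho := size_rho jnk.
have rn0 : r != 0 by rewrite -size_poly_eq0 sr.
have rhon0 : rho (k - n.+1) != 0 by rewrite -size_poly_eq0 srho.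
have sM : size (r * rho (k - n.+1))%R = k.
  by rewrite size_mul// sr srho; lia.
rewrite dual_form_neg ?sM//.
have -> : - 1 - (k - n.+1)%N%:Z = Negz (k - n.+1) by rewrite NegzE; lia.
rewrite mul0r linear0 eq_sym mulf_neq0 ?oppr_eq0 ?mulf_neq0 ?invr_eq0 ?C_nat//.
have -> : (r * rho (k - n.+1))`_k.-1 = lead_coef (r * rho (k - n.+1)).
  by rewrite lead_coefE sM.
by rewrite lead_coef_eq0 mulf_neq0.
Qed.

Definition tau_det (n : int) : F := \det (\matrix_(i < k, j < k) phi i (n - j%:Z)).

Definition phi_rows (n : int) (v : 'I_k.+1 -> F) : 'M[F]_k.+1 :=
  \matrix_(i, j) if unlift ord_max i is Some i' then phi i' (n - j%:Z) else v j.

(** Cofactors along the last row do not involve that row, which is therefore filled with zeros. *)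
Definition phi_cofactor (n : int) (j : 'I_k.+1) : F :=
  cofactor (phi_rows n (fun=> 0)) ord_max j.

Lemma det_phi_rows n v : \det (phi_rows n v) = \sum_j v j * phi_cofactor n j.
Proof.
rewrite (expand_det_row _ ord_max); apply: eq_bigr => j _.
rewrite mxE unlift_none; congr (_ * (_ * _)); congr (\det _).
by apply/matrixP => i' j'; rewrite !mxE liftK.
Qed.

Lemma phi_cofactor_sum i n : \sum_(j < k.+1) phi i (n - j%:Z) * phi_cofactor n j = 0.
Proof.
rewrite -(det_phi_rows n (fun j => phi i (n - j%:Z))).
rewrite (@determinant_alternate _ _ _ ord_max (lift ord_max i)) ?neq_lift// => j.
by rewrite !mxE unlift_none liftK.
Qed.

Lemma phi_cofactor_max n : phi_cofactor n ord_max = tau_det n.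
Proof.
rewrite /phi_cofactor /cofactor /= addnn -signr_odd odd_double mul1r; congr (\det _).
apply/matrixP => i j; rewrite !mxE liftK; congr (phi i (n - Posz _)).
exact: lift_max.
Qed.

(** The cofactor of Y n is tau at n - 1 up to sign, which fixes the degree of the transform; that of
    the last column is tau at n, which governs the norm. *)
Lemma phi_cofactor_0 n : (phi_cofactor n ord0 == 0) = (tau_det (n - 1) == 0).
Proof.
rewrite /phi_cofactor /cofactor mulf_eq0 signr_eq0 /=; congr (\det _ == 0).
apply/matrixP => i j; rewrite !mxE liftK lift0; congr (phi i _).
by rewrite intS opprD addrA.
Qed.

Definition darboux_poly (n : nat) : {poly F} :=
  \sum_j phi_cofactor n j *: Yz (n%:Z - j%:Z).

Lemma J_darboux (n : nat) (r : {poly F}) : J (darboux_poly n * r) =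
  \sum_j phi_cofactor n j * J (Yz (n%:Z - j%:Z) * r).
Proof.
rewrite mulr_suml linear_sum; apply: eq_bigr => j _.
by rewrite -scalerAl linearZ.
Qed.

Lemma dual_form_cofactor (n : int) (r : {poly F}) :
  \sum_j phi_cofactor n j * dual_form (n - (j : 'I_k.+1)%:Z) r = 0.
Proof.
under eq_bigr => j _ do rewrite /dual_form mulr_sumr.
rewrite exchange_big big1// => i _.
rewrite -[RHS](mulr0 (lagrange_coef x r i / t i)) -[in RHS](phi_cofactor_sum i n).
by rewrite mulr_sumr; apply: eq_bigr => j _; ring.
Qed.

Lemma J_darboux_orth (n : nat) (r : {poly F}) : (size r <= n)%N -> J (darboux_poly n * r) = 0.
Proof.
move=> sr; rewrite J_darboux -[RHS](dual_form_cofactor n r).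
apply: eq_bigr => j _; congr (_ * _); apply: J_Y_dual.
- by rewrite -ltnS.
- exact: leqW.
- by rewrite sr implybT.
Qed.

Lemma J_darboux_neq0 (n : nat) (r : {poly F}) : tau_det n != 0 -> size r = n.+1 ->
  J (darboux_poly n * r) != 0.
Proof.
move=> tn sr; rewrite -subr_eq0 -[X in _ - X](dual_form_cofactor n r) J_darboux.
(* After subtraction of the vanishing sum of dual forms, only the column j = k survives. *)
rewrite !big_ord_recr /= opprD addrACA -sumrB big1 => [|j _].
  by rewrite add0r -mulrBr mulf_neq0 ?subr_eq0 ?J_Y_dual_neq// phi_cofactor_max.
rewrite J_Y_dual ?subrr// ?sr// ?ltn_eqF//=; exact: ltnW.
Qed.

Lemma size_darboux (n : nat) : tau_det (n%:Z - 1) != 0 -> size (darboux_poly n) = n.+1.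
Proof.
rewrite -phi_cofactor_0 => c0; rewrite /darboux_poly big_ord_recl subr0 /Yz -/(Y n) -/Yz.
rewrite size_polyDl size_scale// size_Y// ltnS size_sum_leq// => i.
apply: leq_trans (size_scale_leq _ _) _.
have -> : n%:Z - (lift ord0 i)%:Z = n%:Z - i.+1%:Z by rewrite lift0.
case: (leqP i.+1 n) => ni; last first.
  have -> : n%:Z - i.+1%:Z = Negz (i - n) by rewrite NegzE; lia.
  by rewrite size_poly0.
have -> : n%:Z - i.+1%:Z = (n - i.+1)%N by lia.
by rewrite /Yz size_Y; lia.
Qed.

Theorem darboux_orthogonal : (forall n : int, - 1 <= n -> tau_det n != 0) ->
  [/\ forall n, size (darboux_poly n) = n.+1,
      forall n m, n <> m -> J (darboux_poly n * darboux_poly m) = 0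
    & forall n, J (darboux_poly n * darboux_poly n) != 0].
Proof.
move=> tn; have sP n : size (darboux_poly n) = n.+1 by apply/size_darboux/tn; lia.
split=> // [n m nm|n]; last by rewrite J_darboux_neq0// tn.
case: (ltngtP n m) => // mn; last by rewrite J_darboux_orth// sP.
by rewrite mulrC J_darboux_orth// sP.
Qed.

Definition nondegenerate (I : {poly F} -> F) (n : nat) : Prop :=
  forall S : {poly F}, (size S <= n)%N ->
    (forall r : {poly F}, (size r <= n)%N -> I (S * r) = 0) -> S = 0.

(** A relation w between the columns pairs to 0 with every r. The columns of index at least 0 form a
    polynomial that is null for J, hence zero; the negative ones then form a polynomial of degree
    below k vanishing at all k nodes. Both families are triangular, so w = 0. *)
Lemma tau_det_neq0 (N : nat) : nondegenerate J N -> tau_det (N%:Z - 1) != 0.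
Proof.
move=> nd; rewrite /tau_det -det_tr; apply/det0P => -[w w0 wM].
have wphi i : \sum_j w 0 j * phi i (N%:Z - 1 - j%:Z) = 0.
  have := congr1 (fun M : 'rV_k => M 0 i) wM; rewrite !mxE => E; rewrite -[RHS]E.
  by apply: eq_bigr => j _; rewrite !mxE.
have wdual (r : {poly F}) : \sum_j w 0 j * dual_form (N%:Z - 1 - (j : 'I_k)%:Z) r = 0.
  under eq_bigr => j _ do rewrite /dual_form mulr_sumr.
  rewrite exchange_big big1// => i _.
  rewrite -[RHS](mulr0 (lagrange_coef x r i / t i)) -[in RHS](wphi i).
  by rewrite mulr_sumr; apply: eq_bigr => j _; ring.
(* The entries of w are extended by 0 to all natural numbers so that the sums can be split at N and
   reindexed. *)
pose wn (j : nat) : F := if insub j is Some j' then w 0 j' else 0.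
have wnE (j : 'I_k) : wn j = w 0 j by rewrite /wn valK.
have wlow (j : nat) : (j < k)%N -> (j < N)%N -> wn j = 0.
  case: N nd {wM} wphi wdual => [//|n] nd wphi wdual jk jn.
  have en (i : nat) : n.+1%:Z - 1 - i%:Z = n%:Z - i%:Z by lia.
  pose S := \sum_(i < k) wn i *: Yz (n%:Z - i%:Z).
  have sS : (size S <= n.+1)%N.
    apply: size_sum_leq => i; apply: leq_trans (size_scale_leq _ _) _.
    case: (leqP i n) => ni; last first.
      have -> : n%:Z - i%:Z = Negz (i - n.+1) by rewrite NegzE; lia.
      by rewrite size_poly0.
    have -> : n%:Z - i%:Z = (n - i)%N by lia.
    by rewrite /Yz size_Y; lia.
  have S0 : S = 0.
    apply: nd sS _ => r sr; rewrite mulr_suml linear_sum -[RHS](wdual r).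
    apply: eq_bigr => i _; rewrite -scalerAl linearZ /= wnE en J_Y_dual ?sr//.
    - exact: ltnW.
    - by rewrite ltn_eqF.
  elim/ltn_ind: j jk jn => j IH jk jn.
  have := congr1 (fun p : {poly F} => p`_(n - j)) S0.
  rewrite coef0 coef_sum (bigD1 (Ordinal jk))//= big1 ?addr0 => [|i].
    have -> : n%:Z - j%:Z = (n - j)%N by lia.
    rewrite coefZ /Yz -/(Y (n - j)).
    have -> : (Y (n - j))`_(n - j) = lead_coef (Y (n - j)) by rewrite lead_coefE size_Y.
    move/eqP; rewrite mulf_eq0 lead_coef_eq0 -size_poly_eq0 size_Y orbF.
    by move/eqP.
  rewrite -val_eqE /= coefZ => ij; case: (ltngtP i j) => [ilj|jli|/eqP].
  - by rewrite IH ?mul0r// (leq_trans ilj)// ltnW.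
  - case: (leqP i n) => ni; last first.
      have -> : n%:Z - i%:Z = Negz (i - n.+1) by rewrite NegzE; lia.
      by rewrite coef0 mulr0.
    have -> : n%:Z - i%:Z = (n - i)%N by lia.
    by rewrite nth_default ?mulr0// /Yz size_Y; lia.
  - by rewrite (negPf ij).
have Nk : (N < k)%N.
  rewrite ltnNge; apply: contra w0 => kN; apply/eqP/rowP => j.
  by rewrite mxE -wnE wlow// (leq_trans (ltn_ord j)).
(* The column N + i carries phi at index -1 - i, which is a multiple of [rho i] at the node. *)
pose W := \sum_(i < k - N) wn (N + i)%N *: rho i.
have W0 : W = 0.
  apply: (small_poly_eq0 xI) => [|i].
    apply: size_sum_leq => i; apply: leq_trans (size_scale_leq _ _) _.
    by rewrite size_rho; have := ltn_ord i; lia.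
  apply: (mulfI (_ : - (t i * L 1 / C 0) != 0)).
    by rewrite oppr_eq0 mulf_neq0 ?mulf_neq0 ?invr_eq0 ?C_nat ?t_neq0.
  rewrite mulr0 -(wphi i) horner_sum mulr_sumr.
  transitivity (\sum_(j < k - N) wn (N + j)%N * phi i (- 1 - j%:Z)).
    by apply: eq_bigr => j _; rewrite hornerZ mulrCA -phi_neg//; have := ltn_ord j; lia.
  under [RHS]eq_bigr => j _ do rewrite -wnE.
  rewrite -(big_mkord xpredT (fun j => wn (N + j)%N * phi i (- 1 - j%:Z))).
  rewrite -(big_mkord xpredT (fun j => wn j * phi i (N%:Z - 1 - j%:Z))).
  have Z : \sum_(0 <= j < N) wn j * phi i (N%:Z - 1 - j%:Z) = 0.
    by rewrite big_nat big1// => j /andP[_ jN]; rewrite wlow ?mul0r// (ltn_trans jN).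
  rewrite [RHS](@big_cat_nat _ _ _ N)//= 1?ltnW// Z add0r.
  rewrite -[RHS]/(\sum_(0 + N <= j < k) _) big_addn; apply: eq_bigr => j _.
  by rewrite addnC; congr (_ * phi i _); lia.
have srho (j : nat) : (j < k - N)%N -> size (rho j) = j.+1.
  by move=> jk; apply: size_rho; lia.
have wtop := size_basis_eq0 (c := fun i => wn (N + i)%N) srho W0.
move/negP: w0; apply; apply/eqP/rowP => j; rewrite mxE -wnE.
case: (ltnP j N) => jN; first exact: wlow.
by rewrite -(subnKC jN) wtop//; have := ltn_ord j; lia.
Qed.

End Geronimus.
End Functional.
End Darboux.

(** * Hankel determinants *)

Section Hankel.
Variable F : fieldType.
Implicit Types (I J : {poly F} -> F) (p r S : {poly F}).

Definition scalar_of I (lI : scalar I) : {scalar {poly F}} :=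
  HB.pack I (GRing.isLinear.Build F {poly F} F *%R I lI).

Definition hankel I n : F := \det (\matrix_(i < n, j < n) I 'X^(i + j)).

Lemma scalar_mul_sum I n S r : scalar I -> (size S <= n)%N -> (size r <= n)%N ->
  I (S * r) = \sum_(i < n) \sum_(j < n) S`_i * r`_j * I 'X^(i + j).
Proof.
move=> lI sS sr; rewrite -[I]/(scalar_of lI : _ -> _).
have polyE p : (size p <= n)%N -> p = \sum_(i < n) p`_i *: 'X^i.
  by move=> sp; rewrite -poly_def; apply/polyP => i; rewrite coef_poly; case: ltnP => // ni;
    rewrite nth_default// (leq_trans sp).
rewrite {1}(polyE _ sS) {1}(polyE _ sr) mulr_suml linear_sum; apply: eq_bigr => i _.
rewrite mulr_sumr linear_sum; apply: eq_bigr => j _.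
by rewrite -scalerAl -scalerAr !linearZ /= exprD mulrA.
Qed.

Lemma hankel_eq0 I n : scalar I -> hankel I n = 0 ->
  exists S, [/\ S != 0, (size S <= n)%N &
    forall r, (size r <= n)%N -> I (S * r) = 0].
Proof.
move=> lI /eqP/det0P[v v0 vM]; exists (rVpoly v); split=> [| |r sr].
- by apply: contra v0 => /eqP v0; rewrite -[v]rVpolyK v0 linear0.
- exact: size_poly.
rewrite (scalar_mul_sum lI (size_poly _ _) sr) exchange_big big1// => j _.
have := congr1 (fun M : 'rV_n => r`_j * M 0 j) vM; rewrite !mxE mulr0 => E.
rewrite -[RHS]E mulr_sumr; apply: eq_bigr => i _.
by rewrite mxE coef_rVpoly_ord; ring.
Qed.

Lemma hankel_neq0 I n : scalar I ->
  (forall S, (size S <= n)%N -> (forall r, (size r <= n)%N -> I (S * r) = 0) -> S = 0) ->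
  hankel I n != 0.
Proof.
move=> lI nd; apply/eqP => /(hankel_eq0 lI)[S [S0 sS SI]].
by move: S0; rewrite (nd S sS SI) eqxx.
Qed.

Lemma hankel_nondegenerate I n S : scalar I -> hankel I n != 0 -> (size S <= n)%N ->
  (forall r, (size r <= n)%N -> I (S * r) = 0) -> S = 0.
Proof.
move=> lI h0 sS SI; apply/eqP; apply: contraNT h0 => S0; apply/det0P.
exists (poly_rV S); first by apply: contra S0 => /eqP e; rewrite -(poly_rV_K sS) e linear0.
apply/rowP => j; rewrite !mxE.
have := SI 'X^j; rewrite size_polyXn ltn_ord => /(_ isT).
rewrite (scalar_mul_sum lI sS) ?size_polyXn//= => E; rewrite -[RHS]E.
apply: eq_bigr => i _; rewrite (bigD1 j)//= big1 => [|j' jj'].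
  by rewrite !mxE coefXn eqxx mulr1 addr0.
by rewrite coefXn (_ : (j' == j :> nat) = false) ?mulr0 ?mul0r//; apply: negPf.
Qed.

(* If both determinants vanish, the two null vectors coincide up to a factor, hence
   vanish at y, and the quotient by 'X - y is a null vector of the smaller matrix. *)
Lemma geronimus_hankel J J' y nu1 nu2 n :
  scalar J -> scalar J' -> (forall p, J' (('X - y%:P) * p) = J p) -> nu1 != nu2 ->
  hankel J n != 0 ->
  hankel (fun p => J' p + nu1 * p.[y]) n.+1 != 0 \/
  hankel (fun p => J' p + nu2 * p.[y]) n.+1 != 0.
Proof.
move=> lJ lJ' JJ' nu12 hn.
have lM nu : scalar (fun p => J' p + nu * p.[y]).
  by move=> a p r; rewrite lJ' hornerD hornerZ; ring.
have [h1|h1] := eqVneq (hankel (fun p => J' p + nu1 * p.[y]) n.+1) 0; last by left.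
right; apply/eqP => h2.
have [S1 [S10 sS1 H1]] := hankel_eq0 (lM nu1) h1.
have [S2 [S20 sS2 H2]] := hankel_eq0 (lM nu2) h2.
have orth S nu : (forall r, (size r <= n.+1)%N -> J' (S * r) + nu * (S * r).[y] = 0) ->
    forall r, (size r <= n)%N -> J (S * r) = 0.
  move=> H r sr; rewrite -JJ' mulrCA.
  have : (size (('X - y%:P) * r)%R <= n.+1)%N.
    by rewrite (leq_trans (size_polyMleq _ _))// size_XsubC.
  by move/H; rewrite !hornerM hornerXsubC subrr mul0r !mulr0 addr0.
(* A null vector without top coefficient would already be one for J at order n, which is
   excluded. *)
have lead S nu : S != 0 -> (size S <= n.+1)%N ->
    (forall r, (size r <= n.+1)%N -> J' (S * r) + nu * (S * r).[y] = 0) -> S`_n != 0.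
  move=> S0 sS H; apply: contra S0 => Sn; apply/eqP.
  apply: (hankel_nondegenerate lJ hn _ (orth _ _ H)).
  by apply/leq_sizeP => j; rewrite leq_eqVlt => /predU1P[<-|jn];
    [exact/eqP | rewrite nth_default// (leq_trans sS)].
have c1 := lead _ _ S10 sS1 H1; have c2 := lead _ _ S20 sS2 H2.
have E : S2`_n *: S1 = S1`_n *: S2.
  apply/eqP; rewrite -subr_eq0; apply/eqP.
  apply: (hankel_nondegenerate lJ hn) => [|r sr].
    apply/leq_sizeP => j; rewrite leq_eqVlt => /predU1P[<-|jn].
      by rewrite coefB !coefZ mulrC subrr.
    by rewrite coefB !coefZ (nth_default _ (leq_trans sS1 jn)) (nth_default _ (leq_trans sS2 jn)) !mulr0 subr0.
  rewrite mulrBl -!scalerAl -[J]/(scalar_of lJ : _ -> _) linearB !linearZ /=.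
  by rewrite (orth _ _ H1)// (orth _ _ H2)// !mulr0 subr0.
have {}H2 r : (size r <= n.+1)%N -> J' (S1 * r) + nu2 * (S1 * r).[y] = 0.
  move=> sr; apply: (mulfI c2); rewrite mulr0 mulrDr mulrCA.
  have -> : S2`_n * J' (S1 * r) = S1`_n * J' (S2 * r).
    by rewrite -[J']/(scalar_of lJ' : _ -> _) -!linearZ /= !scalerAl E.
  have -> : S2`_n * (S1 * r).[y] = S1`_n * (S2 * r).[y].
    by rewrite -!hornerZ !scalerAl E.
  by rewrite mulrCA -mulrDr H2// mulr0.
have S1y : S1.[y] = 0.
  have h := H1 1; have h' := H2 1; move: h h'; rewrite size_poly1 mulr1.
  move=> /(_ isT) h /(_ isT) h'; apply: (mulfI (_ : nu1 - nu2 != 0)).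
    by rewrite subr_eq0.
  by rewrite mulr0 mulrBl -[RHS](subrr 0) -{1}h -h'; ring.
move: S10; rewrite (_ : S1 = 0) ?eqxx//.
have [T TE] : exists T, S1 = T * ('X - y%:P) by apply/factor_theorem/rootP.
suff T0 : T = 0 by rewrite TE T0 mul0r.
apply: (hankel_nondegenerate lJ hn) => [|r sr].
  have [->|T0] := eqVneq T 0; first by rewrite size_poly0.
  by move: sS1; rewrite TE size_Mmonic ?monicXsubC// size_XsubC addn2.
have := H1 r (leqW sr); rewrite hornerM S1y mul0r mulr0 addr0.
by rewrite TE -mulrA mulrCA JJ'.
Qed.

(** Masses are added one node at a time. Each node raises the order of the determinant by one, and
    one of the masses 0 and 1 is admissible by [geronimus_hankel]. *)
Lemma masses_hankel (L : {poly F} -> F) (s : seq F) J n :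
  scalar L -> scalar J -> (forall n, hankel L n != 0) -> uniq s ->
  (forall p, J (\prod_(y <- s) ('X - y%:P) * p) = L p) ->
  exists nu : F -> F, hankel (fun p => J p + \sum_(y <- s) nu y * p.[y]) n != 0.
Proof.
move=> lL + hL; elim: s J n => [|y s IH] J n lJ us JL.
  exists (fun=> 0); have := hL n; congr (\det _ != 0); apply/matrixP => i j.
  by rewrite !mxE big_nil addr0 -JL big_nil mul1r.
case: n => [|n]; first by exists (fun=> 0); rewrite /hankel det_mx00 oner_eq0.
move: us => /= /andP[ys us].
pose J1 p := J (('X - y%:P) * p).
have lJ1 : scalar J1 by move=> a p r; rewrite /J1 mulrDr -scalerAr lJ.
have [|nu hnu] := IH J1 n lJ1 us.
  by move=> p; rewrite /J1 -JL big_cons mulrA.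
(* Dividing the mass at z by z - y cancels the value at z of the factor X - y, so that J' restricted
   to multiples of X - y is the functional of the previous stage. *)
pose J' p := J p + \sum_(z <- s) nu z / (z - y) * p.[z].
have lJ' : scalar J'.
  move=> a p r; rewrite /J' lJ mulrDr mulr_sumr addrACA -big_split; congr (_ + _).
  by apply: eq_bigr => z _; rewrite hornerD hornerZ /=; ring.
pose nu' c z := if z == y then c else nu z / (z - y).
have HE c : (fun p => J' p + c * p.[y]) =1
    (fun p => J p + \sum_(z <- y :: s) nu' c z * p.[z]).
  move=> p; rewrite big_cons /nu' eqxx /J' -addrA; congr (_ + _); rewrite addrC.
  by congr (_ + _); apply: eq_big_seq => z zs; case: eqP => // zy; rewrite -zy zs in ys.
have hE c : hankel (fun p => J' p + c * p.[y]) n.+1 =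
    hankel (fun p => J p + \sum_(z <- y :: s) nu' c z * p.[z]) n.+1.
  by congr (\det _); apply/matrixP => i j; rewrite !mxE HE.
have [|||h|h] := @geronimus_hankel (fun p => J1 p + \sum_(z <- s) nu z * p.[z]) J' y 0 1 n _ lJ' _ _ hnu.
- move=> a p r; rewrite lJ1 mulrDr mulr_sumr addrACA -big_split; congr (_ + _).
  by apply: eq_bigr => z _; rewrite hornerD hornerZ /=; ring.
- move=> p; rewrite /J'; congr (_ + _); apply: eq_big_seq => z zs.
  rewrite hornerM hornerXsubC mulrA divfK// subr_eq0.
  by apply: contraNneq ys => <-.
- by rewrite eq_sym oner_eq0.
- by exists (nu' 0); rewrite -hE.
- by exists (nu' 1); rewrite -hE.
Qed.

End Hankel.

(** * The Askey-Wilson weight *)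

Import Normc.

Section ComplexModulus.
Variable R : realType.
Implicit Types (z w : R[i]) (r : R).

Lemma normc_ge0 z : 0 <= normc z.
Proof. by case: z => x y; exact: sqrtr_ge0. Qed.

Lemma normcD z w : normc (z + w) <= normc z + normc w.
Proof. exact: le_normcD. Qed.

Lemma normcB z w : normc (z - w) <= normc z + normc w.
Proof. by rewrite -[normc w]normcN; exact: le_normcD. Qed.

Lemma normc_distC z w : normc (z - w) = normc (w - z).
Proof. by rewrite -normcN opprB. Qed.

Lemma normcX z n : normc (z ^+ n) = normc z ^+ n.
Proof. by elim: n => [|n IH]; rewrite ?expr0 ?normc1// !exprS normcM IH. Qed.

Lemma normc_realE r : normc r%:C = `|r|.
Proof. by rewrite /normc /= expr0n addr0 sqrtr_sqr. Qed.

Lemma normr_Re_le z : `|complex.Re z| <= normc z.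
Proof.
case: z => x y /=; rewrite -sqrtr_sqr ler_sqrt ?addr_ge0 ?sqr_ge0//.
by rewrite lerDl sqr_ge0.
Qed.

Lemma normr_Im_le z : `|complex.Im z| <= normc z.
Proof.
case: z => x y /=; rewrite -sqrtr_sqr ler_sqrt ?addr_ge0 ?sqr_ge0//.
by rewrite lerDr sqr_ge0.
Qed.

Lemma normc_le_ReIm z : normc z <= `|complex.Re z| + `|complex.Im z|.
Proof.
case: z => x y; have -> : x +i* y = x%:C + y%:C * 'i.
  by apply/eqP; rewrite eq_complex /= !(mulr0, mul0r, mulr1, addr0, add0r, subr0) !eqxx.
rewrite (le_trans (normcD _ _))// normcM normc_realE normc_realE /=.
by rewrite expr0n /= add0r expr1n sqrtr1 mulr1 !(mulr0, mul0r, mulr1, addr0, add0r, subr0).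
Qed.

Lemma normc_sum (I : Type) (s : seq I) (P : pred I) (f : I -> R[i]) :
  normc (\sum_(i <- s | P i) f i) <= \sum_(i <- s | P i) normc (f i).
Proof.
elim/big_rec2: _ => [|i x y _ h]; first by rewrite normc0.
by rewrite (le_trans (normcD _ _))// lerD2l.
Qed.

Lemma normc_sub_ge z w : normc z - normc w <= normc (z - w).
Proof. by rewrite lerBlDr -{1}(subrK w z) normcD. Qed.

Lemma normc_eq1V z : normc z = 1 -> normc z^-1 = 1.
Proof. by move=> z1; rewrite normcV z1 invr1. Qed.

Lemma eq0_normc_le (z : R[i]) (q K : R) : 0 <= q < 1 ->
  (forall n, normc z <= K * q ^+ n) -> z = 0.
Proof.
move=> /andP[q0 q1] h; apply: eq0_normc; apply/eqP; rewrite eq_le normc_ge0 andbT.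
have : (fun n => K * q ^+ n) @ \oo --> K * 0.
  by apply: cvgM; [exact: cvg_cst | apply: cvg_expr; rewrite ger0_norm].
rewrite mulr0 => /cvgrPdist_le K0.
apply/ler_addgt0Pl => e e0; rewrite addr0.
have [N _ /(_ N (leqnn N))] := K0 e e0.
by rewrite sub0r normrN => /(le_trans (ler_norm _)); apply: le_trans; exact: h.
Qed.

End ComplexModulus.

(** * Limits with an explicit geometric rate *)

Section GeometricLimits.
Variables (R : realType) (q : R).
Hypothesis q01 : 0 < q < 1.

Let q0 : 0 < q. Proof. by case/andP: q01. Qed.
Let q1 : q < 1. Proof. by case/andP: q01. Qed.
Let q1' : 0 < 1 - q. Proof. by rewrite subr_gt0. Qed.

(** The rate depends only on K and q; with K bounded on a disc it becomes uniform convergence of the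
    infinite products. *)
Lemma limn_geometric (u : nat -> R) (K : R) :
  (forall n, `|u n.+1 - u n| <= K * q ^+ n) ->
  forall n, `|u n - limn u| <= K * q ^+ n / (1 - q).
Proof.
move=> h.
have K0 : 0 <= K by have := le_trans (normr_ge0 _) (h 0%N); rewrite expr0 mulr1.
(* The factor 1 - q^m, a partial geometric sum, is what makes the induction on m close. *)
have step n m : `|u (n + m)%N - u n| <= K * q ^+ n / (1 - q) * (1 - q ^+ m).
  elim: m => [|m IH]; first by rewrite addn0 subrr normr0 expr0 subrr mulr0.
  rewrite addnS -[u _.+1](subrK (u (n + m)%N)) -addrA (le_trans (ler_normD _ _))//.
  rewrite (le_trans (lerD (h _) IH))// exprD exprS le_eqVlt; apply/orP; left; apply/eqP.
  by field; rewrite gt_eqF.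
have bnd n m : `|u (n + m)%N - u n| <= K * q ^+ n / (1 - q).
  rewrite (le_trans (step n m))// ler_piMr//.
    by rewrite divr_ge0 ?mulr_ge0 ?exprn_ge0//; exact: ltW.
  by rewrite lerBlDr lerDl exprn_ge0// ltW.
have cu : cvgn u.
  apply/cauchy_cvgP/cauchy_exP => e e0.
  have : (fun n => K * q ^+ n / (1 - q)) @ \oo --> K * 0 / (1 - q).
    apply: cvgM; last exact: cvg_cst.
    by apply: cvgM; [exact: cvg_cst | apply: cvg_expr; rewrite ger0_norm// ltW].
  rewrite mulr0 mul0r => /cvgrPdist_lt/(_ e e0)[N _ hN].
  exists (u N); exists N => // n /= Nn; rewrite /ball /= distrC.
  rewrite -(subnKC Nn) (le_lt_trans (bnd _ _))//.
  by have := hN N (leqnn N); rewrite sub0r normrN; apply: le_lt_trans; exact: ler_norm.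
move=> n; rewrite distrC.
have c : (fun m => `|u (n + m)%N - u n|) @ \oo --> `|limn u - u n|.
  apply: cvg_norm; apply: cvgB; last exact: cvg_cst.
  by rewrite (_ : (fun m => u (n + m)%N) = (fun m => u (m + n)%N)) ?cvg_shiftn//;
    apply/funext => m; rewrite addnC.
rewrite -(cvg_lim _ c)//; apply: limr_le; first by apply/cvg_ex; eexists; exact: c.
by near=> m; exact: bnd.
Unshelve. all: by end_near. Qed.

Lemma climn_geometric (u : nat -> R[i]) (K : R) :
  (forall n, normc (u n.+1 - u n) <= K * q ^+ n) ->
  forall n, normc (u n - climn u) <= 2 * K * q ^+ n / (1 - q).
Proof.
move=> h n; have hR m : `|complex.Re (u m.+1) - complex.Re (u m)| <= K * q ^+ m.
  rewrite (le_trans _ (h m))// (le_trans _ (normr_Re_le _))//.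
  by case: (u m.+1) => ? ?; case: (u m).
have hI m : `|complex.Im (u m.+1) - complex.Im (u m)| <= K * q ^+ m.
  rewrite (le_trans _ (h m))// (le_trans _ (normr_Im_le _))//.
  by case: (u m.+1) => ? ?; case: (u m).
rewrite (le_trans (normc_le_ReIm _))// -!mulrA mulr2n mulrDl !mul1r !mulrA.
apply: lerD; [apply: le_trans (limn_geometric hR n) | apply: le_trans (limn_geometric hI n)];
  by rewrite /climn; case: (u n).
Qed.

Lemma climn_eventually (u : nat -> R[i]) (l : R[i]) N :
  (forall n, (N <= n)%N -> u n = l) -> climn u = l.
Proof.
move=> h; rewrite /climn; case: l h => x y h; congr (_ +i* _).
  by apply: lim_near_cst => //; exists N => // n /= /h ->.
by apply: lim_near_cst => //; exists N => // n /= /h ->.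
Qed.

End GeometricLimits.

Section QPochhammerLimits.
Variables (R : realType) (q : R).
Hypothesis q01 : 0 < q < 1.

Let q0 : 0 < q. Proof. by case/andP: q01. Qed.
Let q1 : q < 1. Proof. by case/andP: q01. Qed.
Let q1' : 0 < 1 - q. Proof. by rewrite subr_gt0. Qed.

Let normc_term (u : R[i]) n : normc (u * q%:C ^+ n) = normc u * q ^+ n.
Proof. by rewrite normcM normcX normc_realE ger0_norm// ltW. Qed.

Lemma qpochS (u : R[i]) n : qpoch q u n.+1 = qpoch q u n * (1 - u * q%:C ^+ n).
Proof. exact: big_ord_recr. Qed.

Lemma qpochSl (u : R[i]) n : qpoch q u n.+1 = (1 - u) * qpoch q (u * q%:C) n.
Proof. exact: qfactSl. Qed.

Lemma qpoch_le (u : R[i]) n : normc (qpoch q u n) <= expR (normc u / (1 - q)).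
Proof.
have : normc (qpoch q u n) <= expR (normc u * (1 - q ^+ n) / (1 - q)).
  elim: n => [|n IH].
    by rewrite /qpoch big_ord0 normc1 expr0 subrr mulr0 mul0r expR0.
  have h : normc (1 - u * q%:C ^+ n) <= expR (normc u * q ^+ n).
    apply: le_trans (normcB _ _) _; rewrite normc1 normc_term.
    exact: expR_ge1Dx.
  rewrite qpochS normcM; apply: le_trans (ler_pM _ _ IH h) _; rewrite ?normc_ge0//.
  rewrite -expRD ler_expR le_eqVlt; apply/orP; left; apply/eqP.
  by rewrite exprS; field; rewrite gt_eqF.
move/le_trans; apply; rewrite ler_expR ler_pM2r ?invr_gt0//.
by rewrite ler_piMr ?normc_ge0// lerBlDr lerDl exprn_ge0// ltW.
Qed.

(** From 1 - r q^n >= exp(- r q^n / (1 - r)), multiplied over all n. *)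
Definition qpoch_lower (r : R) : R := expR (- (r / (1 - r) / (1 - q))).

Lemma qpoch_lower_gt0 r : 0 < qpoch_lower r. Proof. exact: expR_gt0. Qed.

Lemma qpoch_ge (u : R[i]) r n : normc u <= r -> r < 1 ->
  qpoch_lower r <= normc (qpoch q u n).
Proof.
move=> ur r1; have r0 : 0 <= r := le_trans (normc_ge0 u) ur.
have r1' : 0 < 1 - r by rewrite subr_gt0.
have : expR (- (r / (1 - r) * (1 - q ^+ n) / (1 - q))) <= normc (qpoch q u n).
  elim: n => [|n IH].
    by rewrite /qpoch big_ord0 normc1 expr0 subrr mulr0 mul0r oppr0 expR0.
  rewrite qpochS normcM.
  have -> : - (r / (1 - r) * (1 - q ^+ n.+1) / (1 - q)) =
      - (r / (1 - r) * (1 - q ^+ n) / (1 - q)) + - (r / (1 - r) * q ^+ n).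
    by rewrite exprS; field; rewrite !gt_eqF.
  rewrite expRD; apply: ler_pM IH _; rewrite ?expR_ge0//.
  apply: le_trans (normc_sub_ge _ _); rewrite normc1 normc_term.
  have qn0 : 0 <= q ^+ n by rewrite exprn_ge0// ltW.
  have qn1 : q ^+ n <= 1 by rewrite exprn_ile1// ltW.
  apply: (@le_trans _ _ (1 - r * q ^+ n)); last by rewrite lerD2l lerN2 ler_wpM2r.
  have x1 : 0 < 1 - r * q ^+ n.
    by rewrite subr_gt0 (le_lt_trans _ r1)// ler_piMr.
  rewrite expRN -[leRHS]invrK lef_pV2 ?posrE ?expR_gt0 ?invr_gt0//.
  apply: le_trans (expR_ge1Dx _); rewrite -subr_ge0.
  have -> : 1 + r / (1 - r) * q ^+ n - (1 - r * q ^+ n)^-1 =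
      r ^+ 2 * q ^+ n * (1 - q ^+ n) / ((1 - r) * (1 - r * q ^+ n)).
    by field; rewrite !gt_eqF.
  by rewrite divr_ge0 ?mulr_ge0 ?sqr_ge0 ?(ltW r1') ?(ltW x1) ?subr_ge0.
apply: le_trans; rewrite /qpoch_lower ler_expR lerN2 ler_pM2r ?invr_gt0//.
rewrite ler_piMr ?divr_ge0 ?(ltW r1')//.
by rewrite lerBlDr lerDl exprn_ge0// ltW.
Qed.

(** Successive products differ by at most exp(r/(1-q)) r q^n; the factor 2/(1-q) comes from
    [climn_geometric], which treats real and imaginary parts separately. *)
Definition qpoch_rate (r : R) : R := 2 * (expR (r / (1 - q)) * r) / (1 - q).

Lemma qpoch_inf_cvg (u : R[i]) r n : normc u <= r ->
  normc (qpoch q u n - qpoch_inf q u) <= qpoch_rate r * q ^+ n.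
Proof.
move=> ur; have r0 : 0 <= r := le_trans (normc_ge0 u) ur.
have h m : normc (qpoch q u m.+1 - qpoch q u m) <= expR (r / (1 - q)) * r * q ^+ m.
  rewrite qpochS mulrBr mulr1 addrAC subrr add0r normcN normcM normc_term mulrA.
  rewrite ler_wpM2r ?exprn_ge0 ?(ltW q0)// ler_pM ?normc_ge0//.
  by rewrite (le_trans (qpoch_le _ _))// ler_expR ler_pM2r ?invr_gt0.
apply: le_trans (climn_geometric q01 h n) _.
by rewrite /qpoch_rate mulrAC.
Qed.

Lemma qpoch_rate_ge0 r : 0 <= r -> 0 <= qpoch_rate r.
Proof. by move=> r0; rewrite /qpoch_rate !mulr_ge0 ?expR_ge0 ?invr_ge0// ltW. Qed.

(** Both sides are approximated by the same finite products at a geometric rate, which avoids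
    product rules for the componentwise limit. *)
Lemma qpoch_infS (u : R[i]) : qpoch_inf q u = (1 - u) * qpoch_inf q (u * q%:C).
Proof.
have sh n : normc (qpoch q u n.+1 - (1 - u) * qpoch_inf q (u * q%:C)) <=
    normc (1 - u) * (qpoch_rate (normc (u * q%:C)) * q ^+ n).
  by rewrite qpochSl -mulrBr normcM ler_wpM2l ?normc_ge0// qpoch_inf_cvg.
apply/eqP; rewrite -subr_eq0; apply/eqP.
apply: (@eq0_normc_le _ _ q
  (qpoch_rate (normc u) * q + normc (1 - u) * qpoch_rate (normc (u * q%:C)))).
  by rewrite ltW.
move=> n; rewrite -(subrK (qpoch q u n.+1) (qpoch_inf q u)) -addrA [leRHS]mulrDl.
apply: le_trans (normcD _ _) _; apply: lerD; last by rewrite -mulrA.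
by rewrite normc_distC -mulrA -exprS qpoch_inf_cvg.
Qed.

Lemma qpoch_inf_ge (u : R[i]) r : normc u <= r -> r < 1 ->
  qpoch_lower r <= normc (qpoch_inf q u).
Proof.
move=> ur r1; have r0 : 0 <= r := le_trans (normc_ge0 u) ur.
have : (fun n => qpoch_rate r * q ^+ n) @ \oo --> qpoch_rate r * 0.
  by apply: cvgM; [exact: cvg_cst | apply: cvg_expr; rewrite ger0_norm// ltW].
rewrite mulr0 => /cvgrPdist_le K0; apply/ler_addgt0Pl => e e0.
have [N _ /(_ N (leqnn N))] := K0 e e0.
rewrite sub0r normrN => /(le_trans (ler_norm _)) Ne.
rewrite (le_trans (qpoch_ge N ur r1))// addrC -lerBlDl.
apply: le_trans (normc_sub_ge _ _) _.
by rewrite (le_trans (qpoch_inf_cvg _ ur)).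
Qed.

Lemma qpoch_inf_neq0 (u : R[i]) : normc u < 1 -> qpoch_inf q u != 0.
Proof.
move=> u1; apply/eqP => h; have := qpoch_inf_ge (lexx _) u1.
by rewrite h normc0 leNgt qpoch_lower_gt0.
Qed.

Lemma qpoch_inf_le (u : R[i]) r : normc u <= r ->
  normc (qpoch_inf q u) <= qpoch_rate r + 1.
Proof.
move=> ur; have := qpoch_inf_cvg 0 ur; rewrite expr0 mulr1 /qpoch big_ord0 => h.
rewrite -(subrK 1 (qpoch_inf q u)) (le_trans (normcD _ _))// normc1 lerD2r.
by rewrite normc_distC.
Qed.

End QPochhammerLimits.

(** * Uniform approximation by polynomials on the unit disc *)

Section DiscApproximation.
Variables (R : realType).
Implicit Types (f g : R[i] -> R[i]) (P : {poly R[i]}).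

(* Uniform limits of polynomials on the closed unit disc. *)
Definition disc_approx f : Prop := forall e : R, 0 < e ->
  exists P : {poly R[i]}, forall z, normc z <= 1 -> normc (f z - P.[z]) <= e.

Lemma horner_disc_bound P z : normc z <= 1 ->
  normc P.[z] <= \sum_(i < size P) normc P`_i.
Proof.
move=> z1; rewrite horner_coef (le_trans (normc_sum _ _ _))// ler_sum// => i _.
by rewrite normcM normcX ler_piMr ?normc_ge0// exprn_ile1// normc_ge0.
Qed.

Lemma disc_approx_bound f : disc_approx f ->
  exists2 B : R, 0 < B & forall z, normc z <= 1 -> normc (f z) <= B.
Proof.
move=> /(_ 1 ltr01)[P hP]; exists (1 + \sum_(i < size P) normc P`_i + 1).
  by rewrite ltr_wpDl// addr_ge0// sumr_ge0// => i _; exact: normc_ge0.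
move=> z z1; rewrite -(subrK P.[z] (f z)).
apply: le_trans (normcD _ _) _; rewrite ler_wpDr// lerD ?hP//.
exact: horner_disc_bound.
Qed.

Lemma disc_approx_poly P : disc_approx (fun z => P.[z]).
Proof. by move=> e e0; exists P => z _; rewrite subrr normc0 ltW. Qed.

Lemma disc_approx_ext f g : (forall z, normc z <= 1 -> f z = g z) ->
  disc_approx f -> disc_approx g.
Proof. by move=> fg hf e /hf[P hP]; exists P => z z1; rewrite -fg ?hP. Qed.

Lemma disc_approx_lim f : (forall e : R, 0 < e -> exists g, disc_approx g /\
    forall z, normc z <= 1 -> normc (f z - g z) <= e) -> disc_approx f.
Proof.
move=> h e e0; have e20 : 0 < e / 2 by rewrite divr_gt0.
have [g [hg fg]] := h _ e20; have [P gP] := hg _ e20; exists P => z z1.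
rewrite -(subrK (g z) (f z)) -addrA (splitr e).
by apply: le_trans (normcD _ _) _; rewrite lerD ?fg ?gP.
Qed.

Lemma disc_approxM f g : disc_approx f -> disc_approx g ->
  disc_approx (fun z => f z * g z).
Proof.
move=> hf hg e e0.
have [Bf Bf0 fB] := disc_approx_bound hf; have [Bg Bg0 gB] := disc_approx_bound hg.
(* The bound d <= 1 makes the product of the two errors at most d, and the total error is (Bf + Bg +
   1) d <= e. *)
pose d := Num.min 1 (e / (Bf + Bg + 1)).
have S0 : 0 < Bf + Bg + 1 by rewrite !addr_gt0.
have d0 : 0 < d by rewrite /d lt_min ltr01 divr_gt0.
have [P fP] := hf _ d0; have [Q gQ] := hg _ d0; exists (P * Q) => z z1.
rewrite hornerM; have -> : f z * g z - P.[z] * Q.[z] =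
  f z * (g z - Q.[z]) + g z * (f z - P.[z]) - (f z - P.[z]) * (g z - Q.[z]) by ring.
apply: le_trans (normcB _ _) _; apply: le_trans (lerD (normcD _ _) (lexx _)) _.
rewrite !normcM; apply: (@le_trans _ _ (Bf * d + Bg * d + 1 * d)).
  rewrite !lerD// ler_pM ?normc_ge0 ?fB ?gB ?fP ?gQ//.
  by rewrite (le_trans (fP _ z1))// /d ge_min lexx.
by rewrite -!mulrDl mulrC -ler_pdivlMr// /d ge_min lexx orbT.
Qed.

Lemma disc_approx_inv_linear a : normc a < 1 -> disc_approx (fun z => (1 - a * z)^-1).
Proof.
move=> a1 e e0; have a0 := normc_ge0 a; have s0 : 0 < 1 - normc a by rewrite subr_gt0.
have : (fun n => normc a ^+ n / (1 - normc a)) @ \oo --> 0 / (1 - normc a).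
  by apply: cvgM; [apply: cvg_expr; rewrite ger0_norm | exact: cvg_cst].
rewrite mul0r => /cvgrPdist_le/(_ e e0)[N _ /(_ N (leqnn N))].
rewrite sub0r normrN => /(le_trans (ler_norm _)) hN.
exists (\sum_(i < N) a ^+ i *: 'X^i) => z z1.
have az : normc (a * z) <= normc a by rewrite normcM ler_piMr.
have d0 : 1 - normc a <= normc (1 - a * z).
  by apply: le_trans (normc_sub_ge _ _); rewrite normc1 lerD2l lerN2.
have n0 : 1 - a * z != 0.
  by apply: contraTneq d0 => ->; rewrite normc0 -ltNge.
have -> : (\sum_(i < N) a ^+ i *: 'X^i).[z] = (1 - (a * z) ^+ N) / (1 - a * z).
  apply: (mulIf n0); rewrite divfK// -[in RHS](expr1n _ N) subrXX mulrC.
  congr (_ * _); rewrite horner_sum; apply: eq_bigr => i _.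
  by rewrite hornerZ hornerXn expr1n mul1r exprMn.
rewrite mulrBl mul1r opprB addrC subrK normcM normcX normcV.
apply: le_trans hN; apply: ler_pM; rewrite ?invr_ge0 ?exprn_ge0 ?normc_ge0//.
  by rewrite lerXn2r// nnegrE normc_ge0.
by rewrite lef_pV2// posrE (lt_le_trans s0).
Qed.

Variable q : R.
Hypothesis q01 : 0 < q < 1.

Let normc_qX (a : R[i]) n : normc (a * q%:C ^+ n) <= normc a.
Proof.
case/andP: q01 => q0 q1; rewrite normcM normcX normc_realE ger0_norm ?(ltW q0)//.
by rewrite ler_piMr ?normc_ge0// exprn_ile1// ltW.
Qed.

Lemma normcM_le (a z : R[i]) r : normc a <= r -> normc z <= 1 -> normc (a * z) <= r.
Proof.
by move=> ar z1; rewrite normcM (le_trans _ ar)// ler_piMr// normc_ge0.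
Qed.

Let cvg0 (K e : R) : 0 < e -> exists n, K * q ^+ n <= e.
Proof.
case/andP: q01 => q0 q1 e0.
have : (fun n => K * q ^+ n) @ \oo --> K * 0.
  by apply: cvgM; [exact: cvg_cst | apply: cvg_expr; rewrite ger0_norm// ltW].
rewrite mulr0 => /cvgrPdist_le/(_ e e0)[N _ /(_ N (leqnn N))].
by rewrite sub0r normrN => /(le_trans (ler_norm _)) hN; exists N.
Qed.

(** Finite products of geometric series, followed by a uniform limit; [qpoch_lower] keeps all
    denominators away from 0. *)
Lemma disc_approx_qpochV a : normc a < 1 ->
  disc_approx (fun z => (qpoch_inf q (a * z))^-1).
Proof.
move=> a1; apply: disc_approx_lim => e e0.
pose c := qpoch_lower q (normc a); have c0 : 0 < c := qpoch_lower_gt0 q (normc a).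
have [n hn] := cvg0 (qpoch_rate q (normc a) / c ^+ 2) e0.
exists (fun z => (qpoch q (a * z) n)^-1); split.
  have H : forall m, disc_approx (fun z => (qpoch q (a * z) m)^-1).
    elim=> [|m IH].
      apply: disc_approx_ext (disc_approx_poly 1) => z _.
      by rewrite hornerC /qpoch big_ord0 invr1.
    have am : normc (a * q%:C ^+ m) < 1 by rewrite (le_lt_trans (normc_qX _ _)).
    apply: disc_approx_ext (disc_approxM IH (disc_approx_inv_linear am)) => z _.
    by rewrite qpochS invfM mulrAC [a * z * _]mulrAC; congr (_ * _).
  exact: H.
move=> z z1; have az := normcM_le (lexx (normc a)) z1.
have g1 := qpoch_inf_ge q01 az a1; have g2 := qpoch_ge q01 n az a1.
have x0 : qpoch_inf q (a * z) != 0.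
  by apply: contraTneq g1 => ->; rewrite normc0 -ltNge.
have y0 : qpoch q (a * z) n != 0.
  by apply: contraTneq g2 => ->; rewrite normc0 -ltNge.
have -> : (qpoch_inf q (a * z))^-1 - (qpoch q (a * z) n)^-1 =
   (qpoch q (a * z) n - qpoch_inf q (a * z)) *
   ((qpoch_inf q (a * z))^-1 * (qpoch q (a * z) n)^-1).
  by field; rewrite x0 y0.
rewrite normcM; apply: le_trans hn; rewrite -mulrA [_^-1 * q ^+ n]mulrC mulrA.
apply: ler_pM; rewrite ?normc_ge0//; first exact: qpoch_inf_cvg.
rewrite normcM !normcV expr2 invfM.
by apply: ler_pM; rewrite ?invr_ge0 ?normc_ge0// lef_pV2// posrE (lt_le_trans c0).
Qed.

Lemma disc_approx_qpoch_sqr : disc_approx (fun z => qpoch_inf q (q%:C * z ^+ 2)).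
Proof.
apply: disc_approx_lim => e e0.
have [n hn] := cvg0 (qpoch_rate q 1) e0.
exists (fun z => qpoch q (q%:C * z ^+ 2) n); split.
  apply: disc_approx_ext
    (disc_approx_poly (\prod_(j < n) (1 - (q%:C * q%:C ^+ j) *: 'X^2))) => z _.
  rewrite horner_prod; apply: eq_bigr => j _.
  by rewrite hornerD hornerN hornerZ hornerXn hornerC; ring.
move=> z z1; rewrite normc_distC; apply: le_trans hn.
apply: qpoch_inf_cvg => //; apply: normcM_le.
  by case/andP: q01 => q0 q1; rewrite normc_realE ger0_norm ?ltW.
by rewrite normcX exprn_ile1// normc_ge0.
Qed.

End DiscApproximation.

Section OuterFactor.
Variables (R : realType) (q : R) (a b c d : R[i]).
Hypothesis q01 : 0 < q < 1.
Hypotheses (a1 : normc a < 1) (b1 : normc b < 1) (c1 : normc c < 1) (d1 : normc d < 1).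

(* The factor of the weight that is analytic in the unit disc, see outer_weight. *)
Definition outer (z : R[i]) : R[i] :=
  qpoch_inf q (q%:C * z ^+ 2) /
  (qpoch_inf q (a * z) * qpoch_inf q (b * z) * qpoch_inf q (c * z) * qpoch_inf q (d * z)).

Lemma disc_approx_outer : disc_approx outer.
Proof.
apply: disc_approx_ext
  (disc_approxM (disc_approx_qpoch_sqr q01)
  (disc_approxM (disc_approxM (disc_approxM (disc_approx_qpochV q01 a1)
    (disc_approx_qpochV q01 b1)) (disc_approx_qpochV q01 c1))
    (disc_approx_qpochV q01 d1))) => z _.
by rewrite /outer !invfM.
Qed.

Let nz (u z : R[i]) : normc u < 1 -> normc z <= 1 -> qpoch_inf q (u * z) != 0.
Proof.
move=> u1 z1; apply: qpoch_inf_neq0 => //; apply: le_lt_trans u1.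
exact: normcM_le (lexx _) z1.
Qed.

(** This q-difference equation expresses the shifted factor E(q z) through E(z), and so turns
    [shift_form] into the weight times elementary factors. *)
Lemma outer_shift z : normc z <= 1 ->
  outer z * ((1 - a * z) * (1 - b * z) * (1 - c * z) * (1 - d * z)) =
  (1 - q%:C * z ^+ 2) * (1 - q%:C ^+ 2 * z ^+ 2) * outer (q%:C * z).
Proof.
move=> z1; have qz1 : normc (q%:C * z) <= 1.
  case/andP: q01 => q0 q1; apply: normcM_le z1.
  by rewrite normc_realE ger0_norm ?(ltW q0)// ltW.
rewrite /outer (qpoch_infS q01 (q%:C * z ^+ 2)) (qpoch_infS q01 (_ * q%:C)).
have -> : q%:C * z ^+ 2 * q%:C * q%:C = q%:C * (q%:C * z) ^+ 2 by ring.
have -> : q%:C * z ^+ 2 * q%:C = q%:C ^+ 2 * z ^+ 2 by ring.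
have h u : normc u < 1 -> (qpoch_inf q (u * z) = (1 - u * z) * qpoch_inf q (u * (q%:C * z)))
    /\ (1 - u * z != 0 /\ qpoch_inf q (u * (q%:C * z)) != 0).
  move=> u1; have E : qpoch_inf q (u * z) = (1 - u * z) * qpoch_inf q (u * (q%:C * z)).
    by rewrite qpoch_infS//; congr (_ * qpoch_inf q _); ring.
  split=> //; have := nz u1 z1; rewrite E mulf_eq0 negb_or => /andP[? ?]; split=> //.
have [-> [ha ha']] := h a a1; have [-> [hb hb']] := h b b1.
have [-> [hc hc']] := h c c1; have [-> [hd hd']] := h d d1.
by field; rewrite ha hb hc hd ha' hb' hc' hd'.
Qed.

(** The factors 1 - z^2 and 1 - z^(-2) are kept apart because on the circle their product is 4 (1 -
    x^2), which absorbs the square root in the denominator of the measure. *)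
Lemma outer_weight z : normc z = 1 ->
  qpochs_inf q [:: z ^+ 2; z ^- 2] /
    qpochs_inf q [:: a * z; a / z; b * z; b / z; c * z; c / z; d * z; d / z] =
  (1 - z ^+ 2) * (1 - z ^- 2) * (outer z * outer z^-1).
Proof.
move=> z1; have z1' := normc_eq1V z1.
rewrite /qpochs_inf !big_cons !big_nil /outer (qpoch_infS q01 (z ^+ 2)) (qpoch_infS q01 (z ^- 2)).
rewrite [_ * q%:C]mulrC [z ^- 2 * _]mulrC -exprVn.
have z0 : z != 0 by apply: contra_eq_neq z1 => ->; rewrite normc0 eq_sym oner_eq0.
by field; rewrite z0 !nz ?z1 ?z1'.
Qed.

End OuterFactor.

(** * Componentwise continuity and integration of complex-valued functions *)

Section ComplexIntegral.
Variable R : realType.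
Variables u v : R.
Implicit Types (F G : R -> R[i]).

Definition ccont F : Prop :=
  {within `[u, v], continuous (fun x => complex.Re (F x))} /\
  {within `[u, v], continuous (fun x => complex.Im (F x))}.

Definition cint F : R[i] :=
  (\int[lebesgue_measure]_(x in `[u, v]) complex.Re (F x))
  +i* (\int[lebesgue_measure]_(x in `[u, v]) complex.Im (F x)).

Lemma ReD (z w : R[i]) : complex.Re (z + w) = complex.Re z + complex.Re w.
Proof. by case: z w => ? ? [? ?]. Qed.

Lemma ImD (z w : R[i]) : complex.Im (z + w) = complex.Im z + complex.Im w.
Proof. by case: z w => ? ? [? ?]. Qed.

Lemma ReM (z w : R[i]) : complex.Re (z * w) =
  complex.Re z * complex.Re w - complex.Im z * complex.Im w.
Proof. by case: z w => ? ? [? ?]. Qed.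

Lemma ImM (z w : R[i]) : complex.Im (z * w) =
  complex.Re z * complex.Im w + complex.Im z * complex.Re w.
Proof. by case: z w => ? ? [? ?]. Qed.

Lemma ReB (z w : R[i]) : complex.Re (z - w) = complex.Re z - complex.Re w.
Proof. by case: z w => ? ? [? ?]. Qed.

Lemma ImB (z w : R[i]) : complex.Im (z - w) = complex.Im z - complex.Im w.
Proof. by case: z w => ? ? [? ?]. Qed.

Lemma ccont_ext F G : (forall x, F x = G x) -> ccont F -> ccont G.
Proof. by move=> /funext ->. Qed.

Lemma ccont_real (f : R -> R) : {within `[u, v], continuous f} ->
  ccont (fun x => (f x)%:C).
Proof. by move=> cf; split=> //=; move=> x; exact: cvg_cst. Qed.

Lemma ccont_cst (c : R[i]) : ccont (fun=> c).
Proof. by split=> x; exact: cvg_cst. Qed.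

Lemma ccontD F G : ccont F -> ccont G -> ccont (fun x => F x + G x).
Proof.
move=> [Fr Fi] [Gr Gi]; split.
  rewrite (_ : (fun x => _) = (fun x => complex.Re (F x) + complex.Re (G x))).
    by move=> x; apply: cvgD; [exact: Fr | exact: Gr].
  by apply/funext => x; rewrite ReD.
rewrite (_ : (fun x => _) = (fun x => complex.Im (F x) + complex.Im (G x))).
  by move=> x; apply: cvgD; [exact: Fi | exact: Gi].
by apply/funext => x; rewrite ImD.
Qed.

Lemma ccontM F G : ccont F -> ccont G -> ccont (fun x => F x * G x).
Proof.
move=> [Fr Fi] [Gr Gi]; split.
  rewrite (_ : (fun x => _) = (fun x => complex.Re (F x) * complex.Re (G x) -
      complex.Im (F x) * complex.Im (G x))).
    by move=> x; apply: cvgB; apply: cvgM; [exact: Fr | exact: Gr | exact: Fi | exact: Gi].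
  by apply/funext => x; rewrite ReM.
rewrite (_ : (fun x => _) = (fun x => complex.Re (F x) * complex.Im (G x) +
    complex.Im (F x) * complex.Re (G x))).
  by move=> x; apply: cvgD; apply: cvgM; [exact: Fr | exact: Gi | exact: Fi | exact: Gr].
by apply/funext => x; rewrite ImM.
Qed.

Lemma ccont_sum (I : Type) (s : seq I) (F : I -> R -> R[i]) :
  (forall i, ccont (F i)) -> ccont (fun x => \sum_(i <- s) F i x).
Proof.
move=> h; elim: s => [|i s IH].
  by apply: ccont_ext (ccont_cst 0) => x; rewrite big_nil.
by apply: ccont_ext (ccontD (h i) IH) => x; rewrite big_cons.
Qed.

Lemma ccontX F n : ccont F -> ccont (fun x => F x ^+ n).
Proof.
move=> cF; elim: n => [|n IH]; first exact: ccont_cst.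
by apply: ccont_ext (ccontM cF IH) => x; rewrite exprS.
Qed.

Lemma ccont_horner (P : {poly R[i]}) F : ccont F -> ccont (fun x => P.[F x]).
Proof.
move=> cF.
have h (i : 'I_(size P)) : ccont (fun x => P`_i * F x ^+ i).
  by apply: ccontM; [exact: ccont_cst | exact: ccontX].
by apply: ccont_ext (ccont_sum _ h) => x; rewrite horner_coef.
Qed.

Lemma within_continuous_lim (f : R -> R) :
  (forall e : R, 0 < e -> exists g, {within `[u, v], continuous g} /\
     forall x, u <= x <= v -> `|f x - g x| <= e) ->
  {within `[u, v], continuous f}.
Proof.
move=> h; apply/subspace_continuousP => x /= xuv.
apply/cvgrPdist_le => e e0.
have e30 : 0 < e / 3 by rewrite divr_gt0.
have [g [cg fg]] := h _ e30.
move/subspace_continuousP : cg => /(_ x xuv)/cvgrPdist_le/(_ _ e30) gx.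
near=> t.
have tuv : u <= t <= v.
  have : `[u, v]%classic t by near: t; exact: withinT.
  by rewrite /= in_itv.
have -> : f x - f t = (f x - g x) + (g x - g t) + (g t - f t) by ring.
have -> : e = e / 3 + e / 3 + e / 3 by field.
apply: le_trans (ler_normD _ _) _; apply: lerD; last by rewrite distrC fg.
apply: le_trans (ler_normD _ _) _; apply: lerD.
  by apply: fg; move: xuv; rewrite in_itv.
by near: t.
Unshelve. all: by end_near. Qed.

Lemma ccont_lim F :
  (forall e : R, 0 < e -> exists G, ccont G /\
     forall x, u <= x <= v -> normc (F x - G x) <= e) -> ccont F.
Proof.
move=> h; split; apply: within_continuous_lim => e /h[G [[Gr Gi] FG]].
  exists (fun x => complex.Re (G x)); split=> // x /FG.
  by rewrite -ReB; apply: le_trans; exact: normr_Re_le.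
exists (fun x => complex.Im (G x)); split=> // x /FG.
by rewrite -ImB; apply: le_trans; exact: normr_Im_le.
Qed.

Let integrable_within (f : R -> R) : {within `[u, v], continuous f} ->
  lebesgue_measure.-integrable `[u, v] (EFin \o f).
Proof.
by move=> cf; apply: continuous_compact_integrable => //; exact: segment_compact.
Qed.

Lemma eq_cint F G : (forall x, u <= x <= v -> F x = G x) -> cint F = cint G.
Proof.
move=> FG; rewrite /cint; congr (_ +i* _); apply: eq_Rintegral => x;
  by rewrite in_setE /= in_itv /= => /FG ->.
Qed.

Lemma eq_ccont F G : (forall x, u <= x <= v -> F x = G x) -> ccont F -> ccont G.
Proof.
move=> FG cF; apply: ccont_lim => e e0; exists F; split=> // x /FG ->.
by rewrite subrr normc0 ltW.
Qed.

Lemma cintD F G : ccont F -> ccont G -> cint (fun x => F x + G x) = cint F + cint G.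
Proof.
move=> [Fr Fi] [Gr Gi]; rewrite /cint.
under [X in X +i* _]eq_Rintegral => x _ do rewrite ReD.
under [X in _ +i* X]eq_Rintegral => x _ do rewrite ImD.
by rewrite !RintegralD//; exact: integrable_within.
Qed.

Lemma cintZ (c : R[i]) F : ccont F -> cint (fun x => c * F x) = c * cint F.
Proof.
move=> [Fr Fi]; rewrite /cint.
under [X in X +i* _]eq_Rintegral => x _ do rewrite ReM.
under [X in _ +i* X]eq_Rintegral => x _ do rewrite ImM.
have cM (k : R) (f : R -> R) : {within `[u, v], continuous f} ->
    {within `[u, v], continuous (fun x => k * f x)}.
  by move=> cf x; apply: cvgM; [exact: cvg_cst | exact: cf].
rewrite RintegralB ?RintegralD//; try (by apply: integrable_within; exact: cM).
rewrite !RintegralZl//; try (by apply: integrable_within).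
by case: c => x y.
Qed.

Lemma cint_le F (e : R) : u <= v -> ccont F -> 0 <= e ->
  (forall x, u <= x <= v -> normc (F x) <= e) -> normc (cint F) <= 2 * (e * (v - u)).
Proof.
move=> uv [Fr Fi] e0 Fe.
have bnd (f : R -> R) : {within `[u, v], continuous f} ->
    (forall x, u <= x <= v -> `|f x| <= e) ->
    `|\int[lebesgue_measure]_(x in `[u, v]) f x| <= e * (v - u).
  move=> cf fe; apply: le_trans (le_normr_Rintegral _ _) _ => //.
    exact: integrable_within.
  have cn : {within `[u, v], continuous (fun x => `|f x|)}.
    by move=> x; apply: cvg_norm; exact: cf.
  have -> : e * (v - u) = \int[lebesgue_measure]_(x in `[u, v]) cst e x.
    rewrite Rintegral_cst//; congr (_ * _).
    have -> : v - u = fine (lebesgue_measure [set` `[u, v] : interval R]).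
      rewrite lebesgue_measure_itv /= lte_fin; case: ltP => //= vu.
      by apply/eqP; rewrite subr_eq0 eq_le uv vu.
    by [].
  apply: le_Rintegral => //.
  - exact: integrable_within.
  - by apply: integrable_within => x; exact: cvg_cst.
apply: le_trans (normc_le_ReIm _) _; rewrite mulr2n mulrDl mul1r; apply: lerD; apply: bnd => // x xuv.
  by rewrite (le_trans (normr_Re_le _))// Fe.
by rewrite (le_trans (normr_Im_le _))// Fe.
Qed.

Lemma cint0 : cint (fun=> 0) = 0.
Proof.
rewrite -[RHS](mul0r (cint (fun=> 0))) -(cintZ 0 (ccont_cst 0)).
by apply: eq_cint => x _; rewrite mul0r.
Qed.

Lemma cintB F G : ccont F -> ccont G -> cint (fun x => F x - G x) = cint F - cint G.
Proof.
move=> cF cG; rewrite -mulN1r -cintZ// -cintD//; last exact: ccontM (ccont_cst _) cG.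
by apply: eq_cint => x _; rewrite mulN1r.
Qed.

Lemma cint_sum (I : Type) (s : seq I) (F : I -> R -> R[i]) :
  (forall i, ccont (F i)) -> cint (fun x => \sum_(i <- s) F i x) = \sum_(i <- s) cint (F i).
Proof.
move=> h; elim: s => [|i s IH].
  by rewrite big_nil -[RHS]cint0; apply: eq_cint => x _; rewrite big_nil.
rewrite big_cons -IH -cintD//; last exact: ccont_sum.
by apply: eq_cint => x _; rewrite big_cons.
Qed.

Lemma cint_eq0_lim F : u <= v -> ccont F ->
  (forall e : R, 0 < e -> exists G, [/\ ccont G, cint G = 0 &
     forall x, u <= x <= v -> normc (F x - G x) <= e]) -> cint F = 0.
Proof.
move=> uv cF h; apply: eq0_normc; apply/eqP; rewrite eq_le normc_ge0 andbT.
apply/ler_addgt0Pl => e e0; rewrite addr0.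
have k0 : 0 < 2 * (v - u) + 1 by lra.
have [G [cG G0 FG]] := h (e / (2 * (v - u) + 1)) (divr_gt0 e0 k0).
rewrite -[cint F]subr0 -G0 -cintB//.
have cFG : ccont (fun x => F x - G x).
  apply: eq_ccont (ccontD cF (ccontM (ccont_cst (-1)) cG)) => x _.
  by rewrite mulN1r.
apply: le_trans (cint_le uv cFG (ltW (divr_gt0 e0 k0)) FG) _.
set k := 2 * (v - u) + 1 in k0 *.
have -> : 2 * (e / k * (v - u)) = e * (2 * (v - u) / k) by ring.
rewrite ler_piMr ?(ltW e0)// ler_pdivrMr// mul1r /k; lra.
Qed.

End ComplexIntegral.

(** * Integrals over the unit circle and the substitution x = cos t *)

Section Circle.
Variable R : realType.
Implicit Types (t : R) (h : R -> R).

Definition eit t : R[i] := cos t +i* sin t.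

Lemma normc_eit t : normc (eit t) = 1.
Proof. by rewrite /= cos2Dsin2 sqrtr1. Qed.

Lemma eit_neq0 t : eit t != 0.
Proof.
apply/eqP => e; have := normc_eit t; rewrite e normc0 => /eqP.
by rewrite eq_sym oner_eq0.
Qed.

Lemma eitV t : (eit t)^-1 = cos t -i* sin t.
Proof.
apply: (mulfI (eit_neq0 t)); rewrite mulfV ?eit_neq0//.
apply/eqP; rewrite eq_complex /=; apply/andP; split; apply/eqP.
  by rewrite -(cos2Dsin2 t); ring.
by ring.
Qed.

Lemma eitX t n : eit t ^+ n = eit (n%:R * t).
Proof.
elim: n => [|n IH]; first by rewrite expr0 mul0r /eit cos0 sin0.
rewrite exprS IH -natr1 mulrDl mul1r [_ + t]addrC /eit cosD sinD.
by apply/eqP; rewrite eq_complex /=; apply/andP; split; apply/eqP; ring.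
Qed.

Lemma ccont_eit (u v : R) : ccont u v eit.
Proof.
split; apply: continuous_subspaceT; [exact: continuous_cos | exact: continuous_sin].
Qed.

Lemma ccont_eitV (u v : R) : ccont u v (fun t => (eit t)^-1).
Proof.
apply: (@ccont_ext _ _ _ (fun t => cos t -i* sin t)); first by move=> t; rewrite eitV.
split; apply: continuous_subspaceT => /=; first exact: continuous_cos.
by move=> x; apply: cvgN; exact: continuous_sin.
Qed.

Lemma continuous_cos_scale (k : R) : continuous (fun t : R => cos (k * t)).
Proof.
move=> t; apply: (@continuous_comp _ _ _ (fun t => k * t) cos).
  by apply: cvgM; [exact: cvg_cst | exact: cvg_id].
exact: continuous_cos.
Qed.

Lemma Rintegral_cos n : (0 < n)%N ->
  \int[lebesgue_measure]_(t in `[0, pi]) cos (n%:R * t) = 0 :> R.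
Proof.
move=> n0; have n0' : (n%:R : R) != 0 by rewrite pnatr_eq0 -lt0n.
have D t : is_derive t 1 (fun t => n%:R^-1 * sin (n%:R * t)) (cos (n%:R * t)).
  apply: is_derive_eq; rewrite /GRing.scale /=.
  by field.
rewrite /Rintegral (@continuous_FTC2 _ (fun t => cos (n%:R * t)) (fun t => n%:R^-1 * sin (n%:R * t))).
(* The sine of n pi is the imaginary part of (-1)^n, by de Moivre's formula. *)
- have sn : sin (n%:R * pi) = 0 :> R.
    have := congr1 (@complex.Im R) (eitX pi n); rewrite /= => <-.
    have -> : eit pi = (-1)%:C by rewrite /eit cospi sinpi.
    by rewrite -rmorphXn.
  by rewrite mulr0 sin0 sn mulr0 -EFinB /= subrr.
- exact: pi_gt0.
- by apply: continuous_subspaceT; exact: continuous_cos_scale.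
- have cF : continuous (fun t : R => n%:R^-1 * sin (n%:R * t)).
    by move=> t; apply: differentiable_continuous; apply/derivable1_diffP; case: (D t).
  split=> //.
  + exact: cvg_at_right_filter (cF _).
  + exact: cvg_at_left_filter (cF _).
- by move=> t _; rewrite derive1E; case: (D t).
Qed.

Lemma Rintegral_cos_subst h : {within `[-1, 1], continuous h} ->
  \int[lebesgue_measure]_(x in `[-1, 1]) h x =
  \int[lebesgue_measure]_(t in `[0, pi]) (h (cos t) * sin t).
Proof.
move=> ch; rewrite /Rintegral.
have E1 : cos (pi : R) = -1 := cospi _.
have E0 : cos (0 : R) = 1 := cos0 _.
have dcos : (@cos R)^`()%classic = (fun t => - sin t).
  by apply/funext => t; rewrite derive1E derive_val.
have cs : continuous (fun t : R => - sin t).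
  by move=> t; apply: cvgN; exact: continuous_sin.
rewrite -[X in `[X, _]]E1 -[X in `[_, X]]E0 integration_by_substitution_decreasing //.
- congr fine; apply: eq_integral => t _; congr (_%:E).
  by rewrite /= dcos fctE /= opprK.
- exact: pi_ge0.
- by move=> x y x0 y0; rewrite ltr_cos.
- by rewrite dcos => x _; exact: cs.
- by rewrite dcos; apply/cvg_ex; exists (- sin 0); exact: cvg_at_right_filter (cs _).
- by rewrite dcos; apply/cvg_ex; exists (- sin pi); exact: cvg_at_left_filter (cs _).
- split=> //.
  + by apply: cvg_at_right_filter; exact: continuous_cos.
  + by apply: cvg_at_left_filter; exact: continuous_cos.
- by rewrite E1 E0.
Qed.

End Circle.

Section CircleIntegrals.
Variable R : realType.

(** The point of the upper half circle above x. Unlike [joukowski_inv] it is explicit and visibly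
    continuous; the two agree up to inversion by [joukowski_circle]. *)
Definition circle_z (x : R) : R[i] := x +i* Num.sqrt (1 - x ^+ 2).

Let sub_sqr_ge0 (x : R) : -1 <= x <= 1 -> 0 <= 1 - x ^+ 2.
Proof. by move=> /andP[? ?]; nra. Qed.

Lemma normc_circle_z x : -1 <= x <= 1 -> normc (circle_z x) = 1.
Proof. by move=> x1; rewrite /= sqr_sqrtr ?sub_sqr_ge0// addrC subrK sqrtr1. Qed.

Lemma circle_z_neq0 x : -1 <= x <= 1 -> circle_z x != 0.
Proof.
move=> x1; apply/eqP => e; have := normc_circle_z x1; rewrite e normc0 => /eqP.
by rewrite eq_sym oner_eq0.
Qed.

Lemma circle_zV x : -1 <= x <= 1 -> (circle_z x)^-1 = x -i* Num.sqrt (1 - x ^+ 2).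
Proof.
move=> x1; apply: (mulfI (circle_z_neq0 x1)); rewrite mulfV ?circle_z_neq0//.
apply/eqP; rewrite eq_complex /=; apply/andP; split; apply/eqP; last by ring.
by rewrite mulrN opprK -[X in _ + X]expr2 sqr_sqrtr ?sub_sqr_ge0//; ring.
Qed.

Lemma circle_zD x : -1 <= x <= 1 -> circle_z x + (circle_z x)^-1 = (2 * x)%:C.
Proof.
move=> x1; rewrite circle_zV//; apply/eqP; rewrite eq_complex /=.
by apply/andP; split; apply/eqP; ring.
Qed.

Lemma circle_z_cos t : 0 <= t <= pi -> circle_z (cos t) = eit t.
Proof.
move=> t0; rewrite /circle_z /eit -sin2cos2 sqrtr_sqr ger0_norm//.
exact: sin_ge0_pi.
Qed.

Lemma cos_itv (t : R) : -1 <= cos t <= 1.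
Proof. by rewrite cos_geN1 cos_le1. Qed.

Lemma ccont_id (u v : R) : ccont u v (fun x => x%:C).
Proof. by apply: ccont_real; apply: continuous_subspaceT => x; exact: cvg_id. Qed.

Lemma continuous_sqrt_sub_sqr : continuous (fun x : R => Num.sqrt (1 - x ^+ 2)).
Proof.
move=> x; apply: (@continuous_comp _ _ _ (fun x : R => 1 - x ^+ 2) Num.sqrt).
  by apply: cvgB; [exact: cvg_cst | exact: exprn_continuous].
exact: sqrt_continuous.
Qed.

Lemma ccont_circle_z (u v : R) : ccont u v circle_z.
Proof.
split; apply: continuous_subspaceT => x /=; first exact: cvg_id.
exact: continuous_sqrt_sub_sqr.
Qed.

Lemma ccont_circle_zV : ccont (-1) 1 (fun x => (circle_z x)^-1).
Proof.
apply: (@eq_ccont _ _ _ (fun x => x -i* Num.sqrt (1 - x ^+ 2))).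
  by move=> x /circle_zV.
split; apply: continuous_subspaceT => x /=; first exact: cvg_id.
by apply: cvgN; exact: continuous_sqrt_sub_sqr.
Qed.

Lemma cint_cos_subst (F : R -> R[i]) : ccont (-1) 1 F ->
  cint (-1) 1 F = cint 0 pi (fun t => F (cos t) * (sin t)%:C).
Proof.
move=> [Fr Fi]; rewrite /cint (Rintegral_cos_subst Fr) (Rintegral_cos_subst Fi).
by congr (_ +i* _); apply: eq_Rintegral => t _;
  rewrite (ReM, ImM) /= mulr0 ?subr0 ?add0r.
Qed.

Definition circle_power (m : int) (t : R) : R[i] := eit t ^ m + eit t ^ (- m).

Lemma ccont_circle_power (u v : R) m : ccont u v (circle_power m).
Proof.
have h (n : int) : ccont u v (fun t => eit t ^ n).
  case: n => n; first by apply: ccontX; exact: ccont_eit.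
  apply: (@ccont_ext _ _ _ (fun t => (eit t)^-1 ^+ n.+1)) => [t|].
    by rewrite exprVn.
  by apply: ccontX; exact: ccont_eitV.
by apply: ccontD.
Qed.

Lemma circle_powerN m : circle_power (- m) = circle_power m.
Proof. by apply/funext => t; rewrite /circle_power opprK addrC. Qed.

Lemma cint_circle_power m : m != 0 -> cint 0 pi (circle_power m) = 0.
Proof.
suff h n : cint 0 pi (circle_power n.+1%:Z) = 0.
  case: m => [[|n]|n] m0; [by rewrite eqxx in m0 | exact: h |].
  by rewrite NegzE circle_powerN h.
rewrite /cint; apply/eqP; rewrite eq_complex /=.
have E t : circle_power n.+1%:Z t = (2 * cos (n.+1%:R * t))%:C.
  rewrite /circle_power -exprnN -exprnP eitX eitV /eit; apply/eqP; rewrite eq_complex /=.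
  by apply/andP; split; apply/eqP; ring.
apply/andP; split; apply/eqP.
  under eq_Rintegral => t _ do rewrite E /=.
  rewrite RintegralZl//; first by rewrite Rintegral_cos// mulr0.
  apply: continuous_compact_integrable; first exact: segment_compact.
  by apply: continuous_subspaceT; exact: continuous_cos_scale.
under eq_Rintegral => t _ do rewrite E /=.
by have [] := cint0 0 (pi : R).
Qed.

(** The expression is antisymmetric under z -> 1/(qz). For g(z) = (1 - z^2) E(z), its sum over z and
    1/z is the weight times a polynomial of degree 1 in x, see [shift_form_sym]. *)
Definition shift_form (q : R) (g : R[i] -> R[i]) (z : R[i]) : R[i] :=
  g (q%:C * z) * g z^-1 * (q%:C * z - z^-1).

(* The constant term of p(qz) p(1/z) (qz - 1/z) vanishes, since that expression is
   antisymmetric under z -> 1/(qz). *)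
Lemma cint_shift_form_poly (q : R) (p : {poly R[i]}) :
  cint 0 pi (fun t => shift_form q (horner p) (eit t) +
                      shift_form q (horner p) (eit t)^-1) = 0.
Proof.
pose N := size p.
pose S (i j : 'I_N) (t : R) : R[i] :=
  p`_i * p`_j * (q%:C ^+ i.+1 * circle_power (i.+1%:Z - j%:Z) t -
                 q%:C ^+ i * circle_power (i%:Z - j.+1%:Z) t).
have cS i j : ccont 0 pi (S i j).
  apply: ccontM; first exact: ccont_cst.
  apply: (@ccont_ext _ _ _ (fun t => q%:C ^+ i.+1 * circle_power (i.+1%:Z - j%:Z) t +
                 (- q%:C ^+ i) * circle_power (i%:Z - j.+1%:Z) t)) => [t|].
    by rewrite mulNr.
  by apply: ccontD; apply: ccontM (ccont_cst _ _ _) _; exact: ccont_circle_power.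
transitivity (cint 0 pi (fun t => \sum_i \sum_j S i j t)).
  apply: eq_cint => t _; set z := eit t; have z0 : z != 0 := eit_neq0 t.
  have half w : w != 0 -> shift_form q (horner p) w = \sum_(i < N) \sum_(j < N)
      p`_i * p`_j * (q%:C ^+ i.+1 * w ^ (i.+1%:Z - j%:Z) - q%:C ^+ i * w ^ (i%:Z - j.+1%:Z)).
    move=> w0; rewrite /shift_form !horner_coef mulr_suml mulr_suml; apply: eq_bigr => i _.
    rewrite mulr_sumr mulr_suml; apply: eq_bigr => j _.
    rewrite !expfzDr// -!exprnP -!exprnN exprMn !exprS exprVn.
    have wi := expf_neq0 i w0; have wj := expf_neq0 j w0.
    by field; rewrite wj w0.
  rewrite !half ?invr_eq0// -big_split; apply: eq_bigr => i _.
  rewrite -big_split; apply: eq_bigr => j _.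
  rewrite /S /circle_power -/z !exprz_inv /=; ring.
rewrite cint_sum => [|i]; last exact: ccont_sum.
under eq_bigr => i _ do rewrite cint_sum//.
pose T m := cint 0 pi (circle_power m).
have cZ (c : R[i]) m : ccont 0 pi (fun t => c * circle_power m t).
  by apply: ccontM; [exact: ccont_cst | exact: ccont_circle_power].
have SE i j : cint 0 pi (S i j) = p`_i * p`_j *
    (q%:C ^+ i.+1 * T (i.+1%:Z - j%:Z)) - p`_i * p`_j * (q%:C ^+ i * T (i%:Z - j.+1%:Z)).
  rewrite cintZ; last first.
    apply: (@ccont_ext _ _ _ (fun t => q%:C ^+ i.+1 * circle_power (i.+1%:Z - j%:Z) t +
                 (- q%:C ^+ i) * circle_power (i%:Z - j.+1%:Z) t)) => [t|].
      by rewrite mulNr.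
    exact: ccontD.
  rewrite cintB// !cintZ ?mulrBr//; exact: ccont_circle_power.
under eq_bigr => i _ do under eq_bigr => j _ do rewrite SE.
under eq_bigr => i _ do rewrite sumrB.
rewrite sumrB [X in _ - X]exchange_big /=; apply/eqP; rewrite subr_eq0; apply/eqP.
apply: eq_bigr => i _; apply: eq_bigr => j _; rewrite [p`_j * _]mulrC; congr (_ * _).
have -> : j%:Z - i.+1%:Z = - (i.+1%:Z - j%:Z) by rewrite opprB.
rewrite /T circle_powerN.
(* For i + 1 = j the two powers of q agree; otherwise the integral vanishes. *)
have [->|ij] := eqVneq (i.+1) j; first by [].
by rewrite cint_circle_power ?mulr0// subr_eq0.
Qed.

End CircleIntegrals.

Section SymmetricLaurent.
Variable F : fieldType.
Hypothesis two_neq0 : (2 : F) != 0.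

Lemma sym_laurent_power n : exists Q : {poly F}, forall z, z != 0 ->
  z ^+ n + z^-1 ^+ n = Q.[(z + z^-1) / 2].
Proof.
suff [Q [Q' hQ]] : exists Q Q' : {poly F}, forall z, z != 0 ->
    z ^+ n + z^-1 ^+ n = Q.[(z + z^-1) / 2] /\
    z ^+ n.+1 + z^-1 ^+ n.+1 = Q'.[(z + z^-1) / 2].
  by exists Q => z /hQ[].
elim: n => [|n [Q [Q' hQ]]].
  exists 2%:P, (2 *: 'X) => z z0.
  rewrite hornerC hornerZ hornerX !expr0 !expr1; split=> //.
  by field; rewrite ?two_neq0 ?z0.
exists Q', (2 *: ('X * Q') - Q) => z z0; have [q1 q2] := hQ z z0; split=> //.
rewrite hornerD hornerN hornerZ hornerM hornerX -q1 -q2 !exprS.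
by move: (z ^+ n) (z^-1 ^+ n) => u v; field; rewrite ?two_neq0 ?z0.
Qed.

Lemma sym_laurent_sum (p : {poly F}) : exists Q : {poly F}, forall z, z != 0 ->
  p.[z] + p.[z^-1] = Q.[(z + z^-1) / 2].
Proof.
have /choice[T hT] := sym_laurent_power.
exists (\sum_(i < size p) p`_i *: T i) => z z0.
rewrite !(horner_coef p) horner_sum -big_split; apply: eq_bigr => i _.
by rewrite hornerZ -hT//= mulrDr.
Qed.

(** Converts an approximation of E by polynomials in z into one of E(z) E(1/z) by polynomials in
    x. *)
Lemma sym_laurent_prod (p : {poly F}) : exists Q : {poly F}, forall z, z != 0 ->
  p.[z] * p.[z^-1] = Q.[(z + z^-1) / 2].
Proof.
elim/poly_ind: p => [|p c [Q hQ]]; first by exists 0 => z _; rewrite !horner0 mul0r.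
have [S hS] := sym_laurent_sum (p * 'X).
exists (Q + c *: S + (c ^+ 2)%:P) => z z0.
rewrite !hornerD hornerZ -hQ// -hS// !hornerMX !hornerC.
by move: p.[z] p.[z^-1] => u v; field; rewrite ?two_neq0 ?z0.
Qed.

End SymmetricLaurent.

Lemma normc_mul_diff (R : realType) (x y x' y' : R[i]) (B e : R) :
  normc x <= B -> normc y <= B -> normc (x - x') <= e -> normc (y - y') <= e -> e <= 1 ->
  normc (x * y - x' * y') <= B * e + e * B + e * 1.
Proof.
move=> xB yB xe ye e1.
have -> : x * y - x' * y' = x * (y - y') + (x - x') * y - (x - x') * (y - y') by ring.
apply: le_trans (normcB _ _) _; apply: lerD; last first.
  by rewrite normcM ler_pM ?normc_ge0// (le_trans ye).
apply: le_trans (normcD _ _) _; rewrite !normcM.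
by apply: lerD; apply: ler_pM; rewrite ?normc_ge0.
Qed.

(** * The weight as a continuous kernel, and its first moment relation *)

Section AskeyWilsonWeight.
Variables (R : realType) (q : R) (a b c d : R[i]).
Hypothesis q01 : 0 < q < 1.
Hypotheses (a1 : normc a < 1) (b1 : normc b < 1) (c1 : normc c < 1) (d1 : normc d < 1).

Let E := outer q a b c d.

Definition aw_density (x : R) : R[i] := E (circle_z x) * E (circle_z x)^-1.

(** The factor is 4 (1 - x^2) / (2 pi sqrt(1 - x^2)) after cancellation, so the kernel is continuous
    up to the endpoints. *)
Definition aw_kernel (x : R) : R[i] :=
  (2 / pi * Num.sqrt (1 - x ^+ 2))%:C * aw_density x.

Lemma joukowski_circle (x : R) : -1 <= x <= 1 ->
  joukowski_inv x%:C = circle_z x \/ joukowski_inv x%:C = (circle_z x)^-1.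
Proof.
move=> x1; have z0 := circle_z_neq0 x1.
have := joukowski_invK x%:C; set w := joukowski_inv _ => wx.
have w0 : w != 0.
  rewrite /w /joukowski_inv; apply/eqP => /eqP; rewrite addr_eq0 => /eqP e.
  have := sqrtCK ((x%:C : R[i]) ^+ 2 - 1).
  rewrite -[sqrtC _]opprK -e sqrrN => /eqP; rewrite -subr_eq0 opprB addrC subrK.
  by rewrite oner_eq0.
have : (w - circle_z x) * (w - (circle_z x)^-1) = 0.
  have -> : (w - circle_z x) * (w - (circle_z x)^-1) =
     w * (w + w^-1 - (circle_z x + (circle_z x)^-1)) by field; rewrite w0 z0.
  rewrite circle_zD// rmorphM /= -[in X in _ - X]wx -[2%:C]/(2%:R%:C) rmorph_nat.
  by field.
by move/eqP; rewrite mulf_eq0 !subr_eq0 => /orP[] /eqP ->; [left | right].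
Qed.

Lemma aw_weight_kernel (x : R) : -1 <= x <= 1 ->
  aw_weight q a b c d x / (2 * pi * Num.sqrt (1 - x ^+ 2))%:C = aw_kernel x.
Proof.
move=> x1; have z0 := circle_z_neq0 x1; have z1 := normc_circle_z x1.
have -> : aw_weight q a b c d x = (4 * (1 - x ^+ 2))%:C * aw_density x.
  have zz : (1 - circle_z x ^+ 2) * (1 - circle_z x ^- 2) = (4 * (1 - x ^+ 2))%:C.
    have -> : (4 * (1 - x ^+ 2))%:C = 4%:R - ((2 * x)%:C : R[i]) ^+ 2.
      by rewrite -rmorphXn -(rmorph_nat (real_complex R)) -rmorphB /=; congr _%:C; ring.
    by rewrite -circle_zD//; field.
  rewrite -zz /aw_weight /aw_density; have [->|->] := joukowski_circle x1.
    by rewrite (outer_weight q01 a1 b1 c1 d1 z1).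
  rewrite (outer_weight q01 a1 b1 c1 d1 (normc_eq1V z1)) invrK.
  by rewrite !exprVn invrK; rewrite [E _^-1 * _]mulrC [X in X * _]mulrC.
rewrite /aw_kernel mulrAC; congr (_ * _); rewrite -fmorphV -rmorphM; congr (_%:C).
have x20 : 0 <= 1 - x ^+ 2 by case/andP: x1 => ? ?; nra.
rewrite -{1}(sqr_sqrtr x20) /=; set s := Num.sqrt _.
(* At the endpoints x = 1 and x = -1 both sides are 0, because division by 0 yields 0. *)
have [->|s0] := eqVneq s 0; first by rewrite !(mulr0, expr0n, invr0).
have pi0 : (pi : R) != 0 by rewrite gt_eqF// pi_gt0.
by move: (pi : R) pi0 => p p0; field; rewrite ?s0 ?p0.
Qed.

Lemma aw_integral_cint (f : R -> R[i]) :
  aw_integral q a b c d f = cint (-1) 1 (fun x => f x * aw_kernel x).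
Proof. by apply: eq_cint => x x1; rewrite aw_weight_kernel. Qed.

Lemma ccont_disc (u v : R) (g : R[i] -> R[i]) (z : R -> R[i]) : disc_approx g ->
  ccont u v z -> (forall x, u <= x <= v -> normc (z x) <= 1) ->
  ccont u v (fun x => g (z x)).
Proof.
move=> hg cz z1; apply: ccont_lim => e /hg[P gP]; exists (fun x => P.[z x]).
by split=> [|x /z1]; [exact: ccont_horner | exact: gP].
Qed.

Let hE : disc_approx E := disc_approx_outer q01 a1 b1 c1 d1.

Lemma ccont_density : ccont (-1) 1 aw_density.
Proof.
apply: ccontM; apply: ccont_disc hE _ _.
- exact: ccont_circle_z.
- by move=> x /normc_circle_z ->.
- exact: ccont_circle_zV.
- by move=> x /normc_circle_z /normc_eq1V ->.
Qed.

Lemma ccont_sqrt (k : R) : ccont (-1) 1 (fun x => (k * Num.sqrt (1 - x ^+ 2))%:C).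
Proof.
apply: ccont_real; apply: continuous_subspaceT => x.
by apply: cvgM; [exact: cvg_cst | exact: continuous_sqrt_sub_sqr].
Qed.

Lemma ccont_kernel : ccont (-1) 1 aw_kernel.
Proof. by apply: ccontM; [exact: ccont_sqrt | exact: ccont_density]. Qed.

Let g (z : R[i]) : R[i] := (1 - z ^+ 2) * E z.

(** In elementary symmetric functions of a, b, c, d: [e4] is the fourth, and [e13] the first minus
    the third. *)
Let e4 := a * b * c * d.
Let e13 := a + b + c + d - (a * b * c + a * b * d + a * c * d + b * c * d).

Lemma shift_form_outer (z : R[i]) : normc z = 1 ->
  shift_form q g z = - (E z * E z^-1 * (1 - z ^- 2) / z *
    ((1 - a * z) * (1 - b * z) * (1 - c * z) * (1 - d * z))).
Proof.
move=> z1; have z0 : z != 0 by apply: contra_eq_neq z1 => ->; rewrite normc0 eq_sym oner_eq0.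
have zle : normc z <= 1 by rewrite z1.
have := outer_shift q01 a1 b1 c1 d1 zle; rewrite -/E => H.
have -> : E z * E z^-1 * (1 - z ^- 2) / z *
    ((1 - a * z) * (1 - b * z) * (1 - c * z) * (1 - d * z)) =
  E z * ((1 - a * z) * (1 - b * z) * (1 - c * z) * (1 - d * z)) *
  E z^-1 * (1 - z ^- 2) / z by ring.
rewrite H /shift_form /g exprVn; by field.
Qed.

(** With P(z) the product of the four factors 1 - a z, ..., 1 - d z, the difference z^(-2) P(z) -
    z^2 P(1/z) is odd under inversion. Its quotient by z - 1/z is of degree 1 in z + 1/z. *)
Lemma shift_form_sym (z : R[i]) : normc z = 1 ->
  shift_form q g z + shift_form q g z^-1 =
  (z - z^-1) ^+ 2 * (E z * E z^-1) * ((1 - e4) * (z + z^-1) - e13).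
Proof.
move=> z1; have z0 : z != 0 by apply: contra_eq_neq z1 => ->; rewrite normc0 eq_sym oner_eq0.
rewrite !shift_form_outer ?normc_eq1V// !exprVn !invrK /e4 /e13.
by field.
Qed.

Lemma ccont_shift_form (h : R[i] -> R[i]) : disc_approx h ->
  ccont 0 pi (fun t => shift_form q h (eit t) + shift_form q h (eit t)^-1).
Proof.
have q1' : normc (q%:C : R[i]) <= 1.
  by case/andP: q01 => q0 q1; rewrite normc_realE ger0_norm ltW.
move=> hh; have ce := ccont_eit (0 : R) pi; have ceV := ccont_eitV (0 : R) pi.
have half z z' : ccont 0 pi z -> ccont 0 pi z' -> (forall t, normc (z t) = 1) ->
    (forall t, normc (z' t) = 1) ->
    ccont 0 pi (fun t => h (q%:C * z t) * h (z' t) * (q%:C * z t - z' t)).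
  move=> cz cz' z1 z1'; have cqz : ccont 0 pi (fun t => q%:C * z t).
    by apply: ccontM => //; exact: ccont_cst.
  apply: ccontM; first apply: ccontM.
  - by apply: ccont_disc => // t _; apply: normcM_le => //; rewrite z1.
  - by apply: ccont_disc => // t _; rewrite z1'.
  - apply: ccont_ext (ccontD cqz (ccontM (ccont_cst _ _ (-1)) cz')) => t.
    by rewrite mulN1r.
apply: ccontD; first by apply: half => // t; rewrite ?normc_eq1V ?normc_eit.
have HV := half (fun t => (eit t)^-1) (@eit R) ceV ce
  (fun t => normc_eq1V (normc_eit t)) (@normc_eit R).
by apply: ccont_ext HV => t; rewrite /shift_form invrK.
Qed.

Let hg : disc_approx g.
Proof.
apply: disc_approx_ext (disc_approxM (disc_approx_poly (1 - 'X^2)) hE) => z _.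
by rewrite /g hornerD hornerN hornerXn hornerC.
Qed.

Lemma cint_shift_form :
  cint 0 pi (fun t => shift_form q g (eit t) + shift_form q g (eit t)^-1) = 0.
Proof.
have q1' : normc (q%:C : R[i]) <= 1.
  by case/andP: q01 => q0 q1; rewrite normc_realE ger0_norm ltW.
apply: cint_eq0_lim; [exact: pi_ge0 | exact: ccont_shift_form |].
move=> e e0.
have [B B0 gB] := disc_approx_bound hg.
(* Chosen so that (2 B + 1) d0 times 2 is at most e/2, where 2 bounds |qz - 1/z|; each of the two
   terms of the symmetrization contributes e/2. *)
pose d0 := Num.min 1 (e / (4 * (2 * B + 1))).
have k0 : 0 < 4 * (2 * B + 1) by lra.
have d0_gt0 : 0 < d0 by rewrite /d0 lt_min ltr01 divr_gt0.
have [P gP] := hg d0_gt0.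
exists (fun t => shift_form q (horner P) (eit t) + shift_form q (horner P) (eit t)^-1).
split; [exact: ccont_shift_form (disc_approx_poly P) | exact: cint_shift_form_poly |].
have half z : normc z = 1 ->
    normc (shift_form q g z - shift_form q (horner P) z) <= e / 2.
  move=> z1; have z1' := normc_eq1V z1; rewrite /shift_form -mulrBl.
  have qz : normc (q%:C * z) <= 1 by apply: normcM_le => //; rewrite z1.
  have zV : normc z^-1 <= 1 by rewrite z1'.
  rewrite normcM; apply: (@le_trans _ _ ((B * d0 + d0 * B + d0 * 1) * 2)).
    apply: ler_pM; rewrite ?normc_ge0//.
      by apply: normc_mul_diff; rewrite ?gB ?gP// /d0 ge_min lexx.
    by apply: le_trans (normcB _ _) _; rewrite z1'; move: qz; lra.
  have : d0 <= e / (4 * (2 * B + 1)) by rewrite /d0 ge_min lexx orbT.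
  by rewrite ler_pdivlMr//; lra.
move=> t _; have et := normc_eit t.
have -> : forall u v w r : R[i], u + v - (w + r) = (u - w) + (v - r) by move=> *; ring.
by rewrite (splitr e); apply: le_trans (normcD _ _) _; rewrite lerD ?half ?normc_eq1V.
Qed.

(** Under x = cos t the integrand is the symmetrized [shift_form] up to the constant -1/(2 pi). *)
Lemma cint_aw_linear :
  cint (-1) 1 (fun x => ((1 - e4) * (2 * x)%:C - e13) * aw_kernel x) = 0.
Proof.
have clin : ccont (-1) 1 (fun x : R => (1 - e4) * (2 * x)%:C - e13).
  apply: (@ccont_ext _ _ _ (fun x => (1 - e4) * 2%:R * x%:C + (- e13))) => [x|].
    by rewrite rmorphM rmorph_nat mulrA.
  apply: ccontD; last exact: ccont_cst.
  by apply: ccontM; [exact: ccont_cst | exact: ccont_id].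
rewrite cint_cos_subst; last by apply: ccontM => //; exact: ccont_kernel.
pose H t := shift_form q g (eit t) + shift_form q g (eit t)^-1.
transitivity (cint 0 pi (fun t => (- (2 * pi)^-1)%:C * H t)); last first.
  by rewrite cintZ ?cint_shift_form ?mulr0//; exact: ccont_shift_form.
apply: eq_cint => t t0; rewrite /H shift_form_sym ?normc_eit// /aw_kernel /aw_density.
have ct := cos_itv t; rewrite -circle_zD// circle_z_cos//.
have -> : Num.sqrt (1 - cos t ^+ 2) = sin t.
  by rewrite -sin2cos2 sqrtr_sqr ger0_norm// sin_ge0_pi.
have -> : (eit t - (eit t)^-1) ^+ 2 = (- 4 * sin t ^+ 2)%:C.
  rewrite eitV expr2; apply/eqP; rewrite eq_complex /=.
  by apply/andP; split; apply/eqP; ring.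
set z := eit t; set l := (1 - e4) * _ - _; set w := E z * _.
have -> : l * ((2 / pi * sin t)%:C * w) * (sin t)%:C =
    ((2 / pi * sin t)%:C * (sin t)%:C) * (l * w) by ring.
have -> : (- (2 * pi)^-1)%:C * ((- 4 * sin t ^+ 2)%:C * w * l) =
    ((- (2 * pi)^-1)%:C * (- 4 * sin t ^+ 2)%:C) * (l * w) by ring.
rewrite -!rmorphM; congr (_%:C * _).
have pi0 : (pi : R) != 0 by rewrite gt_eqF// pi_gt0.
by move: (pi : R) pi0 => p p0; field; rewrite ?p0.
Qed.

Lemma outer_lower : exists2 l : R, 0 < l & forall z, normc z <= 1 -> l <= normc (E z).
Proof.
have [q0 q1] := andP q01.
pose D u := qpoch_rate q (normc u) + 1.
have D0 u : 0 < D u by rewrite ltr_wpDl// qpoch_rate_ge0// normc_ge0.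
exists (qpoch_lower q q / (D a * D b * D c * D d)).
  by rewrite divr_gt0 ?qpoch_lower_gt0// !mulr_gt0.
move=> z z1; rewrite /E /outer normcM normcV.
have Dz u : normc (qpoch_inf q (u * z)) <= D u.
  exact: (qpoch_inf_le q01 (normcM_le (lexx _) z1)).
apply: ler_pM.
- exact: ltW (qpoch_lower_gt0 _ _).
- by rewrite invr_ge0 !mulr_ge0// ltW.
- apply: qpoch_inf_ge => //; apply: normcM_le.
    by rewrite normc_realE ger0_norm// ltW.
  by rewrite normcX exprn_ile1// normc_ge0.
rewrite lef_pV2 ?posrE ?mulr_gt0//.
  by rewrite !normcM !ler_pM ?mulr_ge0 ?normc_ge0.
rewrite lt_def normc_ge0 andbT; apply/eqP => /eq0_normc/eqP.
have nz u : normc u < 1 -> qpoch_inf q (u * z) != 0.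
  by move=> u1; apply: qpoch_inf_neq0 => //; apply: le_lt_trans (normcM_le (lexx _) z1) u1.
by apply/negP; rewrite !mulf_neq0 ?nz.
Qed.

Lemma density_bound : exists2 B : R, 0 < B &
  forall x, -1 <= x <= 1 -> normc (aw_density x) <= B.
Proof.
have [B B0 EB] := disc_approx_bound hE; exists (B * B); first exact: mulr_gt0.
move=> x /normc_circle_z x1.
by rewrite /aw_density normcM ler_pM ?normc_ge0// EB ?normc_eq1V ?x1.
Qed.

Lemma density_approx (e : R) : 0 < e -> exists Q : {poly R[i]},
  forall x, -1 <= x <= 1 -> normc (aw_density x - Q.[x%:C]) <= e.
Proof.
move=> e0; have [B B0 EB] := disc_approx_bound hE.
pose d0 := Num.min 1 (e / (2 * B + 1)).
have k0 : 0 < 2 * B + 1 by lra.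
have d0_gt0 : 0 < d0 by rewrite /d0 lt_min ltr01 divr_gt0.
have [P EP] := hE d0_gt0.
have two0 : (2 : R[i]) != 0 by rewrite pnatr_eq0.
have [Q hQ] := sym_laurent_prod two0 P.
exists Q => x x1; have z1 := normc_circle_z x1; have z1' := normc_eq1V z1.
have -> : (x%:C : R[i]) = (circle_z x + (circle_z x)^-1) / 2.
  by rewrite circle_zD// rmorphM rmorph_nat mulrC mulKf// pnatr_eq0.
rewrite -hQ ?circle_z_neq0//.
apply: (@le_trans _ _ (B * d0 + d0 * B + d0 * 1)).
  by apply: normc_mul_diff; rewrite ?EB ?EP ?z1 ?z1'// /d0 ge_min lexx.
have : d0 <= e / (2 * B + 1) by rewrite /d0 ge_min lexx orbT.
by rewrite ler_pdivlMr//; lra.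
Qed.

Lemma normc_conjc (z : R[i]) : normc z^* = normc z.
Proof. by case: z => x y /=; rewrite sqrrN. Qed.

Lemma Rintegral_parabola (k : R) :
  \int[lebesgue_measure]_(x in `[-1, 1]) (k * (1 - x ^+ 2)) = k * (4 / 3) :> R.
Proof.
pose G x : R := k * (x - x ^+ 3 / 3).
have D (x : R) : is_derive x 1 (fun x : R => k * (x - x ^+ 3 / 3)) (k * (1 - x ^+ 2)).
  apply: is_derive_eq; rewrite /GRing.scale /=; by field.
have cG : continuous G.
  by move=> t; apply: differentiable_continuous; apply/derivable1_diffP; case: (D t).
rewrite /Rintegral (@continuous_FTC2 _ (fun x => k * (1 - x ^+ 2)) G).
- by rewrite -EFinB /= /G; field.
- by lra.
- apply: continuous_subspaceT => x; apply: cvgM; first exact: cvg_cst.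
  by apply: cvgB; [exact: cvg_cst | exact: exprn_continuous].
- split=> //.
  + by apply: cvg_at_right_filter; exact: cG.
  + by apply: cvg_at_left_filter; exact: cG.
- by move=> t _; rewrite derive1E; case: (D t).
Qed.

(* The density is a uniform limit of polynomials, and so is its conjugate: if all
   the moments vanished, so would the integral of its squared modulus. *)
Lemma kernel_moment_neq0 :
  exists P : {poly R[i]}, cint (-1) 1 (fun x => P.[x%:C] * aw_kernel x) != 0.
Proof.
apply: contrapT => H.
have {}H P : cint (-1) 1 (fun x => P.[x%:C] * aw_kernel x) = 0.
  by apply/eqP; apply: contrapT => h; apply: H; exists P; apply/negP.
have cK := ccont_kernel; have [cdr cdi] := ccont_density.
pose F x : R[i] := (aw_density x)^* * aw_kernel x.
have cconj : ccont (-1) 1 (fun x => (aw_density x)^*).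
  split.
    by rewrite (_ : (fun x => _) = (fun x => complex.Re (aw_density x)))//;
      apply/funext => x; case: (aw_density x).
  rewrite (_ : (fun x => _) = (fun x => - complex.Im (aw_density x))).
    by move=> x; apply: cvgN; exact: cdi.
  by apply/funext => x; case: (aw_density x).
have [B B0 dB] := density_bound.
have pi0 : 0 < (pi : R) := pi_gt0 R.
have KB x : -1 <= x <= 1 -> normc (aw_kernel x) <= 2 / pi * B.
  move=> x1; rewrite /aw_kernel normcM ler_pM ?normc_ge0 ?dB// normc_realE.
  rewrite ger0_norm ?mulr_ge0 ?sqrtr_ge0 ?invr_ge0 ?(ltW pi0)// ler_piMr ?divr_ge0 ?(ltW pi0)//.
  rewrite -[leRHS]sqrtr1 ler_wsqrtr// lerBlDr lerDl sqr_ge0//.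
have F0 : cint (-1) 1 F = 0.
  apply: cint_eq0_lim; [by lra | exact: ccontM |].
  move=> e e0; have k0 : 0 < 2 / pi * B by rewrite mulr_gt0 ?divr_gt0.
  have [Q hQ] := density_approx (divr_gt0 e0 k0).
  exists (fun x => (map_poly conjc Q).[x%:C] * aw_kernel x); split=> [||x x1].
  - by apply: ccontM => //; apply: ccont_horner; exact: ccont_id.
  - exact: H.
  rewrite /F -mulrBl normcM -[leRHS](divfK (negbT (gt_eqF k0))) ler_pM ?normc_ge0 ?KB//.
  rewrite -[X in (map_poly _ _).[X]](conjc_real x) horner_map -rmorphB normc_conjc.
  exact: hQ.
have [l l0 El] := outer_lower.
(* Since |density| >= l^2 and sqrt(1 - x^2) >= 1 - x^2, the integrand is at least k (1 - x^2), whose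
   integral is elementary and positive. *)
pose k := 2 / pi * (l * l) ^+ 2.
have k0 : 0 < k by rewrite mulr_gt0 ?divr_gt0 ?exprn_gt0 ?mulr_gt0.
have [R0 _] : \int[lebesgue_measure]_(x in `[-1, 1]) complex.Re (F x) = 0 /\
    \int[lebesgue_measure]_(x in `[-1, 1]) complex.Im (F x) = 0 by case: F0.
suff : k * (4 / 3) <= 0 by rewrite leNgt mulr_gt0 ?divr_gt0.
rewrite -(Rintegral_parabola k) -R0; apply: le_Rintegral => //.
- apply: continuous_compact_integrable; first exact: segment_compact.
  apply: continuous_subspaceT => x; apply: cvgM; first exact: cvg_cst.
  by apply: cvgB; [exact: cvg_cst | exact: exprn_continuous].
- apply: continuous_compact_integrable; first exact: segment_compact.
  by case: (ccontM cconj cK).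
move=> x xin; have x1 : -1 <= x <= 1 by move: xin; rewrite /= in_itv.
have -> : complex.Re (F x) = 2 / pi * Num.sqrt (1 - x ^+ 2) * normc (aw_density x) ^+ 2.
  rewrite /F /aw_kernel; case: (aw_density x) => u v /=.
  by rewrite sqr_sqrtr ?addr_ge0 ?sqr_ge0//; ring.
have x20 : 0 <= 1 - x ^+ 2 by case/andP: x1 => ? ?; nra.
rewrite /k mulrAC; apply: ler_pM.
- by rewrite mulr_ge0 ?divr_ge0 ?(ltW pi0).
- by rewrite sqr_ge0.
- rewrite ler_wpM2l ?divr_ge0 ?(ltW pi0)// -{1}(sqr_sqrtr x20) expr2 ler_piMl ?sqrtr_ge0//.
  by rewrite -[leRHS]sqrtr1 ler_wsqrtr// lerBlDr lerDl sqr_ge0.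
have z1 := normc_circle_z x1; have z1' := normc_eq1V z1.
rewrite lerXn2r ?nnegrE ?mulr_ge0 ?normc_ge0 ?(ltW l0)// /aw_density normcM.
by apply: ler_pM; rewrite ?(ltW l0)// El ?z1 ?z1'.
Qed.

End AskeyWilsonWeight.

(** * The total mass under a -> a q and the vanishing of the integrals of p_n for n > 0 *)

Section AskeyWilsonMoments.
Variables (R : realType) (q : R).
Hypothesis q01 : 0 < q < 1.

Definition aw_mass (a b c d : R[i]) : R[i] := cint (-1) 1 (aw_kernel q a b c d).

Lemma qfact_unit_neq0 (u : R[i]) n : normc u < 1 -> qfact q%:C u n != 0.
Proof.
move=> u1; apply/eqP => h; have := qpoch_ge q01 n (lexx _) u1.
by rewrite /qpoch -/(qfact _ _ _) h normc0 leNgt qpoch_lower_gt0.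
Qed.

Let normc_q : normc (q%:C : R[i]) < 1.
Proof. by case/andP: q01 => q0 q1; rewrite normc_realE ger0_norm// ltW. Qed.

Lemma normcM_lt1 (u v : R[i]) : normc u < 1 -> normc v <= 1 -> normc (u * v) < 1.
Proof.
by move=> u1 v1; apply: le_lt_trans u1; rewrite normcM ler_piMr ?normc_ge0.
Qed.

Let normc_qX n : normc (q%:C ^+ n : R[i]) <= 1.
Proof. by rewrite normcX exprn_ile1 ?normc_ge0// ltW. Qed.

Section ShiftedMass.
Variables (b c d : R[i]).
Hypotheses (b1 : normc b < 1) (c1 : normc c < 1) (d1 : normc d < 1).

Lemma aw_kernel_shift a x : normc a < 1 -> -1 <= x <= 1 ->
  aw_kernel q (a * q%:C) b c d x =
  (1 - a * (2 * x)%:C + a ^+ 2) * aw_kernel q a b c d x.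
Proof.
move=> a1 x1; have z1 := normc_circle_z x1; have z1' := normc_eq1V z1.
have z0 := circle_z_neq0 x1.
have nz (u w : R[i]) : normc u < 1 -> normc w = 1 -> qpoch_inf q (u * w) != 0.
  by move=> u1 w1; apply: qpoch_inf_neq0 => //; apply: normcM_lt1; rewrite ?w1.
have sh (w : R[i]) : normc w = 1 -> qpoch_inf q (a * w) = (1 - a * w) * qpoch_inf q (a * q%:C * w)
    /\ 1 - a * w != 0.
  move=> w1; have E : qpoch_inf q (a * w) = (1 - a * w) * qpoch_inf q (a * q%:C * w).
    by rewrite qpoch_infS//; congr (_ * qpoch_inf q _); ring.
  by split=> //; have := nz a w a1 w1; rewrite E mulf_eq0 negb_or => /andP[].
have [s1 n1] := sh _ z1; have [s2 n2] := sh _ z1'.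
have aq1 : normc (a * q%:C) < 1 by apply: normcM_lt1 => //; exact: ltW.
rewrite /aw_kernel [RHS]mulrCA; congr (_ * _); rewrite /aw_density /outer s1 s2 -circle_zD//.
set z := circle_z x in z1 z1' z0 n1 n2 *.
have h1 := nz _ _ aq1 z1; have h2 := nz _ _ aq1 z1'.
have b2 := nz _ _ b1 z1; have b3 := nz _ _ b1 z1'.
have c2 := nz _ _ c1 z1; have c3 := nz _ _ c1 z1'.
have d2 := nz _ _ d1 z1; have d3 := nz _ _ d1 z1'.
have -> : 1 - a * (z + z^-1) + a ^+ 2 = (1 - a * z) * (1 - a * z^-1) by field.
move: (qpoch_inf q (q%:C * _)) (qpoch_inf q (q%:C * _)) => E1 E2.
move: (qpoch_inf _ _) h1 (qpoch_inf _ _) b2 (qpoch_inf _ _) c2 (qpoch_inf _ _) d2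
  (qpoch_inf _ _) h2 (qpoch_inf _ _) b3 (qpoch_inf _ _) c3 (qpoch_inf _ _) d3.
move: (1 - a * z) (1 - a * z^-1) n1 n2 => y1 y2 y10 y20.
move=> *.
by field; do ?[apply/andP; split].
Qed.

Lemma ccont_2x : ccont (-1) 1 (fun x : R => ((2 * x)%:C : R[i])).
Proof.
apply: ccont_ext (ccontM (ccont_cst _ _ 2%:R) (ccont_id _ _)) => x.
by rewrite rmorphM rmorph_nat.
Qed.

(** The shift a -> a q multiplies the kernel by 1 - 2 a x + a^2. Times 1 - abcd, this is (1 - ab)(1
    - ac)(1 - ad) minus a times the linear form of [cint_aw_linear]. *)
Lemma aw_mass_shift a : normc a < 1 ->
  (1 - a * b * c * d) * aw_mass (a * q%:C) b c d =
  (1 - a * b) * (1 - a * c) * (1 - a * d) * aw_mass a b c d.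
Proof.
move=> a1; have cK := ccont_kernel q01 a1 b1 c1 d1.
have clin : ccont (-1) 1 (fun x : R => (1 - a * b * c * d) * (2 * x)%:C -
    (a + b + c + d - (a * b * c + a * b * d + a * c * d + b * c * d))).
  apply: ccont_ext (ccontD (ccontM (ccont_cst _ _ (1 - a * b * c * d)) ccont_2x)
    (ccont_cst _ _ (- (a + b + c + d - (a * b * c + a * b * d + a * c * d + b * c * d))))) => x.
  by [].
have L0 := cint_aw_linear q01 a1 b1 c1 d1.
have aq1 : normc (a * q%:C) < 1 by apply: normcM_lt1 => //; exact: ltW.
have cKq := ccont_kernel q01 aq1 b1 c1 d1.
apply/eqP; rewrite -subr_eq0 /aw_mass -!cintZ//.
rewrite -cintB; try exact: ccontM (ccont_cst _ _ _) _.
rewrite -[X in _ == X](mulr0 (- a)) -L0 -cintZ; last exact: ccontM.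
by apply/eqP; apply: eq_cint => x x1; rewrite aw_kernel_shift//; ring.
Qed.

Lemma cint_aw_base a s : normc a < 1 ->
  cint (-1) 1 (fun x => aw_base q%:C a (2 * x)%:C s * aw_kernel q a b c d x) =
  aw_mass (a * q%:C ^+ s) b c d.
Proof.
move=> a1; apply: eq_cint => x x1; elim: s => [|s IH].
  by rewrite /aw_base big_ord0 mul1r expr0 mulr1.
have as1 : normc (a * q%:C ^+ s) < 1 by apply: normcM_lt1.
rewrite aw_baseS mulrAC IH (exprSr q%:C) (mulrA a) aw_kernel_shift// exprMn.
by rewrite [LHS]mulrC.
Qed.

Lemma aw_mass_iter a s : normc a < 1 ->
  qfact q%:C (a * b * c * d) s * aw_mass (a * q%:C ^+ s) b c d =
  qfact q%:C (a * b) s * qfact q%:C (a * c) s * qfact q%:C (a * d) s * aw_mass a b c d.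
Proof.
move=> a1; elim: s => [|s IH]; first by rewrite !qfact0 !mul1r expr0 mulr1.
have as1 : normc (a * q%:C ^+ s) < 1 by apply: normcM_lt1.
have := aw_mass_shift as1.
rewrite (_ : a * q%:C ^+ s * q%:C = a * q%:C ^+ s.+1) ?qfactS; last by rewrite exprSr mulrA.
have e1 u : a * q%:C ^+ s * u = a * u * q%:C ^+ s by ring.
rewrite !e1 (_ : a * b * q%:C ^+ s * c * d = a * b * c * d * q%:C ^+ s); last by ring.
move=> E; rewrite -[LHS]mulrA E.
transitivity ((1 - a * b * q%:C ^+ s) * (1 - a * c * q%:C ^+ s) *
    (1 - a * d * q%:C ^+ s) *
    (qfact q%:C (a * b * c * d) s * aw_mass (a * q%:C ^+ s) b c d)); first by ring.
by rewrite IH; ring.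
Qed.

(** Each [aw_base] integrates to a shifted mass, a known multiple of the total mass. The sum that
    remains is of q-Vandermonde type, and it vanishes for n > 0. *)
Lemma aw_sum_mass a n : normc a < 1 -> (0 < n)%N -> b != 0 -> c != 0 -> d != 0 -> a != 0 ->
  cint (-1) 1 (fun x => aw_sum q%:C a b c d (2 * x)%:C n (q%:C ^+ n) *
    aw_kernel q a b c d x) = 0.
Proof.
move=> a1 n0 b0 c0 d0 a0; have q0 : (q%:C : R[i]) != 0.
  by rewrite -(rmorph0 (real_complex R)) (inj_eq (@complexI R)) gt_eqF; case/andP: q01.
pose X : R[i] := q%:C ^+ n; have X0 : X != 0 by rewrite expf_neq0.
have cK := ccont_kernel q01 a1 b1 c1 d1.
have cb s : ccont (-1) 1 (fun x => aw_base q%:C a (2 * x)%:C s * aw_kernel q a b c d x).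
  have as1 : normc (a * q%:C ^+ s) < 1 by apply: normcM_lt1.
  apply: eq_ccont (ccont_kernel q01 as1 b1 c1 d1) => x x1.
  elim: s {as1} => [|s IH]; first by rewrite expr0 mulr1 /aw_base big_ord0 mul1r.
  have as1 : normc (a * q%:C ^+ s) < 1 by apply: normcM_lt1.
  by rewrite (exprSr q%:C) (mulrA a) aw_kernel_shift// IH aw_baseS exprMn; ring.
pose w s : R[i] := q%:C ^+ s / (qfact q%:C (a * b) s * qfact q%:C (a * c) s *
  qfact q%:C (a * d) s * qfact q%:C q%:C s) * aw_dual q%:C a b c d s X.
have ab1 : normc (a * b) < 1 by apply: normcM_lt1 => //; exact: ltW.
have ac1 : normc (a * c) < 1 by apply: normcM_lt1 => //; exact: ltW.
have ad1 : normc (a * d) < 1 by apply: normcM_lt1 => //; exact: ltW.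
have e1 : normc (a * b * c * d) < 1.
  by do 2 (apply: normcM_lt1 => //; last exact: ltW).
transitivity (cint (-1) 1 (fun x => \sum_(s < n.+1)
    w s * (aw_base q%:C a (2 * x)%:C s * aw_kernel q a b c d x))).
  apply: eq_cint => x _; rewrite /aw_sum mulr_suml; apply: eq_bigr => s _.
  by rewrite /aw_coef /w -/X; ring.
rewrite cint_sum => [|s]; last by apply: ccontM; [exact: ccont_cst | exact: cb].
under eq_bigr => s _ do rewrite cintZ// cint_aw_base//.
have XV : X^-1 != 0 by rewrite invr_eq0.
have vd := @qvandermonde_partial _ q%:C q0 (a * b * c * d) X^-1 n
  (fun s => qfact_unit_neq0 s e1) (fun s => qfact_unit_neq0 s normc_q) XV.
(* The closed form contains (q^(1-n); q)_n, whose last factor is 0 when n > 0. *)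
have z : qfact q%:C (q%:C / X) n = 0.
  apply: (@qfact_eq0 _ _ _ _ n.-1); first by rewrite ltn_predL.
  by rewrite mulrAC -exprS prednK// divff.
rewrite z !mul0r in vd.
rewrite -[RHS](mul0r (aw_mass a b c d)) -[X in _ = X * _]vd mulr_suml; apply: eq_bigr => s _.
have h1 := qfact_unit_neq0 s ab1; have h2 := qfact_unit_neq0 s ac1.
have h3 := qfact_unit_neq0 s ad1; have h4 := qfact_unit_neq0 s e1.
have h5 := qfact_unit_neq0 s normc_q.
have E : aw_mass (a * q%:C ^+ s) b c d = qfact q%:C (a * b) s * qfact q%:C (a * c) s *
    qfact q%:C (a * d) s * aw_mass a b c d / qfact q%:C (a * b * c * d) s.
  by apply: (mulfI h4); rewrite aw_mass_iter//; field.
rewrite E /w /aw_dual (_ : a * b * c * d / (q%:C * X^-1) = a * b * c * d * X / q%:C).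
  by field; rewrite h1 h2 h3 h4 h5.
by field; rewrite q0 X0.
Qed.

End ShiftedMass.
End AskeyWilsonMoments.

(** * The resonant parameters *)

Section Resonance.
Variables (R : realType) (q eps : R) (alpha l k : nat) (a b c d : R[i]).
Hypotheses (q01 : 0 < q < 1) (heps : eps = 1 \/ eps = -1)
  (hl : (0 < l)%N) (hk : (0 < k <= alpha)%N)
  (hd : d = (eps * q `^ (l%:R / 2))%:C)
  (ha : a = (eps * q `^ (alpha%:R + l%:R / 2))%:C)
  (hb0 : b != 0) (hc0 : c != 0) (hb : normc b < 1) (hc : normc c < 1).

Let Q : R[i] := q%:C.
Let e : R[i] := a * b * c * d.
Let s : R := q `^ (l%:R / 2).

Let q0 : 0 < q. Proof. by case/andP: q01. Qed.
Let q1 : q < 1. Proof. by case/andP: q01. Qed.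
Let s0 : 0 < s. Proof. by apply: powR_gt0. Qed.
Let s_sqr : s ^+ 2 = q ^+ l.
Proof.
rewrite -(powR_mulrn _ (ltW s0)) /s -powRrM divfK ?pnatr_eq0//.
by rewrite powR_mulrn// ltW.
Qed.
Let s1 : s < 1.
Proof.
rewrite -(@ltr_pXn2r _ 2)// ?nnegrE ?ler01 ?(ltW s0)// s_sqr expr1n.
by rewrite exprn_ilt1 ?(ltW q0)// -lt0n.
Qed.
Let eps2 : eps * eps = 1.
Proof. by case: heps => ->; rewrite ?mulr1// mulrNN mulr1. Qed.
Let eps0 : eps != 0.
Proof. by apply/eqP => h; move/eqP: eps2; rewrite h mul0r eq_sym oner_eq0. Qed.
Let eps_norm : `|eps| = 1.
Proof. by case: heps => ->; rewrite ?normrN normr1. Qed.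
Let epsV : eps^-1 = eps.
Proof. by apply: (mulfI eps0); rewrite divff. Qed.
Let d_real : d = (eps * s)%:C. Proof. exact: hd. Qed.
Let Q0 : Q != 0.
Proof. by rewrite -(rmorph0 (real_complex R)) (inj_eq (@complexI R)) gt_eqF. Qed.
Let normQX n : normc (Q ^+ n) = q ^+ n.
Proof. by rewrite normcX normc_realE ger0_norm// ltW. Qed.

Lemma resonance_a : a = d * Q ^+ alpha.
Proof.
rewrite ha hd powRD; last by rewrite (gt_eqF q0) implybT.
by rewrite powR_mulrn ?(ltW q0)// -rmorphXn -rmorphM; congr (_%:C); ring.
Qed.

Lemma resonance_dd : d ^+ 2 = Q ^+ l.
Proof.
rewrite d_real -!rmorphXn -s_sqr; congr (_%:C).
by rewrite exprMn expr2 eps2 mul1r.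
Qed.

Lemma resonance_ad : a * d = Q ^+ (alpha + l).
Proof. by rewrite resonance_a mulrAC -expr2 resonance_dd -exprD addnC. Qed.

Lemma normc_d : normc d < 1.
Proof. by rewrite d_real normc_realE normrM eps_norm mul1r ger0_norm ?s1// ltW. Qed.

Lemma resonance_d0 : d != 0.
Proof.
rewrite d_real -(rmorph0 (real_complex R)) (inj_eq (@complexI R)).
by rewrite mulf_neq0// gt_eqF.
Qed.

Lemma resonance_a0 : a != 0.
Proof. by rewrite resonance_a mulf_neq0 ?resonance_d0 ?expf_neq0. Qed.

Lemma normc_a : normc a < q ^+ alpha.
Proof.
rewrite resonance_a normcM normQX -[ltRHS]mul1r ltr_pM2r ?exprn_gt0//.
exact: normc_d.
Qed.

Lemma normc_a1 : normc a < 1.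
Proof. by rewrite (lt_le_trans normc_a)// exprn_ile1// ltW. Qed.

Lemma normc_au (u : R[i]) : normc u < 1 -> normc (a * u) < q ^+ alpha.
Proof.
move=> u1; apply: le_lt_trans normc_a.
by rewrite normcM ler_piMr ?normc_ge0// ltW.
Qed.

Lemma normc_e : normc e < q ^+ (alpha + l).
Proof.
have -> : e = Q ^+ (alpha + l) * (b * c) by rewrite -resonance_ad /e; ring.
rewrite normcM normQX -[ltRHS]mulr1 ltr_pM2l ?exprn_gt0// normcM.
by rewrite -[ltRHS]mulr1 ltr_pM ?normc_ge0.
Qed.

Definition node (m : nat) : R := mass_point q eps l m.

Lemma node2E m : (2 * node m)%:C = d * Q ^+ m + (d * Q ^+ m)^-1.
Proof.
have sm0 : s * q ^+ m != 0 by rewrite mulf_neq0 ?expf_neq0// gt_eqF.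
have -> : d * Q ^+ m = (eps * (s * q ^+ m))%:C.
  by rewrite d_real -rmorphXn -rmorphM mulrA.
rewrite -fmorphV -rmorphD; congr (_%:C); rewrite /node /mass_point.
have qimp (x y : R) : (x + y == 0) ==> (q != 0) by rewrite (gt_eqF q0) implybT.
rewrite [X in X + _]powRD// [- _ - _]addrC -opprD powRN powRD// powR_mulrn ?(ltW q0)// -/s.
rewrite [(eps * _)^-1]invfM epsV.
have two0 : (2 : R) != 0 by rewrite pnatr_eq0.
have h : eps / 2 * (q ^+ m * s + (s * q ^+ m)^-1) * 2 = eps * (q ^+ m * s + (s * q ^+ m)^-1).
  by rewrite mulrAC divfK.
by rewrite mulrC h mulrDr [s * q ^+ m]mulrC.
Qed.

Let nodeE m : 2 * node m = eps * (s * q ^+ m + (s * q ^+ m)^-1).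
Proof.
apply: (@complexI R); rewrite [LHS]node2E.
have -> : d * Q ^+ m = (eps * (s * q ^+ m))%:C.
  by rewrite d_real -rmorphXn -rmorphM mulrA.
by rewrite -fmorphV -rmorphD; congr (_%:C); rewrite [(eps * _)^-1]invfM epsV mulrDr.
Qed.

Let sqm m : 0 < s * q ^+ m < 1.
Proof.
rewrite mulr_gt0 ?exprn_gt0//= (le_lt_trans _ s1)// ler_piMr ?(ltW s0)//.
by rewrite exprn_ile1// ltW.
Qed.

(** The nodes lie outside [-1, 1], so division by the product of the x - x_j keeps the kernel
    continuous there. *)
Lemma node_gt1 m : 1 < `|node m|.
Proof.
have /andP[y0 y1] := sqm m.
rewrite -(ltr_pM2l (ltr0Sn R 1)) mulr1 -[X in _ < X * _](@ger0_norm R 2)// -normrM.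
rewrite nodeE normrM eps_norm mul1r ger0_norm ?addr_ge0 ?invr_ge0 ?(ltW y0)//.
move: (s * q ^+ m) y0 y1 => y y0 y1; rewrite -subr_gt0.
have -> : y + y^-1 - 2 = (1 - y) ^+ 2 / y by field; rewrite gt_eqF.
by rewrite divr_gt0// exprn_gt0// subr_gt0.
Qed.

Lemma node_inj : injective node.
Proof.
move=> m m' E; have := congr1 (fun t => 2 * t) E; rewrite /= !nodeE => /(mulfI eps0).
have /andP[y0 y1] := sqm m; have /andP[z0 z1] := sqm m'.
move=> h; have : s * q ^+ m = s * q ^+ m'.
  move: h; move: (s * q ^+ m) (s * q ^+ m') y0 y1 z0 z1 => y z y0 y1 z0 z1 h.
  have : (y - z) * (1 - y * z) = 0.
    have -> : (y - z) * (1 - y * z) = y * z * (z + z^-1 - (y + y^-1)).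
      by field; rewrite !gt_eqF.
    by rewrite h subrr mulr0.
  move/eqP; rewrite mulf_eq0 !subr_eq0 => /orP[/eqP//|/eqP yz].
  by have := mulr_ilt1 (ltW y0) (ltW z0) y1 z1; rewrite -yz ltxx.
move/(mulfI (negbT (gt_eqF s0))) => /eqP.
wlog mm' : m m' {E y0 y1 z0 z1 h} / (m <= m')%N => [W|].
  by case: (leqP m m') => [|/ltnW] mm' H; [exact: W | rewrite (W m' m)// eq_sym].
have qm0 : q ^+ m != 0 by rewrite expf_neq0// gt_eqF.
rewrite -(subnKC mm') exprD -[X in X == _]mulr1 (inj_eq (mulfI qm0)).
case: (m' - m)%N => [|n]; first by rewrite addn0.
move=> /eqP h; have : q ^+ n.+1 < 1 by rewrite exprn_ilt1 ?(ltW q0).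
by rewrite -h ltxx.
Qed.

Let X (n : int) : R[i] := Q ^ n.

Let XS n : Q * X n = X (n + 1).
Proof. by rewrite /X expfzDr// expr1z mulrC. Qed.

Let XB n : X n / Q = X (n - 1).
Proof. by rewrite /X expfzDr// exprN1. Qed.

Let X_neq0 n : X n != 0. Proof. exact: expfz_neq0. Qed.

Let normcXz n : normc (X n) = q ^ n.
Proof.
rewrite /X; case: n => n; first by rewrite -!exprnP normQX.
by rewrite NegzE -!exprnN normcV normQX.
Qed.

Let lt1_sub (u : R[i]) : normc u < 1 -> 1 - u != 0.
Proof.
move=> u1; apply: contraTneq u1 => /eqP; rewrite subr_eq0 => /eqP <-.
by rewrite normc1 ltxx.
Qed.

Let qz_le (m n : int) : m <= n -> q ^ n <= q ^ m.
Proof.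
move=> mn; have [p ->] : exists p : nat, n = m + p%:Z by exists `|n - m|%N; clear -mn; lia.
rewrite expfzDr ?gt_eqF// ler_piMr ?exprz_ge0 ?(ltW q0)// -exprnP.
by rewrite exprn_ile1// ltW.
Qed.

Let small_mul (u : R[i]) (N : nat) (n : int) : normc u < q ^+ N -> - N%:Z <= n ->
  normc (u * X n) < 1.
Proof.
move=> uN nN; rewrite normcM normcXz.
have h : q ^ n <= q ^ (- N%:Z) by exact: qz_le.
apply: (@lt_le_trans _ _ (q ^+ N * q ^ n)); first by rewrite ltr_pM2r// exprz_gt0.
rewrite (le_trans (ler_wpM2l (exprn_ge0 _ (ltW q0)) h))// -exprnN mulfV//.
by rewrite expf_neq0 ?gt_eqF.
Qed.

Definition distinct_eigenvalues : Prop :=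
  forall i j : nat, (0 < i)%N -> (i < j)%N -> (j <= k)%N ->
    aw_eigenvalue q a b c d (- i%:Z) != aw_eigenvalue q a b c d (- j%:Z).

(** The eigenvalue is symmetric in q^(-gamma) and abcd q^(gamma-1). If abcd = q^N, the indices -k
    and -(N-1-k) share an eigenvalue, and |abcd| < q^(alpha+l) forces N large enough for 0 < N-1-k <
    k. *)
Lemma e_power_neq1 (N : nat) : distinct_eigenvalues -> (N <= k.*2)%N ->
  e != Q ^+ N.
Proof.
move=> hdist N2; apply/eqP => eN.
have aN : (alpha + l < N)%N.
  rewrite ltnNge; apply/negP => Nal; have := normc_e; rewrite eN normQX ltNge.
  by rewrite ler_wiXn2l// ltW.
have /andP[k0 ka] := hk.
have := hdist (N.-1 - k)%N k; rewrite /aw_eigenvalue -/e -/Q eN !opprK.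
have i0 : (0 < N.-1 - k)%N by clear -aN k0 ka hl; lia.
have ik : (N.-1 - k < k)%N by clear -k0 N2; lia.
move=> /(_ i0 ik (leqnn _)) /eqP; apply.
have E1 : Q ^+ N * Q ^ (- (N.-1 - k)%N%:Z - 1) = Q ^+ k.
  by rewrite !exprnP -expfzDr//; congr (_ ^ _); clear -aN k0 ka hl N2; lia.
have E2 : Q ^+ N * Q ^ (- k%:Z - 1) = Q ^+ (N.-1 - k).
  by rewrite !exprnP -expfzDr//; congr (_ ^ _); clear -aN k0 ka hl N2; lia.
have E3 : Q ^ (N.-1 - k)%N%:Z * Q ^ (- (N.-1 - k)%N%:Z - 1) = Q ^ (- 1).
  by rewrite -expfzDr//; congr (_ ^ _); clear -aN k0 ka hl N2; lia.
have E4 : Q ^ k%:Z * Q ^ (- k%:Z - 1) = Q ^ (- 1).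
  by rewrite -expfzDr//; congr (_ ^ _); clear -aN k0 ka hl N2; lia.
rewrite E1 E2 -!exprnP; ring.
Qed.

Lemma e_intpower_neq1 (n : int) : distinct_eigenvalues -> - k.*2%:Z <= n ->
  1 - e * X n != 0.
Proof.
move=> hdist kn; case: (lerP 0 n) => n0.
  by apply: lt1_sub; apply: small_mul normc_e _; rewrite (le_trans _ n0)// oppr_le0.
have [N nE] : exists N : nat, n = - N%:Z by exists `|n|%N; clear -n0; lia.
have NK : (N <= k.*2)%N by move: kn; rewrite nE; clear; lia.
rewrite subr_eq0; apply: contra (e_power_neq1 hdist NK) => /eqP h.
rewrite -[X in _ == X]mul1r [X in _ == X * _]h /X nE -exprnN -mulrA.
by rewrite mulVf ?mulr1 ?expf_neq0.
Qed.

Lemma regular_int (n : int) : distinct_eigenvalues -> 1 - k%:Z <= n ->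
  aw_regular Q a b c d (X n).
Proof.
move=> hdist kn; have X2 : X n ^+ 2 = X (n + n) by rewrite /X expfzDr// expr2.
apply/and4P; split=> //; rewrite -/e X2.
- by rewrite -mulrA XB; apply: e_intpower_neq1 => //; clear -kn; lia.
- by apply: e_intpower_neq1 => //; clear -kn; lia.
- have -> : e * X (n + n) / Q ^+ 2 = e * X (n + n - 1 - 1).
    by rewrite -!XB expr2 invfM !mulrA.
  by apply: e_intpower_neq1 => //; clear -kn; lia.
Qed.

Let ek : distinct_eigenvalues -> forall n : int, - (alpha + l)%:Z <= n -> 1 - e * X n != 0.
Proof. by move=> _ n kn; apply: lt1_sub; apply: small_mul normc_e kn. Qed.

(* The coefficients of the recurrence in x rather than 2 x. *)
Definition coef_up (n : int) : R[i] := rec_up Q a b c d (X n) / 2.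

Definition coef_mid (n : int) : R[i] := rec_mid Q a b c d (X n) / 2.

Definition coef_down (n : int) : R[i] := rec_down Q a b c d (X n) / 2.

Let two0 : (2 : R[i]) != 0. Proof. by rewrite pnatr_eq0. Qed.

Lemma coef_up_neq0 (n : nat) : distinct_eigenvalues -> coef_up n != 0.
Proof.
move=> hdist; have k0 : (0 < k)%N by case/andP: hk.
have rX : aw_regular Q a b c d (X n) by apply: regular_int => //; clear -k0; lia.
case/and4P: rX => _ r1 r2 _.
have h u : normc u < 1 -> 1 - u * X n != 0.
  by move=> u1; apply: lt1_sub; apply: (@small_mul _ 0); rewrite ?expr0//; clear; lia.
have bc1 : normc (b * c) < 1 by apply: normcM_lt1 => //; exact: ltW.
have bd1 : normc (b * d) < 1 by apply: normcM_lt1 => //; exact: ltW normc_d.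
have cd1 : normc (c * d) < 1 by apply: normcM_lt1 => //; exact: ltW normc_d.
have Q1 : normc Q < 1 by have := normQX 1; rewrite !expr1 => ->.
rewrite /coef_up /rec_up mulf_neq0 ?invr_eq0// mulf_neq0 ?invr_eq0//.
  by rewrite !mulf_neq0 ?resonance_a0 ?h.
by rewrite !mulf_neq0.
Qed.

Lemma coef_down_neq0 (n : int) : distinct_eigenvalues -> 1 - k%:Z <= n -> coef_down n != 0.
Proof.
move=> hdist kn; have /andP[k0 ka] := hk.
have rX := regular_int hdist kn; case/and4P: rX => _ r1 _ r3.
have eX : e * X n / Q ^+ 2 = e * X (n - 1 - 1) by rewrite -!XB expr2 invfM !mulrA.
rewrite /coef_down /rec_down mulf_neq0 ?invr_eq0// mulf_neq0 ?invr_eq0//; last first.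
  by rewrite !mulf_neq0 ?resonance_a0.
rewrite -/e eX -!(mulrA _ (X n)) XB !mulf_neq0//.
- by apply: ek => //; clear -kn ka hl; lia.
- by apply: lt1_sub; apply: small_mul (normc_au hb) _; clear -kn ka; lia.
- by apply: lt1_sub; apply: small_mul (normc_au hc) _; clear -kn ka; lia.
- by apply: lt1_sub; apply: small_mul (normc_au normc_d) _; clear -kn ka; lia.
Qed.

Lemma coef_up_N1 : coef_up (-1) = 0.
Proof.
by rewrite /coef_up /rec_up XS addNr /X expr0z subrr mulr0 !mul0r.
Qed.

Let two_mulC (x : R) : 2 * x%:C = (2 * x)%:C :> R[i].
Proof. by rewrite !mulr_natl rmorphMn. Qed.

Let normc_Q : normc Q < 1. Proof. by have := normQX 1; rewrite !expr1 => ->. Qed.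

Let qfactQ_neq0 n : qfact Q Q n != 0. Proof. exact: qfact_unit_neq0. Qed.

Definition sol1 (m : nat) (n : int) : R[i] :=
  aw_sum Q (Q / a) (Q / b) (Q / c) (Q / d) (2 * node m)%:C (alpha - m.+1) (Q * X n)^-1.

Definition sol2 (m : nat) (n : int) : R[i] :=
  alt_factor Q b c (alpha + l - 1) (X n) * aw_sum Q d a b c (2 * node m)%:C m (X n).

Lemma aw_base_split (u v x2 : R[i]) a' n : a' * x2 = u + v -> a' ^+ 2 = u * v ->
  aw_base Q a' x2 n = qfact Q u n * qfact Q v n.
Proof.
move=> h1 h2; rewrite -big_split; apply: eq_bigr => j _ /=.
by rewrite h2 mulrAC h1; ring.
Qed.

Let qhypE top bot N : (forall n, (N < n)%N -> qpochs q top n = 0) ->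
  qhyp q top bot = \sum_(i < N.+1) qpochs q top i / qpochs q (rcons bot Q) i * Q ^+ i.
Proof.
move=> h; apply: (@climn_eventually _ _ _ N.+1) => n Nn.
rewrite -(subnKC Nn); elim: (n - N.+1)%N => [|p IH]; first by rewrite addn0.
by rewrite addnS big_ord_recr /= IH h ?mul0r ?addr0// leq_addr.
Qed.

(** The resonance a = d q^alpha turns the node into a zero of a numerator factor: [aw_base] acquires
    q^(m-alpha+1) here and q^(-m) in [base2], so both series terminate for every n. *)
Let base1 m : (m < alpha)%N -> forall n,
  aw_base Q (Q / a) (2 * node m)%:C n =
  qfact Q (Q ^ (m%:Z - alpha%:Z + 1)) n * qfact Q (Q ^ (- m%:Z + alpha%:Z + 1) / a ^+ 2) n.
Proof.
move=> ma n; have d0 := resonance_d0; have ad := resonance_a.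
have e1 : Q ^ (m%:Z - alpha%:Z + 1) = Q * Q ^+ m / Q ^+ alpha.
  by rewrite !expfzDr// -exprnN -exprnP expr1z; ring.
have e2 : Q ^ (- m%:Z + alpha%:Z + 1) = Q * Q ^+ alpha / Q ^+ m.
  by rewrite !expfzDr// -exprnN -exprnP expr1z; ring.
have Qm : Q ^+ m != 0 by rewrite expf_neq0.
have Qa : Q ^+ alpha != 0 by rewrite expf_neq0.
rewrite e1 e2; apply: aw_base_split.
  rewrite node2E ad; move: (Q ^+ m) Qm (Q ^+ alpha) Qa => u u0 v v0.
  by field; rewrite ?d0 ?u0 ?v0.
rewrite ad; move: (Q ^+ m) Qm (Q ^+ alpha) Qa => u u0 v v0.
by field; rewrite ?d0 ?u0 ?v0.
Qed.

Let base2 m n : aw_base Q d (2 * node m)%:C n = qfact Q (Q ^+ (m + l)) n * qfact Q (Q ^- m) n.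
Proof.
have d0 := resonance_d0; have Qm : Q ^+ m != 0 by rewrite expf_neq0.
apply: aw_base_split; rewrite ?node2E exprD -resonance_dd.
  by move: (Q ^+ m) Qm => u u0; field; rewrite ?d0 ?u0.
by move: (Q ^+ m) Qm => u u0; field; rewrite ?u0.
Qed.

Let qpochs3 (u v w z : R[i]) n : qpochs q [:: u; v; w; z] n =
  qfact Q u n * qfact Q v n * qfact Q w n * qfact Q z n.
Proof. by rewrite /qpochs !big_cons big_nil mulr1 !mulrA. Qed.

Let top1_eq0 m n : (m < alpha)%N -> (alpha - m.+1 < n)%N ->
  qfact Q (Q ^ (m%:Z - alpha%:Z + 1)) n = 0.
Proof.
move=> ma h; apply: (qfact_eq0 h); rewrite exprnP -expfzDr//.
by rewrite (_ : _ + _ = 0) ?expr0z//; clear -ma; lia.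
Qed.

Lemma u1E m n : (m < alpha)%N -> u1 q a b c d alpha m n = sol1 m n.
Proof.
move=> ma; rewrite /u1 (@qhypE _ _ (alpha - m.+1)) => [|p hp]; last first.
  by rewrite qpochs3 top1_eq0// !mul0r.
apply: eq_bigr => i _; rewrite -/Q /= !qpochs3 /aw_coef /aw_dual base1//.
have a0 := resonance_a0; have d0 := resonance_d0; have Xn := X_neq0 n.
have -> : (Q * X n)^-1^-1 = Q ^ (n + 1) by rewrite invrK XS.
have -> : Q / a * (Q / b) * (Q / c) * (Q / d) * (Q * X n)^-1 / Q =
    (a * b * c * d * Q ^ (n - 2))^-1.
  rewrite (_ : n - 2 = n - 1 - 1); last by rewrite -addrA -opprD.
  rewrite -!/(X _) -!XB; move: (X n) Xn => u u0.
  by field; rewrite Q0 u0 a0 hb0 hc0 d0.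
have e2 u : Q / a * (Q / u) = Q ^+ 2 / (a * u) by rewrite invfM; ring.
by rewrite !e2; ring.
Qed.

Lemma u2E m n : u2 q a b c d alpha l m n = sol2 m n.
Proof.
rewrite /u2 /sol2; congr (_ * _).
  rewrite /alt_factor /qpochs !big_cons big_nil mulr1 XS -/Q; congr (_ / _).
rewrite (@qhypE _ _ m) => [|p hp]; last first.
  rewrite qpochs3 mulrC (qfact_eq0 hp) ?mul0r//.
  by rewrite mulVf ?expf_neq0.
apply: eq_bigr => i _; rewrite -/Q /= !qpochs3 /aw_coef /aw_dual base2.
have -> : (X n)^-1 = Q ^ (- n) by rewrite /X invr_expz.
have -> : d * a * b * c * X n / Q = a * b * c * d * Q ^ (n - 1).
  by rewrite -/(X _) -XB; ring.
rewrite [d * a]mulrC [d * b]mulrC [d * c]mulrC; ring.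
Qed.

(** Keeps the denominators of u1 away from 0 over the terms that occur: a vanishing factor would
    mean u = q^(i+2), against |u| < q^alpha. *)
Let small_power (u : R[i]) i : normc u < q ^+ alpha -> (i.+2 <= alpha)%N ->
  u != 0 -> Q ^+ 2 / u * Q ^+ i != 1.
Proof.
move=> ua ia u0; apply/eqP => h; have : u = Q ^+ i.+2.
  rewrite -[LHS]mulr1 -h !exprS expr0 !mulrA; field; exact: u0.
by move=> uE; move: ua; rewrite uE normQX ltNge ler_wiXn2l// ltW.
Qed.

Lemma sol1_rec m n : distinct_eigenvalues -> (m < alpha)%N -> 1 - k%:Z <= n ->
  (node m)%:C * sol1 m n =
  coef_up n * sol1 m (n + 1) + coef_mid n * sol1 m n + coef_down n * sol1 m (n - 1).
Proof.
move=> hdist ma kn; have a0 := resonance_a0; have d0 := resonance_d0.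
have rX := regular_int hdist kn.
have D u : normc (a * u) < q ^+ alpha -> u != 0 ->
    qfact Q (Q / a * (Q / u)) (alpha - m.+1) != 0.
  move=> au u0; apply: qfact_neq0 => j jn.
  have -> : Q / a * (Q / u) = Q ^+ 2 / (a * u) by rewrite invfM; ring.
  by apply: small_power; rewrite ?mulf_neq0//; clear -jn ma; lia.
have B0 : aw_base Q (Q / a) (2 * node m)%:C (alpha - m.+1).+1 = 0.
  by rewrite base1// top1_eq0// mul0r.
have := dual_sum_rec Q0 a0 hb0 hc0 d0 rX B0 (D b (normc_au hb) hb0)
  (D c (normc_au hc) hc0) (D d (normc_au normc_d) d0) (qfactQ_neq0 _).
move=> E.
apply: (mulfI two0); rewrite mulrA.
rewrite two_mulC.
rewrite [LHS]E /coef_up /coef_mid /coef_down /sol1 -XS -XB.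
by field.
Qed.

Lemma sol2_rec m n : distinct_eigenvalues -> 1 - k%:Z <= n ->
  (node m)%:C * sol2 m n =
  coef_up n * sol2 m (n + 1) + coef_mid n * sol2 m n + coef_down n * sol2 m (n - 1).
Proof.
move=> hdist kn; have a0 := resonance_a0; have d0 := resonance_d0.
have rX := regular_int hdist kn.
have D u : normc u < 1 -> qfact Q (d * u) m != 0.
  by move=> u1; apply: qfact_unit_neq0 => //; apply: normcM_lt1 (ltW u1); exact: normc_d.
have B0 : aw_base Q d (2 * node m)%:C m.+1 = 0.
  by rewrite base2 mulrC (@qfact_eq0 _ _ _ _ m) ?mul0r// mulVf ?expf_neq0.
have adE : a * d = Q ^+ (alpha + l - 1).+1.
  by rewrite resonance_ad; congr (_ ^+ _); clear -hl; lia.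
have := alt_sum_rec Q0 a0 d0 adE rX B0 (D a normc_a1) (D b hb) (D c hc) (qfactQ_neq0 _).
move=> E.
apply: (mulfI two0); rewrite mulrA.
rewrite two_mulC.
rewrite [LHS]E /coef_up /coef_mid /coef_down /sol2 -XS -XB.
by field.
Qed.

Lemma sol1_N1 m : (m < alpha)%N -> sol1 m (-1) = 1.
Proof.
move=> ma; rewrite /sol1 XS addNr /X expr0z invr1 /aw_sum big_ord_recl big1 => [|i _].
  rewrite addr0 /aw_coef /aw_dual /aw_base !qfact0 big_ord0 expr0 !mulr1.
  by rewrite divff ?oner_eq0.
by rewrite /aw_dual invr1 lift0 (@qfact_eq0 _ _ _ _ 0) ?mul0r ?mulr0// expr0 mulr1.
Qed.

(** The prefactor of u2 contains 1 - q^j q^(-j); the length alpha + l - 1 reaches this factor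
    because j <= k <= alpha and l > 0. *)
Lemma sol2_neg m (j : nat) : (0 < j)%N -> (j <= k)%N -> sol2 m (- j%:Z) = 0.
Proof.
move=> j0 jk; rewrite /sol2 /alt_factor (@qfact_eq0 _ _ (Q * X _) _ j.-1).
- by rewrite mulr0 !mul0r.
- by have /andP[_ ka] := hk; clear -ka jk j0 hl; lia.
- rewrite XS /X exprnP -expfzDr// (_ : _ + _ = 0) ?expr0z//; clear -j0; lia.
Qed.

Lemma sol2_0 m : sol2 m 0 != 0.
Proof.
rewrite /sol2 /X expr0z mulf_neq0//.
  rewrite /alt_factor expr1n divr1 !mulr1 mulf_neq0 ?qfactQ_neq0//.
  by apply: qfact_unit_neq0 => //; apply: normcM_lt1 => //; exact: ltW.
rewrite /aw_sum big_ord_recl big1 => [|i _].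
  rewrite addr0 /aw_coef /aw_dual /aw_base !qfact0 big_ord0 expr0 !mulr1.
  by rewrite divff ?oner_eq0.
by rewrite /aw_dual invr1 lift0 (@qfact_eq0 _ _ _ _ 0) ?mul0r ?mulr0// expr0 mulr1.
Qed.
Let aw_dual_poly a' b' c' d' i : exists p : {poly R[i]}, forall Y, Y != 0 ->
  aw_dual Q a' b' c' d' i Y = p.[Y^-1 + a' * b' * c' * d' * Y / Q].
Proof.
exists (\prod_(j < i) ((1 + a' * b' * c' * d' / Q * Q ^+ j ^+ 2)%:P - Q ^+ j *: 'X)).
move=> Y Y0; rewrite /aw_dual horner_prod -big_split; apply: eq_bigr => j _ /=.
rewrite hornerD hornerN hornerZ hornerX hornerC.
by field; rewrite Y0 Q0.
Qed.

Let aw_sum_poly a' b' c' d' x2 N : exists p : {poly R[i]}, forall Y, Y != 0 ->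
  aw_sum Q a' b' c' d' x2 N Y = p.[Y^-1 + a' * b' * c' * d' * Y / Q].
Proof.
have /choice[p hp] := aw_dual_poly a' b' c' d'.
exists (\sum_(i < N.+1) aw_coef Q a' b' c' d' x2 i *: p i) => Y Y0.
by rewrite horner_sum; apply: eq_bigr => i _; rewrite hornerZ hp.
Qed.

(** The factors 1 - bc q^j Y and 1 - q^(M-j) Y are paired and divided by Y, which leaves Y^(-1) + e
    Y / q minus a constant because e = bc q^(M+1). *)
Let alt_factor_poly : exists p : {poly R[i]}, forall Y, Y != 0 ->
  alt_factor Q b c (alpha + l - 1) Y = p.[Y^-1 + e * Y / Q].
Proof.
set M := (alpha + l - 1)%N.
have adE : e = b * c * Q ^+ M.+1.
  rewrite /e -(_ : a * d = Q ^+ M.+1); first by ring.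
  by rewrite resonance_ad; congr (_ ^+ _); clear -hl; rewrite /M; lia.
exists (\prod_(j < M) ('X - (b * c * Q ^+ j + Q ^+ (M - j))%:P)) => Y Y0.
rewrite horner_prod /alt_factor.
have -> : Y ^+ M = \prod_(j < M) Y by rewrite prodr_const card_ord.
have -> : qfact Q (Q * Y) M = \prod_(j < M) (1 - Q * Y * Q ^+ (M - j.+1)).
  by rewrite /qfact (reindex_inj rev_ord_inj).
rewrite -prodfV -!big_split; apply: eq_bigr => j _ /=.
rewrite hornerXsubC adE.
have -> : (M - j)%N = (M - j.+1).+1 by have := ltn_ord j; clear; lia.
have -> : Q ^+ M.+1 = Q ^+ j * Q ^+ (M - j.+1) * Q ^+ 2.
  by rewrite -!exprD; congr (_ ^+ _); have := ltn_ord j; clear; lia.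
rewrite (exprS Q (M - j.+1)); move: (Q ^+ j) (Q ^+ (M - j.+1)) => u v.
by field; rewrite Y0 Q0.
Qed.

Let eigenvalueE n : (X n)^-1 + e * X n / Q = aw_eigenvalue q a b c d n + (1 + e / Q).
Proof.
rewrite /aw_eigenvalue -/Q -/e (_ : Q ^ (n - 1) = X n / Q); last by rewrite XB.
rewrite (_ : Q ^ (- n) = (X n)^-1); last by rewrite invr_expz.
have Xn := X_neq0 n; move: (X n) Xn => u u0.
by field; rewrite u0 Q0.
Qed.

Lemma sol1_poly m : exists p : {poly R[i]}, forall n,
  p.[aw_eigenvalue q a b c d n] = sol1 m n.
Proof.
have a0 := resonance_a0; have d0 := resonance_d0.
have [p hp] := aw_sum_poly (Q / a) (Q / b) (Q / c) (Q / d) (2 * node m)%:C (alpha - m.+1).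
(* The variable of the dual series is Y = 1/(qX) with product of parameters q^4/e, and q X + q^2/(e
   X) is q^2/e times X^(-1) + e X / q. *)
exists (p \Po ((Q ^+ 2 / e) *: ('X + (1 + e / Q)%:P))) => n; have Xn := X_neq0 n.
rewrite horner_comp hornerZ hornerD hornerX hornerC -eigenvalueE /sol1 hp.
  congr (p.[_]); rewrite /e; move: (X n) Xn => u u0.
  by field; rewrite ?a0 ?d0 ?hb0 ?hc0 ?Q0 ?u0.
by rewrite invr_eq0 mulf_neq0.
Qed.

Lemma sol2_poly m : exists p : {poly R[i]}, forall n,
  p.[aw_eigenvalue q a b c d n] = sol2 m n.
Proof.
have [p1 h1] := alt_factor_poly.
have [p2 h2] := aw_sum_poly d a b c (2 * node m)%:C m.
exists ((p1 * p2) \Po ('X + (1 + e / Q)%:P)) => n; have Xn := X_neq0 n.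
rewrite horner_comp hornerD hornerX hornerC -eigenvalueE /sol2 hornerM h1// h2//.
by congr (_ * p2.[_]); rewrite /e; ring.
Qed.

Let params_neq0 u i : u \in [:: a * b; a * c; a * d; b * c; b * d; c * d; Q] ->
  qfact Q u i != 0.
Proof.
have a1 := normc_a1; have d1 := normc_d.
rewrite !inE => u7; apply: qfact_unit_neq0 => //.
by case/or4P: u7 => [/eqP->|/eqP->|/eqP->|/or4P[/eqP->|/eqP->|/eqP->|/eqP->]] //;
  apply: normcM_lt1 => //; exact: ltW.
Qed.

Definition aw_poly (n : nat) : {poly R[i]} := ttp coef_up coef_mid coef_down n.

Lemma horner_aw_poly n x : distinct_eigenvalues ->
  (aw_poly n).[x] = aw_full Q a b c d (2 * x) n.
Proof.
move=> hdist; have a0 := resonance_a0; have d0 := resonance_d0.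
have k0 : (0 < k)%N by case/andP: hk.
have f0 : aw_full Q a b c d (2 * x) 0 = 1.
  rewrite /aw_full /norm_factor /aw_sum big_ord1 /aw_coef /aw_dual /aw_base !qfact0 !expr0.
  by rewrite big_ord0 !mulr1 !divr1 mulr1.
have /(_ _ _ n (leqnSn n)) U := @ttp_unique _ (fun i : nat => coef_up i)
  (fun i : nat => coef_mid i) (fun i : nat => coef_down i)
  (aw_full Q a b c d (2 * x)) x n.+1.
rewrite [RHS]U ?f0 ?mul1r// => [i _|]; first exact: coef_up_neq0.
move=> i _; have rX : aw_regular Q a b c d (X i).
  by apply: regular_int => //; clear -k0; lia.
have := aw_full_rec Q0 a0 (2 * x) rX params_neq0; rewrite exprnP -/(X i) => E.
apply: (mulfI two0); rewrite mulrA [LHS]E /coef_up /coef_mid /coef_down.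
by case: i {rX E} => [|i]; field.
Qed.

Let joukowski_neq0 (x : R[i]) : joukowski_inv x != 0.
Proof.
have E : joukowski_inv x * (x - sqrtC (x ^+ 2 - 1)) = 1.
  by rewrite mulrC -subr_sqr sqrtCK opprB addrC subrK.
by apply/eqP => w0; move/eqP: E; rewrite w0 mul0r eq_sym oner_eq0.
Qed.

Lemma xi_askey_wilsonE n x : distinct_eigenvalues ->
  xi_askey_wilson q a b c d x n = (Yz coef_up coef_mid coef_down n).[x].
Proof.
move=> hdist; case: n => n; last by rewrite horner0.
have a0 := resonance_a0; rewrite /Yz -/(aw_poly n) horner_aw_poly//.
rewrite /xi_askey_wilson /askey_wilson /askey_wilson_z.
set z := joukowski_inv x; have z0 : z != 0 := joukowski_neq0 x.
have zE : 2 * x = z + z^-1 by rewrite -{1}(joukowski_invK x) mulrC divfK.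
have H3 u v w i : qpochs q [:: u; v; w] i = qfact Q u i * qfact Q v i * qfact Q w i.
  by rewrite /qpochs !big_cons big_nil mulr1 !mulrA.
rewrite (@qhypE _ _ n) => [|p hp]; last by rewrite qpochs3 qfact_inv_eq0 ?mul0r.
set S := bigop _ _ _; have -> : S = aw_sum Q a b c d (2 * x) n (Q ^+ n).
  rewrite /S; apply: eq_bigr => i _; rewrite -/Q /= !qpochs3 /aw_coef /aw_dual.
  have -> : aw_base Q a (2 * x) i = qfact Q (a * z) i * qfact Q (a * z^-1) i.
    by apply: aw_base_split; [rewrite zE mulrDr | field].
  have -> : a * b * c * d * Q ^+ n / Q = a * b * c * d * Q ^ (n%:Z - 1).
    by rewrite -/(X _) -XB /X -exprnP mulrA.
  by ring.
rewrite /aw_full /norm_factor /xi H3 qpochs3 -/Q -/e !invfM.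
rewrite -[qpoch q _ n]/(qfact Q (e / Q) n); ring.
Qed.

(** * The functionals of the two measures, and the correspondence between masses and phi *)

Section Functionals.
Variable m : 'I_k -> 'I_alpha.
Hypothesis hm : injective m.
Hypothesis hdist : distinct_eigenvalues.

Let x (j : 'I_k) : R[i] := (node (m j))%:C.

Let x_inj : injective x.
Proof. by move=> i j /(@complexI R)/node_inj/val_inj/hm. Qed.

Let k_gt0 : (0 < k)%N. Proof. by case/andP: hk. Qed.

Definition moment (P : {poly R[i]}) : R[i] :=
  cint (-1) 1 (fun t => P.[t%:C] * aw_kernel q a b c d t).

Let ccont_poly (P : {poly R[i]}) : ccont (-1) 1 (fun t : R => P.[t%:C]).
Proof. by apply: ccont_horner; exact: ccont_id. Qed.

Let cK : ccont (-1) 1 (aw_kernel q a b c d) := ccont_kernel q01 normc_a1 hb hc normc_d.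

Lemma scalar_moment : scalar moment.
Proof.
move=> u P P'; rewrite /moment -cintZ; last exact: ccontM (ccont_poly P) cK.
rewrite -cintD; last 2 first.
- exact: ccontM (ccont_cst _ _ _) (ccontM (ccont_poly P) cK).
- exact: ccontM (ccont_poly P') cK.
by apply: eq_cint => t _; rewrite hornerD hornerZ; ring.
Qed.

Let mom : {scalar {poly R[i]}} := scalar_of scalar_moment.

Lemma moment_aw_poly n : moment (aw_poly n.+1) = 0.
Proof.
have a0 := resonance_a0; have d0 := resonance_d0.
pose S t : R[i] := aw_sum Q a b c d (2 * t)%:C n.+1 (Q ^+ n.+1).
have cS : ccont (-1) 1 (fun t => S t * aw_kernel q a b c d t).
  pose w i : R[i] := Q ^+ i / (qfact Q (a * b) i * qfact Q (a * c) i *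
    qfact Q (a * d) i * qfact Q Q i) * aw_dual Q a b c d i (Q ^+ n.+1).
  have cB i : ccont (-1) 1 (fun t : R => aw_base Q a (2 * t)%:C i).
    elim: i => [|i IH].
      by apply: ccont_ext (ccont_cst _ _ 1) => t; rewrite /aw_base big_ord0.
    have cf : ccont (-1) 1 (fun t : R =>
        (1 + a ^+ 2 * Q ^+ i ^+ 2) + (- (a * Q ^+ i)) * (2 * t)%:C : R[i]).
      apply: ccontD; first exact: ccont_cst.
      by apply: ccontM; [exact: ccont_cst | exact: ccont_2x].
    by apply: ccont_ext (ccontM IH cf) => t; rewrite aw_baseS; ring.
  have cw (i : 'I_n.+2) : ccont (-1) 1 (fun t : R => aw_base Q a (2 * t)%:C i * w i).
    exact: ccontM (cB i) (ccont_cst _ _ _).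
  apply: ccont_ext (ccontM (ccont_sum _ cw) cK) => t; congr (_ * _).
  by apply: eq_bigr => i _; rewrite /aw_coef /w; ring.
have -> : moment (aw_poly n.+1) = cint (-1) 1 (fun t =>
    norm_factor Q a b c d n.+1 * (S t * aw_kernel q a b c d t)).
  by apply: eq_cint => t _; rewrite horner_aw_poly// /aw_full two_mulC -[LHS]mulrA.
rewrite cintZ// (_ : cint _ _ _ = 0) ?mulr0//.
exact: (aw_sum_mass q01 hb hc normc_d normc_a1 _ hb0 hc0 d0 a0).
Qed.

Let size_aw_poly n : size (aw_poly n) = n.+1.
Proof. by apply: size_ttp => i _; exact: coef_up_neq0. Qed.

(** The polynomials [aw_poly] form a basis, and all but the first have moment 0. If the first had
    too, every moment of the kernel would vanish. *)
Lemma moment_1 : moment 1 != 0.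
Proof.
have [P0 hP] := kernel_moment_neq0 q01 normc_a1 hb hc normc_d.
apply/eqP => m1; move/eqP: hP; apply; rewrite -/(moment P0).
have [n] := ubnP (size P0); elim: n P0 => [//|n IH] P sP.
have mY j : moment (aw_poly j) = 0.
  by case: j => [|j]; [exact: m1 | exact: moment_aw_poly].
have [->|P_neq0] := eqVneq P 0; first by rewrite -[moment]/(mom : _ -> _) linear0.
have sP0 : (0 < size P)%N by rewrite size_poly_gt0.
pose r := P`_(size P).-1 / (aw_poly (size P).-1)`_(size P).-1.
have sY : size (aw_poly (size P).-1) = size P by rewrite size_aw_poly prednK.
have Yn : (aw_poly (size P).-1)`_(size P).-1 != 0.
  by rewrite -{2}sY -lead_coefE lead_coef_eq0 -size_poly_eq0 sY -lt0n.
have -> : P = r *: aw_poly (size P).-1 + (P - r *: aw_poly (size P).-1).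
  by rewrite addrC subrK.
rewrite scalar_moment mY mulr0 add0r IH//.
suff : (size (P - r *: aw_poly (size P).-1)%R <= (size P).-1)%N.
  by move=> h; rewrite (leq_ltn_trans h)// -ltnS prednK.
apply/leq_sizeP => j; rewrite leq_eqVlt => /predU1P[<-|jn].
  by rewrite coefB coefZ /r divfK// subrr.
rewrite coefB coefZ !nth_default ?mulr0 ?subr0//; last by rewrite -(prednK sP0).
by rewrite sY -(prednK sP0).
Qed.

Let prodx (t : R) : R := \prod_(j < k) (t - node (m j)).

Let prodx_neq0 t : -1 <= t <= 1 -> prodx t != 0.
Proof.
move=> t1; apply/prodf_neq0 => j _; rewrite subr_eq0; apply/eqP => tE.
by have := node_gt1 (m j); rewrite -tE ltNge ler_norml t1.
Qed.

Let ccont_prodxV : ccont (-1) 1 (fun t => ((prodx t)%:C)^-1 : R[i]).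
Proof.
suff h (r : seq 'I_k) : ccont (-1) 1
    (fun t : R => ((\prod_(j <- r) (t - node (m j)))%:C)^-1 : R[i]) by exact: h.
elim: r => [|j r IH].
  by apply: ccont_ext (ccont_cst _ _ 1) => t; rewrite big_nil invr1.
have cj : ccont (-1) 1 (fun t : R => ((t - node (m j))^-1)%:C).
  apply: ccont_real; apply/subspace_continuousP => t /=; rewrite in_itv /= => t1.
  apply: cvgV; last by apply: cvgB; [exact: cvg_within | exact: cvg_cst].
  rewrite subr_eq0; apply/eqP => tE.
  by have := node_gt1 (m j); rewrite -tE ltNge ler_norml t1.
apply: ccont_ext (ccontM cj IH) => t.
by rewrite big_cons rmorphM /= invfM fmorphV.
Qed.

Definition quotient_moment (P : {poly R[i]}) : R[i] :=
  cint (-1) 1 (fun t => P.[t%:C] / (prodx t)%:C * aw_kernel q a b c d t).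

Let ccont_quotient (P : {poly R[i]}) :
  ccont (-1) 1 (fun t => P.[t%:C] / (prodx t)%:C * aw_kernel q a b c d t).
Proof. exact: ccontM (ccontM (ccont_poly P) ccont_prodxV) cK. Qed.

Lemma scalar_quotient_moment : scalar quotient_moment.
Proof.
move=> u P P'; rewrite /quotient_moment -cintZ// -cintD//.
  by apply: eq_cint => t _; rewrite hornerD hornerZ; ring.
exact: ccontM (ccont_cst _ _ _) (ccont_quotient P).
Qed.

Lemma horner_nodal_real t : (nodal x).[t%:C] = (prodx t)%:C.
Proof.
rewrite horner_prod rmorph_prod; apply: eq_bigr => j _.
by rewrite hornerXsubC rmorphB.
Qed.

Definition mass_functional (nu : 'I_k -> R[i]) (P : {poly R[i]}) : R[i] :=
  quotient_moment P + \sum_(j < k) nu j * P.[x j].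

Lemma muhat_integralE nu (P : {poly R[i]}) :
  muhat_integral q a b c d (fun j => mass_point q eps l (m j)) nu
    (fun t => P.[t%:C]) = mass_functional nu P.
Proof.
rewrite /muhat_integral aw_integral_cint//; first exact: normc_a1.
exact: normc_d.
Qed.

Lemma scalar_mass_functional nu : scalar (mass_functional nu).
Proof.
move=> u P P'; rewrite /mass_functional scalar_quotient_moment mulrDr mulr_sumr.
rewrite addrACA -big_split; congr (_ + _).
by apply: eq_bigr => j _; rewrite hornerD hornerZ /=; ring.
Qed.

Lemma quotient_moment_nodal P : quotient_moment (nodal x * P) = moment P.
Proof.
apply: eq_cint => t t1; congr (_ * _); rewrite hornerM horner_nodal_real mulrAC divff ?mul1r//.
by rewrite -(rmorph0 (real_complex R)) (inj_eq (@complexI R)) prodx_neq0.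
Qed.

Lemma mass_functional_nodal nu P : mass_functional nu (nodal x * P) = moment P.
Proof.
rewrite /mass_functional quotient_moment_nodal big1 ?addr0// => j _.
by rewrite hornerM horner_nodal mul0r mulr0.
Qed.

Lemma quotient_moment_but nu i : mass_functional nu (nodal_but x i) =
  quotient_moment (nodal_but x i) + nu i * (nodal_but x i).[x i].
Proof.
rewrite /mass_functional (bigD1 i)//= [X in _ + (_ + X)]big1 ?addr0// => j ji.
by rewrite horner_nodal_but// mulr0.
Qed.

Section Transform.
Variable phi : 'I_k -> {poly R[i]}.

Let phiz (i : 'I_k) (n : int) : R[i] := (phi i).[aw_eigenvalue q a b c d n].

Lemma tauE n : tau q a b c d phi n = tau_det phiz n.
Proof.
by congr (\det _); apply/matrixP => i j; rewrite !mxE tnth_mktuple.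
Qed.

Lemma phatE_darboux (n : nat) y : phat q a b c d phi n%:Z y =
  (darboux_poly coef_up coef_mid coef_down phiz n).[y].
Proof.
rewrite horner_sum /phat /wronskian.
transitivity (\det (phi_rows phiz n%:Z
    (fun j => (Yz coef_up coef_mid coef_down (n%:Z - j%:Z)).[y]))); last first.
  by rewrite det_phi_rows; apply: eq_bigr => j _; rewrite hornerZ mulrC.
congr (\det _); apply/matrixP => i j; rewrite !mxE (tnth_nth (fun=> 0)).
rewrite nth_rcons size_tuple; case: unliftP => [i' ->|->] /=; last first.
  by rewrite ltnn eqxx xi_askey_wilsonE.
have -> : bump k i' = i' by rewrite /bump leqNgt ltn_ord.
by rewrite ltn_ord (nth_map i') ?size_enum_ord ?ltn_ord// nth_ord_enum.
Qed.

Variables (nu t : 'I_k -> R[i]).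
Hypothesis t_neq0 : forall i, t i != 0.
Hypothesis phi_rec : forall i (n : int), 1 - k%:Z <= n ->
  x i * phiz i n = coef_up n * phiz i (n + 1) + coef_mid n * phiz i n +
    coef_down n * phiz i (n - 1).
Hypothesis phi_0 : forall i, phiz i 0 = t i * mass_functional nu (nodal_but x i).
Hypothesis phi_N1 : forall i, phiz i (-1) = - (t i * moment 1 / coef_down 0).

Let J : {scalar {poly R[i]}} := scalar_of (scalar_mass_functional nu).

Lemma phat_orthogonal : (forall n : int, -1 <= n -> tau q a b c d phi n != 0) ->
  orthogonal_polynomials
    (muhat_integral q a b c d (fun j => mass_point q eps l (m j)) nu)
    (fun n => phat q a b c d phi n%:Z).
Proof.
move=> tau0; have taud n : -1 <= n -> tau_det phiz n != 0 by rewrite -tauE; exact: tau0.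
have [sP oP nP] := @darboux_orthogonal _ _ coef_up coef_mid coef_down
  (fun n => coef_up_neq0 n hdist) (fun n => @coef_down_neq0 n hdist) k_gt0 coef_up_N1
  mom moment_aw_poly moment_1 x J x_inj (mass_functional_nodal nu) t phiz t_neq0
  phi_rec phi_0 phi_N1 taud.
pose P n := darboux_poly coef_up coef_mid coef_down phiz n.
have E n p : (fun u : R => phat q a b c d phi n%:Z u%:C * phat q a b c d phi p%:Z u%:C) =
    (fun u : R => (P n * P p).[u%:C]).
  by apply/funext => u; rewrite !phatE_darboux hornerM.
split=> [n|n p np|n]; first by exists (P n); split=> // y; rewrite phatE_darboux.
  by rewrite E muhat_integralE; exact: oP.
by rewrite E muhat_integralE; exact: nP.
Qed.

Lemma hankel_tau_neq0 (n : nat) : hankel (mass_functional nu) n != 0 ->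
  tau q a b c d phi (n%:Z - 1) != 0.
Proof.
move=> hn; rewrite tauE.
apply: (@tau_det_neq0 _ _ coef_up coef_mid coef_down
  (fun n => coef_up_neq0 n hdist) (fun n => @coef_down_neq0 n hdist) k_gt0 coef_up_N1
  mom moment_aw_poly moment_1 x J x_inj (mass_functional_nodal nu) t phiz t_neq0
  phi_rec phi_0 phi_N1) => S sS SI.
exact: (hankel_nondegenerate (scalar_mass_functional nu) hn sS SI).
Qed.

End Transform.
Let eig (n : int) : R[i] := aw_eigenvalue q a b c d n.

Let combination_rec (phi : {poly R[i]}) (A B : R[i]) j :
  (forall n, phi.[eig n] = A * sol1 (m j) n + B * sol2 (m j) n) ->
  forall n : int, 1 - k%:Z <= n -> x j * phi.[eig n] = coef_up n * phi.[eig (n + 1)] +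
    coef_mid n * phi.[eig n] + coef_down n * phi.[eig (n - 1)].
Proof.
move=> hphi n kn; rewrite !hphi mulrDr (mulrCA _ A) (mulrCA _ B).
have r1 := sol1_rec hdist (ltn_ord (m j)) kn; have r2 := sol2_rec (m j) hdist kn.
by rewrite -[x j]/((node (m j))%:C) r1 r2; ring.
Qed.

Let coef_down_0 : coef_down 0 != 0.
Proof. by apply: coef_down_neq0 => //; move: k_gt0; clear; lia. Qed.

Let sol2_N1 j : sol2 j (-1) = 0.
Proof. exact: (@sol2_neg j 1). Qed.

Lemma span_orthogonal (phi : 'I_k -> {poly R[i]}) :
  (forall j, in_span_u q a b c d alpha l (m j) (phi j)) ->
  (forall n : int, -1 <= n -> tau q a b c d phi n != 0) ->
  exists nu : 'I_k -> R[i], orthogonal_polynomials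
    (muhat_integral q a b c d (fun j => mass_point q eps l (m j)) nu)
    (fun n => phat q a b c d phi n%:Z).
Proof.
move=> /choice[A /choice[B AB]] tau0.
have hphi j n : (phi j).[eig n] = A j * sol1 (m j) n + B j * sol2 (m j) n.
  by rewrite AB u1E// u2E.
have A_neq0 j : A j != 0.
  (* Without its u1 component, phi^(j) vanishes at -1, ..., -k and contributes a zero row to tau at
     -1. *)
  apply: contraTneq (tau0 (-1) (lexx _)) => A0; rewrite negbK tauE.
  rewrite /tau_det (expand_det_row _ j) big1// => i _.
  rewrite mxE hphi A0 mul0r add0r.
  have -> : -1 - i%:Z = - i.+1%:Z by clear; lia.
  by rewrite sol2_neg ?mulr0 ?mul0r.
have m1 := moment_1.
(* The value at -1 is A_j and determines the scale t_j; the value at 0 then determines the mass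
   nu_j. *)
pose t j := - A j * coef_down 0 / moment 1.
have t_neq0 j : t j != 0.
  apply: mulf_neq0; last by rewrite invr_eq0.
  by apply: mulf_neq0 => //; rewrite oppr_eq0.
pose nu j := ((phi j).[eig 0] / t j - quotient_moment (nodal_but x j)) /
  (nodal_but x j).[x j].
exists nu; apply: (phat_orthogonal t_neq0 (fun j => combination_rec (hphi j)) _ _ tau0) => j.
- by rewrite quotient_moment_but divfK ?nodal_but_neq0// subrKC mulrC divfK.
- rewrite [LHS]hphi sol1_N1// sol2_N1 mulr0 addr0 mulr1 /t.
  by field; rewrite m1 coef_down_0.
Qed.

(** The same two conditions solved the other way, with scale 1: the value at -1 gives A, and the
    value at 0 gives B_j because u2 is nonzero there. *)
Lemma masses_orthogonal (nu : 'I_k -> R[i]) :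
  (forall n, hankel (mass_functional nu) n != 0) ->
  exists phi : 'I_k -> {poly R[i]},
    (forall j, in_span_u q a b c d alpha l (m j) (phi j)) /\
    orthogonal_polynomials
      (muhat_integral q a b c d (fun j => mass_point q eps l (m j)) nu)
      (fun n => phat q a b c d phi n%:Z).
Proof.
move=> hn; have m1 := moment_1.
have /choice[p1 p1E] := sol1_poly.
have /choice[p2 p2E] := sol2_poly.
pose A := - (moment 1 / coef_down 0).
pose B j := (mass_functional nu (nodal_but x j) - A * sol1 (m j) 0) / sol2 (m j) 0.
pose phi j := A *: p1 (m j) + B j *: p2 (m j).
have hphi j n : (phi j).[eig n] = A * sol1 (m j) n + B j * sol2 (m j) n.
  by rewrite hornerD !hornerZ p1E p2E.
have phi_rec j := combination_rec (hphi j).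
have phi_0 j : (phi j).[eig 0] = 1 * mass_functional nu (nodal_but x j).
  by rewrite hphi divfK ?sol2_0// subrKC mul1r.
have phi_N1 j : (phi j).[eig (-1)] = - (1 * moment 1 / coef_down 0).
  by rewrite hphi sol1_N1// sol2_N1 mulr0 addr0 mulr1 mul1r.
have one_neq0 (j : 'I_k) : (1 : R[i]) != 0 by exact: oner_neq0.
exists phi; split=> [j|].
  by exists A, (B j) => n; rewrite u1E// u2E -hphi.
apply: (phat_orthogonal one_neq0 phi_rec phi_0 phi_N1) => n n1.
have -> : n = (absz (n + 1)%R)%:Z - 1 by clear -n1; lia.
exact: (hankel_tau_neq0 one_neq0 phi_rec phi_0 phi_N1 (hn _)).
Qed.

Lemma hankel_moment_neq0 n : hankel moment n != 0.
Proof.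
apply: (hankel_neq0 scalar_moment) => S sS SI; apply/eqP; apply/negPn/negP => S0.
have sS0 : (0 < size S)%N by rewrite size_poly_gt0.
have := @L_mulY_neq0 _ k coef_up coef_mid coef_down
  (fun n => coef_up_neq0 n hdist) (fun n => @coef_down_neq0 n hdist) k_gt0
  mom moment_aw_poly moment_1 S (size S).-1.
rewrite prednK// => /(_ erefl)/eqP; apply.
by apply: SI; rewrite size_aw_poly prednK.
Qed.

Import -(notations) mpoly.

(** The Hankel determinant with the masses as indeterminates, so that its nonvanishing is an
    algebraic condition on nu. *)
Definition mass_hankel_poly n : mpoly k R[i] :=
  \det (\matrix_(i < n, j < n) (mpolyC k (quotient_moment 'X^(i + j)) +
    \sum_(r < k) (x r ^+ (i + j)) *: mpolyX R[i] (mnm1 r))).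

Lemma meval_mass_hankel nu n :
  meval nu (mass_hankel_poly n) = hankel (mass_functional nu) n.
Proof.
rewrite -det_map_mx; congr (\det _); apply/matrixP => i j; rewrite !mxE.
rewrite rmorphD /= mevalC rmorph_sum; congr (_ + _); apply: eq_bigr => r _.
by rewrite /= mevalZ mevalXU hornerXn mulrC.
Qed.

(** One hypersurface for each order n; [masses_hankel] supplies, order by order, a choice of masses
    off it, so each is proper. *)
Lemma generic_masses : generically (fun nu : 'I_k -> R[i] =>
  forall n, hankel (mass_functional nu) n != 0).
Proof.
exists (fun n => [set mass_hankel_poly n]); split=> [n|nu hnu n]; last first.
  apply/eqP => h; apply: (hnu n) => p ->.
  by rewrite meval_mass_hankel.
move=> Z; have us : uniq [seq x j | j <- enum 'I_k].
  by rewrite map_inj_uniq ?enum_uniq.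
have [|nu] := masses_hankel n scalar_moment scalar_quotient_moment hankel_moment_neq0 us.
  by move=> p; rewrite big_map big_enum; exact: quotient_moment_nodal.
move/eqP; apply.
have : zero_locus [set mass_hankel_poly n] (fun j => nu (x j)) by rewrite Z.
move=> /(_ _ erefl); rewrite meval_mass_hankel => h; rewrite -[RHS]h.
congr (\det _); apply/matrixP => i j; rewrite !mxE.
by rewrite big_map big_enum.
Qed.

End Functionals.

(** The columns of tau at -1 are values at the eigenvalues of -1, ..., -k, so a coincidence of two
    of these makes two columns equal. *)
Lemma tau_distinct (phi : 'I_k -> {poly R[i]}) :
  tau q a b c d phi (-1) != 0 -> distinct_eigenvalues.
Proof.
move=> tau0 i j i0 ij jk; apply: contra tau0 => /eqP E.
have i1k : (i.-1 < k)%N by clear -i0 ij jk; lia.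
have j1k : (j.-1 < k)%N by clear -i0 ij jk; lia.
rewrite /tau /wronskian -det_tr.
rewrite (@determinant_alternate _ _ _ (Ordinal i1k) (Ordinal j1k))//.
  by rewrite -val_eqE /=; clear -i0 ij; lia.
move=> r; rewrite !mxE !tnth_mktuple /=.
have -> : -1 - i.-1%:Z = - i%:Z by clear -i0; lia.
have -> : -1 - j.-1%:Z = - j%:Z by clear -i0 ij; lia.
by rewrite E.
Qed.

End Resonance.

Theorem theorem6p2 (R : realType) (q eps : R) (alpha l k : nat)
    (a b c d : R[i]) (m : 'I_k -> 'I_alpha)
    (hq : 0 < q < 1) (heps : eps = 1 \/ eps = -1)
    (hl : (0 < l)%N) (hk : (0 < k <= alpha)%N)
    (hd : d = (eps * q `^ (l%:R / 2))%:C)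
    (ha : a = (eps * q `^ (alpha%:R + l%:R / 2))%:C)
    (hb0 : b != 0) (hc0 : c != 0) (hb : `|b| < 1) (hc : `|c| < 1)
    (hm : injective m) :
  (forall phi : 'I_k -> {poly R[i]},
      (forall j, in_span_u q a b c d alpha l (m j) (phi j)) ->
      standing_conditions q a b c d phi ->
      exists nu : 'I_k -> R[i],
        orthogonal_polynomials
          (muhat_integral q a b c d (fun j => mass_point q eps l (m j)) nu)
          (fun n => phat q a b c d phi n%:Z))
  /\
  ((forall i j : nat, (0 < i)%N -> (i < j)%N -> (j <= k)%N ->
      aw_eigenvalue q a b c d (- i%:Z) != aw_eigenvalue q a b c d (- j%:Z)) ->
   generically (fun nu : 'I_k -> R[i] =>
      exists phi : 'I_k -> {poly R[i]},
        (forall j, in_span_u q a b c d alpha l (m j) (phi j)) /\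
        orthogonal_polynomials
          (muhat_integral q a b c d (fun j => mass_point q eps l (m j)) nu)
          (fun n => phat q a b c d phi n%:Z))).
Proof.
(* The hypotheses use the norm with values in [R[i]]; all estimates use the real-valued [normc]. *)
have normc_lt1 (z : R[i]) : `|z| < 1 -> normc z < 1.
  by rewrite normc_def -(rmorph1 (real_complex R)) ltcR; case: z.
have b1 := normc_lt1 _ hb; have c1 := normc_lt1 _ hc.
split=> [phi hphi [tau0 _]|hdist].
  have hdist := tau_distinct (tau0 (-1) (lexx _)).
  exact: (span_orthogonal hq heps hl hk hd ha hb0 hc0 b1 c1 hm hdist hphi tau0).
have [S [Sproper hS]] :=
  generic_masses hq heps hl hk hd ha hb0 hc0 b1 c1 hm hdist.
exists S; split=> // nu /hS hn.
exact: (masses_orthogonal hq heps hl hk hd ha hb0 hc0 b1 c1 hm hdist hn).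
Qed.
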